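(* Let $S$ be a finite nonempty set of primes, $l=\#S$, $d,m\ge1$, $n=d+m$. For each $\nu\in S$ let $\mathcal{U}_\nu\subseteq\mathbb{Z}_\nu^d$ be open, $\mathbf{f}_\nu:\mathcal{U}_\nu\to\mathbb{Z}_\nu^m$ a $C^2$ map, $\mathbf{F}_\nu(\mathbf{x})=(\mathbf{x},\mathbf{f}_\nu(\mathbf{x}))$, $\mathcal{M}_\nu=\mathbf{F}_\nu(\mathcal{U}_\nu)$; let $\mathcal{U}=\prod_{\nu\in S}\mathcal{U}_\nu$ and $\mathbf{F}((\mathbf{x}_\nu)_\nu)=(\mathbf{F}_\nu(\mathbf{x}_\nu))_\nu\in\mathbb{Z}_S^n$. Let $\boldsymbol{\tau}=(\tau_{i,\nu})_{1\le i\le n,\nu\in S}\in\mathbb{R}_+^{nl}$ satisfy (a) $\sum_{i=1}^n\sum_{\nu\in S}\tau_{i,\nu}=n+1$; (b) $\min_{1\le i\le d}\tau_{i,\nu}\ge\max_{1\le j\le m}\tau_{d+j,\nu}$ for all $\nu\in S$; (c) $\frac{1}{n+1}\sum_{i=1}^n\tau_{i,\nu}<\tau_{j,\nu}$ for all $1\le j\le n$, $\nu\in S$. For $\nu\in S$ define $\boldsymbol{\tau}^\nu=(\tau^\nu_{i,\sigma})_{1\le i\le n,\ \sigma\in S\setminus\{\nu\}}$ by $\tau^\nu_{i,\sigma}=\tau_{i,\sigma}\big/\big(1-\frac{1}{n+1}\sum_{k=1}^n\tau_{k,\nu}\big)$. Suppose that for every $\nu\in S$ with $\min_{1\le i\le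 n}\tau_{i,\nu}\le1$, $$\omega_{\boldsymbol{\tau}^\nu}\Big(\prod_{\sigma\in S\setminus\{\nu\}}\mathcal{M}_\sigma\Big)<\frac{1-\frac{1}{n+1}\sum_{i=1}^n\tau_{i,\nu}}{1-\min_{1\le i\le n}\tau_{i,\nu}}.$$ Then $\mu_{S,d}\big(\mathbf{F}^{-1}(\mathbf{Bad}^{(S)}_n(\boldsymbol{\tau}))\big)=0$.
   Context: For a prime $\nu$, $\mathbb{Q}_\nu$ is the field of $\nu$-adic numbers with absolute value $|\cdot|_\nu$ ($|\nu|_\nu=\nu^{-1}$), $\mathbb{Z}_\nu=\{x:|x|_\nu\le1\}$; $C^2$ is in the sense of ultrametric calculus. For a finite set $T$ of primes, $\mathbb{Q}_T=\prod_{\nu\in T}\mathbb{Q}_\nu$, $\mathbb{Z}_T=\prod_{\nu\in T}\mathbb{Z}_\nu$, and $\mu_{T,k}$ is the Haar measure on $\mathbb{Q}_T^k$ normalized so $\mu_{T,k}(\mathbb{Z}_T^k)=1$. Points of $\mathbb{Q}_T^n$ are written $\mathbf{y}=(y_{i,\nu})_{1\le i\le n,\nu\in T}$. For $\tilde{\mathbf{b}}=(b_0,\dots,b_n)\in\mathbb{Z}^{n+1}$, $\|\tilde{\mathbf{b}}\|_\infty=\max_i|b_i|$. Bad set: for $c>0$, $W(c;\boldsymbol{\tau})$ is the set of $\mathbf{y}\in\mathbb{Z}_S^n$ such that for infinitely many $\tilde{\mathbf{b}}\in\mathbb{Z}^{n+1}$, $|b_0y_{i,\nu}-b_i|_\nu<c\|\tilde{\mathbf{b}}\|_\infty^{-\tau_{i,\nu}}$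 for all $1\le i\le n$, $\nu\in S$; $\mathbf{Bad}^{(S)}_n(\boldsymbol{\tau})=W(1;\boldsymbol{\tau})\setminus\bigcap_{k\in\mathbb{N}}W(\tfrac1k;\boldsymbol{\tau})$. Diophantine exponents: for weights $\boldsymbol{\kappa}=(\kappa_{i,\nu})_{1\le i\le n,\nu\in T}$ with positive entries summing to $n+1$ and $\mathbf{y}\in\mathbb{Q}_T^n$, $\omega_{\boldsymbol{\kappa}}(\mathbf{y})=\sup\{\omega:\ \max_{i,\nu}|b_0y_{i,\nu}+b_i|_\nu^{1/\kappa_{i,\nu}}\le\|\tilde{\mathbf{b}}\|_\infty^{-\omega}\text{ for infinitely many }\tilde{\mathbf{b}}\in\mathbb{Z}^{n+1}\}$. For the manifold $\prod_{\nu\in T}\mathcal{M}_\nu$ parametrized by $\mathbf{F}_T=(\mathbf{F}_\nu)_{\nu\in T}$ on $\prod_{\nu\in T}\mathcal{U}_\nu$, $\omega_{\boldsymbol{\kappa}}(\prod_{\nu\in T}\mathcal{M}_\nu)=\inf\{\omega:\ \omega_{\boldsymbol{\kappa}}(\mathbf{F}_T(\mathbf{x}))\le\omega\text{ for }\mu_{T,d}\text{-a.e. }\mathbf{x}\in\prod_{\nu\in T}\mathcal{U}_\nu\}$. *)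

(* Defs.v *)
From HB Require Import structures.
From mathcomp Require Import all_boot all_order all_algebra.
From mathcomp Require Import generic_quotient ring_quotient finmap.
From mathcomp Require Import all_classical all_reals all_analysis.

Set Implicit Arguments.
Unset Strict Implicit.
Unset Printing Implicit Defensive.

Import Order.TTheory GRing.Theory Num.Theory.
Import numFieldNormedType.Exports.

Local Open Scope classical_set_scope.
Local Open Scope ring_scope.
Local Open Scope quotient_scope.

Definition primeT := {p : nat | prime p}.
HB.instance Definition _ := Countable.on primeT.

Section RatAbs.
Variable p : primeT.
Local Notation q := (val p : nat).
Implicit Types x y : rat.

Definition rat_padic_abs x : rat :=
  if x == 0 then 0 else
  q%:R ^ ((logn q `|denq x|%N)%:Z - (logn q `|numq x|%N)%:Z).

Local Notation abs := rat_padic_abs.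

Let prime_q : prime q. Proof. exact: (valP p). Qed.
Let q_gt0 : (0 : rat) < q%:R. Proof. by rewrite ltr0n prime_gt0. Qed.
Let q_neq0 : (q%:R : rat) != 0. Proof. by rewrite gt_eqF. Qed.

Lemma rat_padic_abs0 : abs 0 = 0. Proof. by rewrite /abs eqxx. Qed.

Lemma rat_padic_abs_gt0 x : x != 0 -> 0 < abs x.
Proof. by move=> /negPf x0; rewrite /abs x0 exprz_gt0. Qed.

Lemma rat_padic_abs_ge0 x : 0 <= abs x.
Proof.
by have [->|/rat_padic_abs_gt0/ltW//] := eqVneq x 0; rewrite rat_padic_abs0.
Qed.

Lemma rat_padic_abs_eq0 x : (abs x == 0) = (x == 0).
Proof.
have [->|x0] := eqVneq x 0; first by rewrite rat_padic_abs0 eqxx.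
by rewrite gt_eqF ?rat_padic_abs_gt0.
Qed.

Lemma rat_padic_abs_frac (a b : int) : a != 0 -> b != 0 ->
  abs (a%:~R / b%:~R) = q%:R ^ ((logn q `|b|%N)%:Z - (logn q `|a|%N)%:Z).
Proof.
move=> a0 b0; set x := _ / _.
have x0 : x != 0 by rewrite mulf_neq0 ?invr_eq0 ?intr_eq0.
rewrite /abs (negPf x0); congr (_ ^ _).
have e : numq x * b = a * denq x.
  apply: (@intr_inj rat); rewrite !rmorphM /= numqE /x.
  by rewrite mulrAC divfK ?intr_eq0.
have {}e : (`|numq x| * `|b| = `|a| * `|denq x|)%N by rewrite -!abszM e.
have := congr1 (logn q) e; rewrite !lognM ?absz_gt0 ?numq_eq0 ?denq_neq0 //.
move=> /(congr1 Posz); rewrite !PoszD => h.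
apply/eqP; rewrite subr_eq addrAC eq_sym subr_eq.
by rewrite addrC h addrC.
Qed.

Lemma rat_padic_absM x y : abs (x * y) = abs x * abs y.
Proof.
have [->|x0] := eqVneq x 0; first by rewrite mul0r rat_padic_abs0 mul0r.
have [->|y0] := eqVneq y 0; first by rewrite mulr0 rat_padic_abs0 mulr0.
rewrite -[in LHS](divq_num_den x) -[in LHS](divq_num_den y) mulf_div -!intrM.
rewrite rat_padic_abs_frac ?mulf_neq0 ?numq_eq0 ?denq_neq0 //.
rewrite /abs (negPf x0) (negPf y0) -expfzDr //; congr (_ ^ _).
rewrite !abszM !lognM ?absz_gt0 ?numq_eq0 ?denq_neq0 // !PoszD.
by rewrite opprD addrACA.
Qed.

Lemma rat_padic_abs_int (a : int) : a != 0 ->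
  abs a%:~R = q%:R ^- logn q `|a|%N.
Proof.
move=> a0; have := rat_padic_abs_frac a0 (oner_neq0 _).
by rewrite divr1 => ->; rewrite logn1 sub0r -exprnN.
Qed.

Lemma rat_padic_abs1 : abs 1 = 1.
Proof. by have := rat_padic_abs_int (oner_neq0 _); rewrite logn1 invr1. Qed.

Lemma rat_padic_absN x : abs (- x) = abs x.
Proof. by rewrite /abs oppr_eq0 denqN numqN abszN. Qed.

Lemma rat_padic_abs_int_le1 (a : int) : abs a%:~R <= 1.
Proof.
have [->|a0] := eqVneq a 0; first by rewrite rat_padic_abs0.
by rewrite rat_padic_abs_int // invf_le1 ?exprn_gt0 // exprn_ege1 // ler1n prime_gt0.
Qed.

Lemma rat_padic_abs_prime : abs q%:R = q%:R^-1.
Proof.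
have q0 : (q : int) != 0 by rewrite -lt0n prime_gt0.
by rewrite pmulrn rat_padic_abs_int // logn_prime // eqxx.
Qed.

Lemma rat_padic_abs_1D x : abs x <= 1 -> abs (1 + x) <= 1.
Proof.
have [->|x0] := eqVneq x 0; first by rewrite addr0 rat_padic_abs1.
move=> x1.
have dq : ~~ (q %| `|denq x|)%N.
  apply/negP => qd.
  have nq : ~~ (q %| `|numq x|)%N.
    apply/negP => qn; have := coprime_num_den x.
    by move/(coprime_dvdl qn)/(coprime_dvdr qd); rewrite /coprime gcdnn => /eqP q1; move: prime_q; rewrite q1.
  move: x1; rewrite /abs (negPf x0) [logn _ `|numq x|]lognE (negPf nq) !andbF subr0.
  rewrite -exprnP leNgt exprn_egt1 ?ltr1n ?prime_gt1 // -lt0n logn_gt0.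
  by rewrite mem_primes prime_q qd absz_gt0 denq_neq0.
have -> : 1 + x = (denq x + numq x)%:~R / (denq x)%:~R.
  by rewrite intrD mulrDl divff ?intr_eq0 ?denq_neq0 // divq_num_den.
rewrite rat_padic_absM -[leRHS]mulr1 ler_pM ?rat_padic_abs_ge0 ?rat_padic_abs_int_le1 //.
have := rat_padic_abs_frac (oner_neq0 _) (denq_neq0 x); rewrite div1r => ->.
by rewrite logn1 subr0 lognE (negPf dq) !andbF expr0z.
Qed.

Lemma rat_padic_absD x y : abs (x + y) <= Num.max (abs x) (abs y).
Proof.
wlog xy : x y / abs y <= abs x.
  by move=> h; have /orP[/h|/h] := le_total (abs y) (abs x); rewrite // addrC maxC.
have [x0|x0] := eqVneq x 0.
  by rewrite x0 add0r le_max lexx orbT.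
rewrite le_max; apply/orP; left.
have -> : x + y = x * (1 + y / x) by rewrite mulrDr mulr1 mulrC divfK.
rewrite rat_padic_absM ler_piMr ?rat_padic_abs_ge0 // rat_padic_abs_1D //.
have := rat_padic_absM (y / x) x; rewrite divfK // => e.
rewrite -(ler_pM2r (rat_padic_abs_gt0 x0)) mul1r -e //.
Qed.

End RatAbs.

(* Qp p is the ring of Cauchy sequences of rationals for |.|_p, modulo the
   maximal ideal of null sequences, i.e. the completion of rat for |.|_p. *)
Section QpDef.
Variable p : primeT.
Local Notation abs := (rat_padic_abs p).
Implicit Types u v : nat -> rat.

Definition is_padic_cauchy u := forall e : rat, 0 < e ->
  exists N, forall m n, (N <= m)%N -> (N <= n)%N -> abs (u m - u n) < e.

Definition is_padic_null u := forall e : rat, 0 < e ->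
  exists N, forall n, (N <= n)%N -> abs (u n) < e.

Let absD_lt x y e : abs x < e -> abs y < e -> abs (x + y) < e.
Proof. by move=> xe ye; rewrite (le_lt_trans (rat_padic_absD _ _ _))// gt_max xe. Qed.

Let absB_lt x y e : abs x < e -> abs y < e -> abs (x - y) < e.
Proof. by move=> xe ye; apply: absD_lt; rewrite ?rat_padic_absN. Qed.

Let absBC x y : abs (x - y) = abs (y - x).
Proof. by rewrite -opprB rat_padic_absN. Qed.

Lemma padic_cauchy_bounded u : is_padic_cauchy u ->
  exists2 M, 0 < M & exists N, forall n, (N <= n)%N -> abs (u n) < M.
Proof.
move=> /(_ 1 ltr01)[N uN]; exists (abs (u N) + 1).
  by rewrite ltr_wpDl ?rat_padic_abs_ge0.
exists N => n Nn; rewrite -[u n](subrK (u N)); apply: absD_lt.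
  by rewrite ltr_wpDl ?rat_padic_abs_ge0 ?uN.
by rewrite ltrDl.
Qed.

Lemma padic_cauchyM u v : is_padic_cauchy u -> is_padic_cauchy v ->
  is_padic_cauchy (u * v).
Proof.
move=> uc vc e e0.
have [Mu Mu0 [Nu uM]] := padic_cauchy_bounded uc.
have [Mv Mv0 [Nv vM]] := padic_cauchy_bounded vc.
have [Ku uK] := uc (e / Mv) (divr_gt0 e0 Mv0).
have [Kv vK] := vc (e / Mu) (divr_gt0 e0 Mu0).
exists (maxn (maxn Nu Nv) (maxn Ku Kv)) => m n.
rewrite !geq_max => /andP[/andP[um vm] /andP[um' vm']].
move=> /andP[/andP[un vn] /andP[un' vn']].
have -> : (u * v) m - (u * v) n = (u m - u n) * v m + u n * (v m - v n).
  by rewrite mulrBl mulrBr addrA subrK.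
apply: absD_lt; rewrite rat_padic_absM.
  by rewrite -(divfK (lt0r_neq0 Mv0) e) ltr_pM ?rat_padic_abs_ge0 ?uK ?vM.
by rewrite -(divfK (lt0r_neq0 Mu0) e) mulrC ltr_pM ?rat_padic_abs_ge0 ?vK ?uM.
Qed.

Definition padic_cauchy_pred : {pred nat -> rat} := fun u => `[< is_padic_cauchy u >].

Lemma padic_cauchy_subring : subring_closed padic_cauchy_pred.
Proof.
split.
- apply/asboolP => e e0; exists 0%N => m n _ _.
  by rewrite subrr rat_padic_abs0.
- move=> u v /asboolP uc /asboolP vc; apply/asboolP => e e0.
  have [Nu uN] := uc e e0; have [Nv vN] := vc e e0.
  exists (maxn Nu Nv) => m n; rewrite !geq_max => /andP[um vm] /andP[un vn].
  have -> : (u - v) m - (u - v) n = (u m - u n) - (v m - v n).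
    by rewrite opprB addrACA opprB [- v m + _]addrC -addrACA.
  by apply: absB_lt; [apply: uN | apply: vN].
- by move=> u v /asboolP uc /asboolP vc; apply/asboolP; exact: padic_cauchyM.
Qed.

HB.instance Definition _ :=
  GRing.isSubringClosed.Build (nat -> rat) padic_cauchy_pred padic_cauchy_subring.

Record padic_cauchy := PadicCauchy {
  padic_cauchy_val :> nat -> rat;
  padic_cauchy_valP : padic_cauchy_val \in padic_cauchy_pred }.

HB.instance Definition _ := [isSub for padic_cauchy_val].
HB.instance Definition _ := [Choice of padic_cauchy by <:].
HB.instance Definition _ := [SubChoice_isSubComNzRing of padic_cauchy by <:].

Definition padic_null_pred : {pred padic_cauchy} :=
  fun w => `[< is_padic_null w >].

Lemma padic_null_ideal : idealr_closed padic_null_pred.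
Proof.
split.
- by apply/asboolP => e e0; exists 0%N => n _; rewrite rat_padic_abs0.
- apply/negP => /asboolP/(_ 1 ltr01)[N /(_ N (leqnn N))].
  by rewrite rat_padic_abs1 ltxx.
- move=> a u v /asboolP un /asboolP vn; apply/asboolP => e e0.
  have [M M0 [Na aM]] := padic_cauchy_bounded (asboolW (padic_cauchy_valP a)).
  have [Nu uN] := un (e / M) (divr_gt0 e0 M0); have [Nv vN] := vn e e0.
  exists (maxn Na (maxn Nu Nv)) => n; rewrite !geq_max => /and3P[an un' vn'].
  apply: absD_lt; last exact: vN.
  rewrite rat_padic_absM -(divfK (lt0r_neq0 M0) e) mulrC.
  by rewrite ltr_pM ?rat_padic_abs_ge0 ?uN ?aM.
Qed.

HB.instance Definition _ :=
  isIdealr.Build padic_cauchy padic_null_pred padic_null_ideal.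

Definition Qp : Type := {ideal_quot padic_null_pred}.

HB.instance Definition _ := GRing.ComNzRing.on Qp.
End QpDef.

Section QpField.
Variable p : primeT.
Local Notation abs := (rat_padic_abs p).
Local Notation proj := (\pi_({ideal_quot (padic_null_pred (p := p))})).
Local Notation rep x := (repr (x : {ideal_quot (padic_null_pred (p := p))})).
Implicit Types (u v : padic_cauchy p) (x y : Qp p).

Lemma rat_padic_abs_eqr (a b : rat) : abs a < abs b -> abs (a + b) = abs b.
Proof.
move=> ab; apply/eqP; rewrite eq_le; apply/andP; split.
  by rewrite (le_trans (rat_padic_absD _ _ _))// ge_max lexx ltW.
have := rat_padic_absD p (- a) (a + b).
by rewrite addKr rat_padic_absN le_max leNgt ab.
Qed.

Lemma padic_proj_eq u v : ((proj u : Qp p) = proj v) <-> is_padic_null p (u - v).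
Proof.
split=> [/eqP|h].
  by rewrite -Quotient.idealrBE => /asboolP.
by apply/eqP; rewrite -Quotient.idealrBE; exact/asboolP.
Qed.

Lemma padic_nonnull_abs u : ~ is_padic_null p u ->
  exists2 a, 0 < a & exists N, forall n, (N <= n)%N -> abs (u n) = a.
Proof.
move=> /existsNP[e /not_implyP[e0 /forallNP eu]].
have [N uN] := asboolW (padic_cauchy_valP u) e e0.
have /existsNP[k /not_implyP[Nk /negP]] := eu N; rewrite -leNgt => ek.
exists (abs (u k)); first exact: lt_le_trans ek.
exists N => n Nn; rewrite -[u n](subrK (u k)) rat_padic_abs_eqr//.
by rewrite (lt_le_trans _ ek)// uN.
Qed.

Definition padic_inv : Qp p -> Qp p := fun x =>
  if x == 0 then 0 else proj (insubd 0 (fun n => (rep x n)^-1)).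

Lemma padic_mulVf x : x != 0 -> padic_inv x * x = 1.
Proof.
move=> x0; rewrite /padic_inv (negPf x0); set u := rep x.
have xu : x = proj u by rewrite reprK.
rewrite [X in _ * X]xu.
have [a a0 [N uN]] : exists2 a, 0 < a &
    exists N, forall n, (N <= n)%N -> abs (u n) = a.
  apply: padic_nonnull_abs => un; move/eqP: x0; apply.
  rewrite xu -[RHS](rmorph0 proj); apply/padic_proj_eq.
  by rewrite subr0.
have uneq0 n : (N <= n)%N -> u n != 0.
  by move=> /uN una; rewrite -(rat_padic_abs_eq0 p) una gt_eqF.
have ic : (fun n => (u n)^-1) \in padic_cauchy_pred p.
  apply/asboolP => e e0.
  have [K uK] := asboolW (padic_cauchy_valP u) _ (mulr_gt0 e0 (mulr_gt0 a0 a0)).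
  exists (maxn N K) => m n; rewrite !geq_max => /andP[mN mK] /andP[nN nK].
  rewrite -(ltr_pM2r (mulr_gt0 a0 a0)) -{1}(uN _ mN) -{1}(uN _ nN).
  rewrite -!rat_padic_absM mulrBl mulKf ?uneq0//.
  by rewrite [u m * _]mulrC mulKf ?uneq0// uK.
rewrite -[_ * _]rmorphM -[RHS](rmorph1 proj); apply/padic_proj_eq => e e0; exists N => n nN.
rewrite /insubd insubT [X in abs X](_ : _ = (u n)^-1 * u n - 1) //.
by rewrite mulVf ?uneq0 // subrr rat_padic_abs0.
Qed.

Lemma padic_inv0 : padic_inv 0 = 0.
Proof. by rewrite /padic_inv eqxx. Qed.

HB.instance Definition _ := GRing.ComNzRing_isField.Build (Qp p) padic_mulVf padic_inv0.

(* |x|_p is the eventual value of |u_n|_p for a Cauchy sequence u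
   representing x <> 0. A null sequence has no nonzero eventual value, and
   0 is the default. The values of |.|_p lie in p^Z and 0, hence in rat. *)
Definition padic_abs x : rat :=
  xget 0 [set a | exists N, forall n, (N <= n)%N -> abs (rep x n) = a].


Lemma padic_nullN (u v : nat -> rat) : is_padic_null p (u - v) -> is_padic_null p (v - u).
Proof.
move=> uv e /uv[N uvN]; exists N => n /uvN.
by rewrite -rat_padic_absN /= opprB.
Qed.

Lemma padic_eventual_uniq (u v : nat -> rat) a b : is_padic_null p (u - v) ->
  (exists N, forall n, (N <= n)%N -> abs (u n) = a) ->
  (exists N, forall n, (N <= n)%N -> abs (v n) = b) -> a = b.
Proof.
wlog ab : u v a b / a <= b.
  move=> h uv ua vb; have /orP[ab|ba] := le_total a b; first exact: (h u v).
  by apply/esym/(h v u) => //; exact: padic_nullN.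
move=> uv [N uN] [M vM]; apply/eqP/negPn/negP => nab.
have {nab}ab : a < b by rewrite lt_neqAle nab.
have b0 : 0 < b by rewrite (le_lt_trans _ ab)// -(uN N)// rat_padic_abs_ge0.
have [K uvK] := padic_nullN uv b0; pose n := maxn K (maxn N M).
have nK : (K <= n)%N by rewrite leq_maxl.
have nN : (N <= n)%N by rewrite /n maxnCA leq_maxl.
have nM : (M <= n)%N by rewrite /n maxnA leq_maxr.
have := uvK _ nK; rewrite [X in abs X](_ : _ = - u n + v n); last by rewrite addrC.
by rewrite rat_padic_abs_eqr ?rat_padic_absN ?uN ?vM ?ltxx.
Qed.

Lemma padic_absE u a :
  (exists N, forall n, (N <= n)%N -> abs (u n) = a) -> padic_abs (proj u) = a.
Proof.
move=> ua; rewrite /padic_abs; set r := rep _.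
have ru : is_padic_null p (r - u).
  by apply/padic_proj_eq; rewrite /r reprK.
case: xgetP => [b _ rb|none]; first exact: (padic_eventual_uniq ru).
have rn : is_padic_null p r.
  by apply: contrapT => /padic_nonnull_abs[b _ rb]; exact: (none b).
apply: (@padic_eventual_uniq 0 u) ua; last first.
  by exists 0%N => n _; rewrite rat_padic_abs0.
rewrite sub0r -[- _]addr0 => e e0.
have [N rN] := rn e e0; have [M ruM] := ru e e0.
exists (maxn N M) => n; rewrite geq_max => /andP[nN nM].
rewrite [X in abs X](_ : _ = (r - u) n - r n); last first.
  by rewrite /= addr0 addrAC subrr sub0r.
rewrite (le_lt_trans (rat_padic_absD _ _ _))// gt_max ruM//.
by rewrite rat_padic_absN rN.
Qed.

Lemma padic_abs_spec x : exists2 u, x = proj u &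
  exists N, forall n, (N <= n)%N -> abs (u n) = padic_abs x.
Proof.
have xE : x = proj (rep x) by rewrite reprK.
have [/padic_nonnull_abs[a _ ua]|/contrapT xn] :=
    pselect (~ is_padic_null p (rep x)).
  by exists (rep x) => //; rewrite [X in padic_abs X]xE (padic_absE ua).
have u0 : exists N, forall n, (N <= n)%N -> abs ((0 : padic_cauchy p) n) = 0.
  by exists 0%N => n _; rewrite rat_padic_abs0.
have x0 : x = proj 0 by rewrite xE; apply/padic_proj_eq; rewrite subr0.
by exists 0 => //; rewrite x0 (padic_absE u0).
Qed.

Lemma padic_abs_ge0 x : 0 <= padic_abs x.
Proof. by have [u _ [N uN]] := padic_abs_spec x; rewrite -(uN N)// rat_padic_abs_ge0. Qed.

Lemma padic_abs0 : padic_abs 0 = 0.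
Proof.
rewrite -(rmorph0 proj); apply: padic_absE.
by exists 0%N => n _; rewrite rat_padic_abs0.
Qed.

Lemma padic_abs_eq0 x : (padic_abs x == 0) = (x == 0).
Proof.
apply/eqP/eqP => [|->]; last exact: padic_abs0.
have [u -> [N uN] u0] := padic_abs_spec x.
rewrite -[RHS](rmorph0 proj); apply/padic_proj_eq; rewrite subr0 => e e0.
by exists N => n nN; rewrite uN// u0.
Qed.

Lemma padic_absM x y : padic_abs (x * y) = padic_abs x * padic_abs y.
Proof.
have [u xu [N uN]] := padic_abs_spec x; have [v yv [M vM]] := padic_abs_spec y.
rewrite {1}xu {1}yv -[_ * _]rmorphM; apply: padic_absE.
exists (maxn N M) => n; rewrite geq_max => /andP[/uN <- /vM <-].
exact: rat_padic_absM.
Qed.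

Lemma padic_absN x : padic_abs (- x) = padic_abs x.
Proof.
have [u xu [N uN]] := padic_abs_spec x.
rewrite {1}xu -[- _]rmorphN; apply: padic_absE.
by exists N => n /uN <-; exact: rat_padic_absN.
Qed.

Lemma padic_absD x y : padic_abs (x + y) <= Num.max (padic_abs x) (padic_abs y).
Proof.
have [u xu [N uN]] := padic_abs_spec x; have [v yv [M vM]] := padic_abs_spec y.
have [w xyw [K wK]] := padic_abs_spec (x + y).
have wuv : is_padic_null p (w - (u + v)).
  by apply/padic_proj_eq; rewrite -xyw xu yv -[_ + _]rmorphD.
rewrite leNgt; apply/negP => xy.
have xy0 : 0 < padic_abs (x + y).
  by rewrite (le_lt_trans _ xy)// le_max padic_abs_ge0.
have [L wuvL] := wuv _ xy0; pose n := maxn (maxn N M) (maxn K L).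
have nN : (N <= n)%N by rewrite /n -maxnA leq_maxl.
have nM : (M <= n)%N by rewrite /n -maxnA maxnCA leq_maxl.
have nK : (K <= n)%N by rewrite /n maxnCA leq_maxl.
have nL : (L <= n)%N by rewrite /n !maxnA leq_maxr.
suff : abs (w n) < padic_abs (x + y) by rewrite wK// ltxx.
rewrite -[w n](subrK (u n + v n)).
rewrite (le_lt_trans (rat_padic_absD _ _ _))// gt_max wuvL//=.
by rewrite (le_lt_trans (rat_padic_absD _ _ _))// uN// vM// -gt_max.
Qed.

Lemma padic_cauchy_intE (a : int) n : (a%:~R : padic_cauchy p) n = a%:~R.
Proof.
rewrite -[LHS]/((val (a%:~R : padic_cauchy p)) n).
rewrite (rmorph_int (val : padic_cauchy p -> nat -> rat)).
have natE k : (k%:R : nat -> rat) n = k%:R.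
  by elim: k => [//|k IH]; rewrite !mulrS -IH.
case: a => k; first by rewrite -!pmulrn natE.
by rewrite NegzE !mulrNz -!pmulrn -natE.
Qed.

Lemma padic_abs_int (a : int) : padic_abs a%:~R = abs a%:~R.
Proof.
rewrite -(rmorph_int proj); apply: padic_absE; exists 0%N => n _.
by rewrite padic_cauchy_intE.
Qed.

Lemma padic_ratr (r : rat) :
  exists2 u : padic_cauchy p, (ratr r : Qp p) = proj u & forall n, u n = r.
Proof.
have rc : (fun=> r) \in padic_cauchy_pred p.
  by apply/asboolP => e e0; exists 0%N => m n _ _; rewrite subrr rat_padic_abs0.
exists (PadicCauchy rc) => //.
have d0 : ((denq r)%:~R : Qp p) != 0.
  by rewrite -padic_abs_eq0 padic_abs_int rat_padic_abs_eq0 intr_eq0 denq_neq0.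
apply: (mulIf d0); rewrite /ratr divfK // -!(rmorph_int proj) -[RHS]rmorphM.
apply/padic_proj_eq => e e0; exists 0%N => n _.
rewrite [X in abs X](_ : _ = (numq r)%:~R - r * (denq r)%:~R); last first.
  rewrite -!(padic_cauchy_intE _ n).
  by [].
by rewrite numqE subrr rat_padic_abs0.
Qed.

Lemma padic_rat_dense x (e : rat) : 0 < e -> exists r : rat, padic_abs (x - ratr r) < e.
Proof.
move=> e0; have [u xu _] := padic_abs_spec x.
have [N uN] := asboolW (padic_cauchy_valP u) e e0.
exists (u N); have [v vE vN] := padic_ratr (u N); rewrite vE.
have [w wE [M wM]] := padic_abs_spec (x - proj v).
have wuv : is_padic_null p (w - (u - v)).
  by apply/padic_proj_eq; rewrite -wE xu -[_ - _]rmorphB.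
have [K wK] := wuv e e0; pose n := maxn N (maxn M K).
have nN : (N <= n)%N by rewrite leq_maxl.
have nM : (M <= n)%N by rewrite /n maxnCA leq_maxl.
have nK : (K <= n)%N by rewrite /n maxnA leq_maxr.
rewrite -(wM n nM) -[w n](subrK (u n - v n)).
rewrite (le_lt_trans (rat_padic_absD _ _ _))// gt_max wK//=.
by rewrite vN uN.
Qed.

(* Completeness, for Cauchy sequences of rationals, which are dense. *)
Lemma padic_rat_complete (u : nat -> rat) : is_padic_cauchy p u ->
  exists x, forall e : rat, 0 < e ->
    exists N, forall n, (N <= n)%N -> padic_abs (x - ratr (u n)) < e.
Proof.
move=> uc; pose c := PadicCauchy (introT (asboolP _) uc).
exists (proj c) => e e0; have [N uN] := uc e e0; exists N => k kN.
have [v vE vN] := padic_ratr (u k); rewrite vE.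
have [w wE [M wM]] := padic_abs_spec (proj c - proj v).
have wuv : is_padic_null p (w - (c - v)).
  by apply/padic_proj_eq; rewrite -wE -[_ - _]rmorphB.
have [K wK] := wuv e e0; pose n := maxn N (maxn M K).
have nN : (N <= n)%N by rewrite leq_maxl.
have nM : (M <= n)%N by rewrite /n maxnCA leq_maxl.
have nK : (K <= n)%N by rewrite /n maxnA leq_maxr.
rewrite -(wM n nM) -[w n](subrK (c n - v n)).
rewrite (le_lt_trans (rat_padic_absD _ _ _))// gt_max wK//=.
by rewrite vN uN.
Qed.

Lemma padic_abs_prime : padic_abs ((val p)%:R : Qp p) = (val p)%:R^-1.
Proof. by rewrite pmulrn padic_abs_int rat_padic_abs_prime. Qed.

Definition Qp_ball x (e : rat) : set (Qp p) := [set y | padic_abs (x - y) < e].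

Lemma Qp_ball_center x e : 0 < e -> Qp_ball x e x.
Proof. by rewrite /Qp_ball /= subrr padic_abs0. Qed.

Lemma Qp_ball_sym x y e : Qp_ball x e y -> Qp_ball y e x.
Proof. by rewrite /Qp_ball /= -opprB padic_absN. Qed.

Lemma Qp_ball_triangle x y z e1 e2 :
  Qp_ball x e1 y -> Qp_ball y e2 z -> Qp_ball x (e1 + e2) z.
Proof.
rewrite /Qp_ball /= => xy yz; rewrite -(subrK y x) -addrA.
rewrite (le_lt_trans (padic_absD _ _))//.
have e1_ge0 := le_trans (padic_abs_ge0 _) (ltW xy).
have e2_ge0 := le_trans (padic_abs_ge0 _) (ltW yz).
by rewrite gt_max (lt_le_trans xy) ?lerDl// (lt_le_trans yz) ?lerDr.
Qed.

HB.instance Definition _ := isPointed.Build (Qp p) 0.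
HB.instance Definition _ := hasNbhs.Build (Qp p) (nbhs_ (entourage_ Qp_ball)).
HB.instance Definition _ := Nbhs_isPseudoMetric.Build rat (Qp p)
  erefl Qp_ball_center Qp_ball_sym Qp_ball_triangle erefl.

End QpField.

Definition padic_norm (R : realType) (p : primeT) (x : Qp p) : R :=
  ratr (padic_abs x).
Arguments padic_norm R {p} x.

Definition Zp_vec (p : primeT) (k : nat) : set 'rV[Qp p]_k :=
  [set x | forall i, padic_abs (x 0 i) <= 1].
Arguments Zp_vec : clear implicits.

(* Order-(size s) difference quotient of g at the nodes x :: s:
   Phi^0 g (x) = g x,
   Phi^n g (x1, x2, x3, ...) =
     (Phi^(n-1) g (x1, x3, ...) - Phi^(n-1) g (x2, x3, ...)) / (x1 - x2). *)
Fixpoint diff_quot (K : fieldType) (V : lmodType K) (g : K -> V) (x : K)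
    (s : seq K) : V :=
  if s is y :: s' then (x - y)^-1 *: (diff_quot g x s' - diff_quot g y s')
  else g x.

Definition set_coord (K : Type) (d : nat) (x : 'rV[K]_d) (i : 'I_d) (t : K) :
    'rV[K]_d :=
  \row_j (if j == i then t else x 0 j).

(* Phi_beta f: the order-(beta i) difference quotient is taken in the i-th
   variable, at the nodes z i, for every i. All coordinates of the base point 0
   get overwritten. *)
Definition partial_diff_quot (K : fieldType) (V : lmodType K) (d : nat)
    (f : 'rV[K]_d -> V) (beta : 'I_d -> nat)
    (z : forall i, 'rV[K]_(beta i).+1) : V :=
  foldr (fun i (g : 'rV[K]_d -> V) x =>
           diff_quot (fun t => g (set_coord x i t))
             (z i 0 0) [seq z i 0 (lift 0 j) | j <- enum 'I_(beta i)])
        f (enum 'I_d) 0.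

(* C^k in the sense of ultrametric calculus: locally on boxes, each Phi_beta f
   with |beta| <= k, which is defined where the nodes in each variable are
   pairwise distinct, extends continuously to all tuples of nodes. *)
Definition Ck_on (p : primeT) (d m k : nat) (U : set 'rV[Qp p]_d)
    (f : 'rV[Qp p]_d -> 'rV[Qp p]_m) : Prop :=
  forall a, U a -> exists r : rat, [/\ 0 < r, ball a r `<=` U &
    forall beta : 'I_d -> nat, (\sum_(i < d) beta i <= k)%N ->
    let nodes := prod_topology (fun i : 'I_d => 'rV[Qp p]_(beta i).+1) in
    let B := [set z : nodes | forall i j, ball (a 0 i) r (z i 0 j)] in
    exists2 g : nodes -> 'rV[Qp p]_m, {within B, continuous g} &
      forall z : nodes, B z -> (forall i, injective (z i 0)) ->
        g z = partial_diff_quot f z].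

Definition QT (T : {fset primeT}) (k : nat) :=
  prod_topology (fun v : T => 'rV[Qp (val v)]_k).

Definition ZT (T : {fset primeT}) (k : nat) : set (QT T k) :=
  [set x | forall v, Zp_vec (val v) k (x v)].

Notation QT_borel T k := (g_sigma_algebraType (@open (QT T k))).

Section SArithmetic.
Variable R : realType.
Implicit Types (T : {fset primeT}).

(* A translation-invariant Borel measure with mu (Z_T^k) = 1 is automatically
   Radon, hence is the normalized Haar measure of Q_T^k. *)
Definition is_haar T k (mu : {measure set (QT_borel T k) -> \bar R}) : Prop :=
  mu (ZT (T := T) (k := k)) = 1%E /\
  forall (a : QT T k) (A : set (QT_borel T k)), measurable A ->
    mu [set (fun v => a v + x v : 'rV_k) | x in A] = mu A.

Definition sup_norm n (b : 'rV[int]_n) : R := (\max_(i < n) `|b ord0 i|%N)%:R.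

Definition approx_set T n (c : R) (tau : 'I_n -> primeT -> R) : set (QT T n) :=
  [set y | ZT y /\ infinite_set [set b : 'rV[int]_n.+1 |
    forall (i : 'I_n) (v : T),
      padic_norm R ((b 0 0)%:~R * y v 0 i - (b 0 (lift 0 i))%:~R)
        < c * sup_norm b `^ (- tau i (val v))]].

Definition bad_set T n (tau : 'I_n -> primeT -> R) : set (QT T n) :=
  approx_set 1 tau `\` \bigcap_(k : nat) approx_set k.+1%:R^-1 tau.

Definition dioph_exponent T n (kappa : 'I_n -> primeT -> R) (y : QT T n) : \bar R :=
  ereal_sup [set w%:E | w in [set w : R |
    infinite_set [set b : 'rV[int]_n.+1 |
      \big[Num.max/0]_(i < n) \big[Num.max/0]_(v : T)
         padic_norm R ((b 0 0)%:~R * y v 0 i + (b 0 (lift 0 i))%:~R)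
           `^ (kappa i (val v))^-1
      <= sup_norm b `^ (- w)]]].

Definition graph_map T d m (f : forall p, 'rV[Qp p]_d -> 'rV[Qp p]_m)
    (x : QT T d) : QT T (d + m) :=
  fun v => row_mx (x v) (f (val v) (x v)).

Definition dioph_exponent_graph T d m (mu : {measure set (QT_borel T d) -> \bar R})
    (U : forall p, set 'rV[Qp p]_d) (f : forall p, 'rV[Qp p]_d -> 'rV[Qp p]_m)
    (kappa : 'I_(d + m) -> primeT -> R) : \bar R :=
  ereal_inf [set w%:E | w in [set w : R |
    {ae mu, forall x : QT_borel T d, (forall v, U (val v) (x v)) ->
       (dioph_exponent kappa (graph_map f x) <= w%:E)%E}]].

Definition avg_weight n (tau : 'I_n -> primeT -> R) (v : primeT) : R :=
  n.+1%:R^-1 * \sum_(i < n) tau i v.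

Definition min_weight n (tau : 'I_n -> primeT -> R) (v : primeT) : \bar R :=
  \big[mine/+oo%E]_(i < n) (tau i v)%:E.

(* tau^v, to be used at the primes other than v only. *)
Definition reduced_weight n (tau : 'I_n -> primeT -> R) (v : primeT) :
    'I_n -> primeT -> R :=
  fun i s => tau i s / (1 - avg_weight tau v).

End SArithmetic.

(* Main.v *)
(* Fix the constant c = 1/(k+1) and a point x of U with y = F(x). The pigeonhole principle
   applied to the linear forms b_0 x_i - b_i and to the linearizations
   b_0 f_j(x) - b_{d+j} - sum_i (b_0 x_i - b_i) d_i f_j(x) gives, for every H, an integer
   vector b of norm at most H for which the first forms are at most C H^(-tau_i) and the second
   ones less than c H^(-tau_{d+j}): shrinking the latter is paid for by the former, as
   the sum of all tau_{i,v} is n+1. Differentiability of f and the ordering (b) then show that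
   the points x' with |b_0 x'_i - b_i|_v < c' H^(-tau_i), for a small c', all satisfy the full
   system with constant c. They form a box of relative volume bounded below in the box
   around x of radii C H^(-tau_i) / |b_0|_v. If these radii do not tend to 0, then b is
   divisible by a power v^t of size about H^(min_i tau_{i,v}), and b / v^t contradicts the
   bound on the exponent at the primes other than v. Hence x is not a strong density point of
   the set where the system with constant c is unsolvable for all large H. The
   shapes of the boxes depend on H and on all the |b_0|_v, so the Lebesgue density theorem is
   needed for arbitrary boxes; it follows from a weak type inequality proved by iterating the
   one-dimensional covering argument over the coordinates. *)
Require Import Defs.
From HB Require Import structures.
From mathcomp Require Import all_boot all_order all_algebra finmap.
From mathcomp Require Import all_classical all_reals all_analysis.
From mathcomp Require Import ring lra zify.

Set Implicit Arguments.
Unset Strict Implicit.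
Unset Printing Implicit Defensive.

Import Order.TTheory GRing.Theory Num.Theory.
Import numFieldNormedType.Exports.

Local Open Scope classical_set_scope.
Local Open Scope ring_scope.

(** * Strong maximal inequality on finite products *)

Section StrongMaximal.
Local Close Scope classical_set_scope.
Variable R : realFieldType.

Definition laminar (T : finType) (L : {pred {set T}}) :=
  forall A B, A \in L -> B \in L ->
    [|| A \subset B, B \subset A | [disjoint A & B]].

Lemma laminar_weak_type (T : finType) (L : {set {set T}}) (w : T -> R) (k : R) :
  laminar (mem L) -> (forall t, 0 <= w t) ->
  (forall B, B \in L -> k * #|B|%:R <= \sum_(t in B) w t) ->
  k * #|finset.cover L|%:R <= \sum_t w t.
Proof.
move=> lam w0 wL; have [k0|k0] := ltP k 0.
  by rewrite (@le_trans _ _ 0) ?mulr_le0_ge0 ?ler0n ?sumr_ge0// ltW.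
pose P := [set B | maxset (mem L) B].
have PL B : B \in P -> B \in L by rewrite inE => /maxsetP[].
have Pcov : finset.cover P = finset.cover L.
  apply/setP => t; apply/bigcupP/bigcupP => -[B BL tB]; first by exists B => //; exact: PL.
  have [M maxM BM] := @maxset_exists _ (mem L) B BL.
  by exists M; [rewrite inE | exact: (fintype.subsetP BM)].
have Ptriv : finset.trivIset P.
  apply/finset.trivIsetP => A B; rewrite !inE => /maxsetP[AL Amax] /maxsetP[BL Bmax] AB.
  case/or3P: (lam _ _ AL BL) => // [/(Amax _ BL)|/(Bmax _ AL)] e; by rewrite e eqxx in AB.
rewrite -Pcov -(eqP Ptriv) natr_sum mulr_sumr.
rewrite (@le_trans _ _ (\sum_(B in P) \sum_(t in B) w t))//.
  by apply: ler_sum => B /PL/wL.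
rewrite -finset.big_trivIset// [leRHS](bigID (mem (finset.cover P)))/= lerDl.
exact: sumr_ge0.
Qed.

Variables D X : finType.
Implicit Types (s : seq D) (J : {ffun D -> {set X}}) (g h : {ffun D -> X}).
Implicit Types (w : {ffun D -> X} -> R) (k : R).

Definition slab s J g : {set {ffun D -> X}} :=
  [set h : {ffun D -> X} | [forall c, h c \in if c \in s then J c else [set g c]]].

Lemma slabP s J g h :
  reflect (forall c, if c \in s then h c \in J c else h c == g c) (h \in slab s J g).
Proof.
rewrite inE; apply: (iffP forallP) => H c; move: (H c); case: ifP => // _.
  by rewrite inE.
by rewrite inE.
Qed.

Lemma card_slab s J g g' : #|slab s J g| = #|slab s J g'|.
Proof.
have E h : #|slab s J h| = foldr muln 1%N
    [seq (if c \in s then #|J c| else 1%N) | c : D].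
  rewrite -[LHS](_ : #|family (fun c => mem (if c \in s then J c else [set h c]))| = _).
    rewrite card_family; congr foldr; apply: eq_map => c.
    by case: ifP => _; rewrite ?cards1.
  by apply: eq_card => f; rewrite !inE.
by rewrite !E.
Qed.

Definition ffset g c (t : X) : {ffun D -> X} := [ffun c' => if c' == c then t else g c'].

Lemma mem_slab_cons c s J g h t : c \notin s -> t \in J c ->
  (h \in slab (c :: s) J g) && (h c == t) = (h \in slab s J (ffset g c t)).
Proof.
move=> cs tJ; apply/andP/slabP => [[/slabP H /eqP hc] c'|H].
  move: (H c'); rewrite inE ffunE; have [->|//] := eqVneq c' c.
  by rewrite (negPf cs) hc.
have hc : h c = t by have := H c; rewrite (negPf cs) ffunE eqxx => /eqP.
split; last exact/eqP.
apply/slabP => c'; have := H c'; rewrite inE ffunE.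
by have [->|//] := eqVneq c' c; rewrite hc.
Qed.

Lemma sum_slab_cons w c s J g : c \notin s ->
  \sum_(h in slab (c :: s) J g) w h =
  \sum_(t in J c) \sum_(h in slab s J (ffset g c t)) w h.
Proof.
move=> cs; rewrite (partition_big (fun h => h c) (mem (J c)))/=; last first.
  by move=> h /slabP/(_ c); rewrite mem_head.
by apply: eq_bigr => t tJ; apply: eq_bigl => h; exact: mem_slab_cons.
Qed.

Variable L : D -> {pred {set X}}.
Hypothesis lamL : forall c, laminar (L c).

Definition dense_set s k w : {set {ffun D -> X}} :=
  [set g : {ffun D -> X} | [exists J : {ffun D -> {set X}}, [&& [forall c, J c \in L c],
     g \in slab s J g & k * #|slab s J g|%:R <= \sum_(h in slab s J g) w h]]].

Lemma dense_set1 c k w : 0 < k -> (forall g, 0 <= w g) ->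
  #|dense_set [:: c] k w|%:R <= k^-1 * \sum_g w g.
Proof.
move=> k0 w0; rewrite ler_pdivlMl//.
pose B := [set A : {set {ffun D -> X}} | [exists p : {ffun D -> {set X}} * {ffun D -> X},
   [&& A == slab [:: c] p.1 p.2, p.1 c \in L c & k * #|A|%:R <= \sum_(h in A) w h]]].
apply: (@le_trans _ _ (k * #|finset.cover B|%:R)).
  rewrite ler_pM2l// ler_nat; apply/subset_leq_card/fintype.subsetP => g.
  rewrite inE => /existsP[J /and3P[/forallP JL gJ wJ]].
  apply/bigcupP; exists (slab [:: c] J g) => //.
  by rewrite inE; apply/existsP; exists (J, g); rewrite eqxx JL.
apply: laminar_weak_type => // [A A'|A]; last by rewrite inE => /existsP[p /and3P[]].
rewrite !inE => /existsP[[J g] /and3P[/eqP-> /= JL _]] /existsP[[J' g'] /and3P[/eqP-> /= JL' _]].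
have [|/pred0Pn[h /andP[/= hA hA']]] := boolP [disjoint slab [:: c] J g & slab [:: c] J' g'].
  by rewrite !orbT.
move: hA hA' => /slabP hA /slabP hA'.
have gg' c' : c' != c -> g c' = g' c'.
  by move=> c'c; have := hA c'; have := hA' c'; rewrite inE (negPf c'c) => /eqP-> /eqP->.
have sub (J1 J2 : {ffun D -> {set X}}) g1 g2 : J1 c \subset J2 c ->
    (forall c', c' != c -> g1 c' = g2 c') -> slab [:: c] J1 g1 \subset slab [:: c] J2 g2.
  move=> /fintype.subsetP J12 g12; apply/fintype.subsetP => f /slabP fJ; apply/slabP => c'.
  move: (fJ c'); rewrite inE; have [->|/g12->//] := eqVneq c' c; exact: J12.
case/or3P: (lamL JL JL') => [JJ|JJ|dis].
- by rewrite sub.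
- by rewrite (sub J')// ?orbT// => c' /gg'.
- move: (hA c) (hA' c); rewrite mem_head => h1 h2.
  by have := disjointFr dis h1; rewrite h2.
Qed.

Fixpoint weak_const k n : R :=
  if n is n'.+1 then (k / 2)^-1 * weak_const (k / 2) n' else k^-1.

Lemma weak_const_ge0 k n : 0 < k -> 0 <= weak_const k n.
Proof.
elim: n k => [|n IH] k k0 /=; first by rewrite invr_ge0 ltW.
by rewrite mulr_ge0 ?invr_ge0 ?IH ?divr_gt0// ltW// divr_gt0.
Qed.

(* If a box has density [k] in [w], then at least a fraction [k / 2] of its sections in the
   directions [s] have density [k / 2]; these sections lie in [dense_set s (k / 2) w]. *)
Lemma dense_set_cons c s k w : 0 < k -> c \notin s -> (forall g, 0 <= w g <= 1) ->
  dense_set (c :: s) k w \subset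
  dense_set [:: c] (k / 2) (fun g => (g \in dense_set s (k / 2) w)%:R).
Proof.
move=> k0 cs w01; apply/fintype.subsetP => g; rewrite inE => /existsP[J /and3P[/forallP JL gJ wJ]].
rewrite inE; apply/existsP; exists J; apply/and3P; split; first exact/forallP.
  by apply/slabP => c'; have /slabP/(_ c') := gJ; rewrite !inE; case: eqP => //= _; case: ifP.
have sum1 (f : {ffun D -> X} -> R) : \sum_(h in slab [:: c] J g) f h = \sum_(t in J c) f (ffset g c t).
  rewrite sum_slab_cons//; apply: eq_bigr => t tJ; rewrite (big_pred1 (ffset g c t))// => h.
  by apply/slabP/eqP => [H|-> c' /=]; [apply/ffunP => c'; apply/eqP/H|].
have card1 : #|slab [:: c] J g|%:R = #|J c|%:R :> R.
  by have := sum1 (fun=> 1); rewrite !sumr_const.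
rewrite card1 sum1.
pose q := #|slab s J g|.
have qE t : #|slab s J (ffset g c t)| = q by exact: card_slab.
have cardc : #|slab (c :: s) J g|%:R = #|J c|%:R * q%:R :> R.
  have := @sum_slab_cons (fun=> 1) c s J g cs; rewrite sumr_const => ->.
  under eq_bigr do rewrite sumr_const qE.
  by rewrite sumr_const mulr_natl.
have q0 : (0 < q)%N.
  rewrite /q card_gt0; apply/set0Pn; exists g; apply/slabP => c'.
  by have /slabP/(_ c') := gJ; rewrite inE; case: (c' \in s); rewrite ?orbT// eqxx.
have q0R : 0 < q%:R :> R by rewrite ltr0n.
rewrite -(ler_pM2r q0R).
move: wJ; rewrite sum_slab_cons// => wJ.
have step t : t \in J c -> \sum_(h in slab s J (ffset g c t)) w h <=
    (ffset g c t \in dense_set s (k / 2) w)%:R * q%:R + (k / 2) * q%:R.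
  move=> tJ; have [kq|kq] := leP ((k / 2) * q%:R) (\sum_(h in slab s J (ffset g c t)) w h); last first.
    by rewrite (le_trans (ltW kq))// lerDr mulr_ge0 ?ler0n.
  have -> : ffset g c t \in dense_set s (k / 2) w.
    rewrite inE; apply/existsP; exists J; apply/and3P; split; first exact/forallP.
      apply/slabP => c'; case: ifP => // c's; rewrite ffunE.
      have /negPf-> : c' != c by apply: contraNneq cs => <-.
      by have /slabP/(_ c') := gJ; rewrite inE c's orbT.
    by rewrite qE.
  have sq : \sum_(h in slab s J (ffset g c t)) w h <= q%:R.
    rewrite -(qE t) -sumr_const; apply: ler_sum => h _; by have /andP[] := w01 h.
  by rewrite mul1r (le_trans sq)// lerDl mulr_ge0 ?ler0n// divr_ge0// ltW.
have : k * (#|J c|%:R * q%:R) <=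
    (\sum_(t in J c) (ffset g c t \in dense_set s (k / 2) w)%:R) * q%:R + (k / 2) * q%:R * #|J c|%:R.
  have -> : k / 2 * q%:R * #|J c|%:R = \sum_(t in J c) k / 2 * q%:R.
    by rewrite sumr_const mulr_natr.
  by rewrite -cardc (le_trans wJ)// mulr_suml -big_split; exact: ler_sum.
set A := \sum_(_ in _) _; set c1 := #|J c|%:R; set q1 := q%:R.
by lra.
Qed.

Lemma card_dense_set s k w : uniq s -> 0 < k -> (forall g, 0 <= w g <= 1) ->
  #|dense_set s k w|%:R <= weak_const k (size s) * \sum_g w g.
Proof.
elim: s k w => [|c s IH] k w /=.
  move=> _ k0 w01; rewrite ler_pdivlMl//.
  rewrite mulr_natr -sumr_const (le_trans _ (_ : \sum_(g in dense_set [::] k w) w g <= _))//.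
    apply: ler_sum => g; rewrite inE => /existsP[J /and3P[_ _]].
    suff -> : slab [::] J g = [set g] by rewrite cards1 mulr1 big_set1.
    by apply/setP => h; rewrite [RHS]inE; apply/slabP/eqP => [H|-> c /=]; [apply/ffunP => c; apply/eqP/H|].
  rewrite [leRHS](bigID (mem (dense_set [::] k w)))/= lerDl.
  by apply: sumr_ge0 => g _; have /andP[] := w01 g.
move=> /andP[cs us] k0 w01; have k20 : 0 < k / 2 by rewrite divr_gt0.
apply: (@le_trans _ _ #|dense_set [:: c] (k / 2) (fun g => (g \in dense_set s (k / 2) w)%:R)|%:R).
  by rewrite ler_nat subset_leq_card// dense_set_cons.
apply: (le_trans (dense_set1 _ k20 _)) => [g|]; first exact: ler0n.
rewrite -mulrA ler_pM2l ?invr_gt0//.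
rewrite -natr_sum [X in X%:R](_ : _ = #|dense_set s (k / 2) w|) ?IH//.
by rewrite -sum1_card [RHS]big_mkcond; apply: eq_bigr => g _; case: (_ \in _).
Qed.
End StrongMaximal.

(** * Boxes in products of p-adic fields *)

Lemma nbhs_prod_ballP (I : finType) (T : I -> pseudoMetricType rat)
    (x : prod_topology T) (A : set (prod_topology T)) :
  nbhs x A <-> exists2 e : rat, 0 < e &
    forall y : prod_topology T, (forall i, ball (x i) e (y i)) -> A y.
Proof.
pose B (e : rat) : set (prod_topology T) := [set y | forall i, ball (x i) e (y i)].
pose F : set_system (prod_topology T) := filter_from [set e : rat | 0 < e] B.
have FF : Filter F.
  apply: filter_from_filter; first by exists 1; rewrite /= ltr01.
  move=> e1 e2 e10 e20; exists (Order.min e1 e2); first by rewrite /= lt_min e10.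
  move=> y By; split=> i.
    by apply: le_ball (By i); rewrite ge_min lexx.
  by apply: le_ball (By i); rewrite ge_min lexx orbT.
split=> [xA|[e e0 BA]].
- suff : F A by move=> [e e0 BA]; exists e.
  suff : F --> x by apply.
  apply/cvg_sup => i C /= [D [[V oV <-] /= Vxi] DC].
  have /nbhs_ballP[e e0 eV] : nbhs (x i) V by exact: open_nbhs_nbhs.
  by exists e => // y By; apply: DC; exact: eV.
- have NF : Filter (nbhs x) := @nbhs_filter (prod_topology T) x.
  have bx : nbhs x [set y | forall i, i \in enum I -> ball (x i) e (y i)].
    elim: (enum I) => [|i s IH]; first by apply: (@filterE _ _ NF) => y j; rewrite in_nil.
    have xi : nbhs x [set y | ball (x i) e (y i)].
      have := @proj_continuous _ T i x _ (nbhsx_ballx (x i) _ e0); exact.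
    apply: (@filterS2 _ _ NF) xi IH => y yi ys j.
    by rewrite inE => /orP[/eqP->|/ys].
  by apply: (@filterS _ _ NF) bx => y By; apply: BA => i; apply: By; rewrite mem_enum.
Qed.

Section PadicIntegers.
Variable p : primeT.
Implicit Types (x y : Qp p) (e N : nat).
Local Notation q := (val p : nat).

Definition prad e : rat := q%:R ^- e.

Lemma prime_gt0R : 0 < q%:R :> rat.
Proof. by rewrite ltr0n prime_gt0 ?(valP p). Qed.

Lemma prime_gt1R : 1 < q%:R :> rat.
Proof. by rewrite ltr1n prime_gt1 ?(valP p). Qed.

Lemma prad_gt0 e : 0 < prad e.
Proof. by rewrite invr_gt0 exprn_gt0 ?prime_gt0R. Qed.

Lemma prad0 : prad 0 = 1. Proof. by rewrite /prad expr0 invr1. Qed.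

Lemma pradD e N : prad (e + N) = prad e * prad N.
Proof. by rewrite /prad exprD invfM. Qed.

Lemma le_prad e N : (prad e <= prad N) = (N <= e)%N.
Proof.
rewrite /prad lef_pV2 ?posrE ?exprn_gt0 ?prime_gt0R//.
by rewrite ler_eXn2l ?prime_gt1R.
Qed.

Lemma prad_le1 e : prad e <= 1.
Proof. by rewrite -prad0 le_prad. Qed.

Lemma prad_small (eps : rat) : 0 < eps -> exists N, prad N < eps.
Proof.
move=> eps0; exists (Num.trunc eps^-1).+1; set M := Num.trunc _.
have h : eps^-1 < M.+1%:R by rewrite /M truncnS_gt// invr_ge0 ltW.
rewrite /prad -[ltRHS]invrK ltf_pV2 ?posrE ?invr_gt0 ?exprn_gt0 ?prime_gt0R//.
rewrite (lt_le_trans h)// -natrX ler_nat ltnW// ltn_expl// prime_gt1 ?(valP p)//.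
Qed.

Lemma padic_abs_int_le (a : int) N :
  (padic_abs (a%:~R : Qp p) <= prad N) = (q ^ N %| `|a|)%N.
Proof.
rewrite padic_abs_int; have [->|a0] := eqVneq a 0.
  by rewrite rat_padic_abs0 ltW ?prad_gt0// dvdn0.
rewrite rat_padic_abs_int// -/(prad _) le_prad pfactor_dvdn ?absz_gt0// (valP p)//.
Qed.

Lemma padic_abs_nat_le1 (a : nat) : padic_abs (a%:R : Qp p) <= 1.
Proof. by rewrite pmulrn padic_abs_int rat_padic_abs_int_le1. Qed.

Lemma padic_absDle x y (r : rat) : padic_abs x <= r -> padic_abs y <= r ->
  padic_abs (x + y) <= r.
Proof. by move=> xr yr; rewrite (le_trans (padic_absD _ _))// ge_max xr. Qed.

Lemma padic_absBle x y (r : rat) : padic_abs x <= r -> padic_abs y <= r ->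
  padic_abs (x - y) <= r.
Proof. by move=> xr yr; rewrite padic_absDle// padic_absN. Qed.

Lemma padic_abs_sum (I : Type) (s : seq I) (P : pred I) (F : I -> Qp p) (r : rat) :
  0 <= r -> (forall i, P i -> padic_abs (F i) <= r) ->
  padic_abs (\sum_(i <- s | P i) F i) <= r.
Proof.
move=> r0 Fr; elim/big_rec: _ => [|i x Pi xr]; first by rewrite padic_abs0.
by rewrite padic_absDle// Fr.
Qed.

Lemma padic_distC x y : padic_abs (x - y) = padic_abs (y - x).
Proof. by rewrite -opprB padic_absN. Qed.

Lemma padic_dist_trans x y z (r : rat) : padic_abs (x - y) <= r ->
  padic_abs (y - z) <= r -> padic_abs (x - z) <= r.
Proof. by move=> xy yz; rewrite -(subrK y x) -addrA padic_absDle. Qed.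

Lemma padic_abs1 : padic_abs (1 : Qp p) = 1.
Proof. by rewrite -[1]/(1%:~R) padic_abs_int rat_padic_abs1. Qed.

Lemma padic_int_approx x N : padic_abs x <= 1 ->
  exists2 r, (r < q ^ N)%N & padic_abs (x - r%:R) <= prad N.
Proof.
move=> x1; have [r xr] := padic_rat_dense x (prad_gt0 N).
suff [a ha] : exists a : int, padic_abs (ratr r - a%:~R : Qp p) <= prad N.
  have qN0 : (q ^ N)%:Z != 0 by rewrite -lt0n expn_gt0 prime_gt0 ?(valP p).
  have := modz_ge0 a qN0; have := ltz_pmod a (_ : 0 < (q ^ N)%:Z).
  rewrite ltz_nat expn_gt0 prime_gt0 ?(valP p)// => /(_ isT).
  have := divz_eq a (q ^ N)%:Z.
  case: (a %% _)%Z => // r' aE; rewrite ltz_nat => r'N _; exists r' => //.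
  apply: (@padic_dist_trans _ (ratr r)); first exact: ltW.
  apply: (padic_dist_trans ha); rewrite pmulrn -rmorphB/= padic_abs_int_le.
  by rewrite [X in (X - _)%R]aE addrK abszM dvdn_mull.
have d0 : (denq r)%:~R != 0 :> Qp p.
  by rewrite -padic_abs_eq0 padic_abs_int rat_padic_abs_eq0 intr_eq0 denq_neq0.
have rE : ratr r * (denq r)%:~R = (numq r)%:~R :> Qp p by rewrite /ratr divfK.
have r1 : padic_abs (ratr r : Qp p) <= 1.
  rewrite -[ratr r](subrK x) padic_absDle// padic_distC.
  by rewrite (le_trans (ltW xr)) ?prad_le1.
have qd : ~~ (q %| `|denq r|)%N.
  apply/negP => qd; have qn : (q %| `|numq r|)%N.
    rewrite -[q]expn1 -padic_abs_int_le -rE padic_absM.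
    rewrite -[leRHS]mul1r ler_pM ?padic_abs_ge0//.
    by rewrite padic_abs_int_le expn1.
  have := coprime_num_den r; move/(coprime_dvdl qn)/(coprime_dvdr qd).
  by rewrite /coprime gcdnn => /eqP q1; have := valP p; rewrite /= q1.
have den1 : padic_abs ((denq r)%:~R : Qp p) = 1.
  rewrite padic_abs_int rat_padic_abs_int ?denq_neq0//.
  by rewrite lognE (negPf qd) !andbF invr1.
have cop : coprimez (denq r) (q ^ N)%:Z.
  rewrite /coprimez /gcdz /= eqz_nat -/(coprime _ _) coprimeXr// coprime_sym.
  by rewrite prime_coprime ?(valP p).
have [[u v] /= uv] := coprimezP _ _ cop.
exists (numq r * u).
have := padic_absM (ratr r - (numq r * u)%:~R) ((denq r)%:~R : Qp p).
rewrite den1 mulr1 => <-; rewrite mulrBl rE -rmorphM/= -rmorphB/= padic_abs_int_le.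
rewrite -mulrA -[X in (X - _)%R]mulr1 -mulrBr -uv addrAC subrr add0r mulrA.
by rewrite abszM dvdn_mull.
Qed.

End PadicIntegers.

Section Boxes.
Variables (T : {fset primeT}) (d : nat).
Local Notation D := (T * 'I_d)%type.
Implicit Types (x y z : QT T d) (e : D -> nat).

Definition cdist x y (c : D) : rat := padic_abs (x c.1 0 c.2 - y c.1 0 c.2).

Definition box e x : set (QT T d) :=
  [set y | forall c : D, cdist x y c <= prad (val c.1) (e c)].

Lemma cdist_trans x y z c (r : rat) : cdist x y c <= r -> cdist y z c <= r ->
  cdist x z c <= r.
Proof. exact: padic_dist_trans. Qed.

Lemma cdistC x y c : cdist x y c = cdist y x c.
Proof. exact: padic_distC. Qed.

Lemma box_refl e x : box e x x.
Proof. by move=> c; rewrite /cdist subrr padic_abs0 ltW ?prad_gt0. Qed.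

Lemma box_eq e x y : box e x y -> box e x = box e y.
Proof.
move=> xy; apply/seteqP; split=> z h c.
  by have := xy c; rewrite cdistC => yx; exact: cdist_trans yx (h c).
exact: cdist_trans (xy c) (h c).
Qed.

Lemma subset_box e e' x : (forall c, (e' c <= e c)%N) -> box e x `<=` box e' x.
Proof. by move=> ee y h c; rewrite (le_trans (h c))// le_prad. Qed.

Lemma boxZ e x : ZT x -> box e x `<=` @ZT T d.
Proof.
move=> xZ y h v i; rewrite -[y v 0 i](subrK (x v 0 i)) padic_absDle//.
  by rewrite padic_distC (le_trans (h (v, i)))// prad_le1.
exact: xZ.
Qed.

Lemma box_translate e x (a : QT T d) :
  box e (fun v => a v + x v) = [set (fun v => a v + y v : 'rV_d) | y in box e x].
Proof.
apply/seteqP; split=> [y h|_ [y h <-] c]; last first.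
  by rewrite /cdist !mxE opprD addrACA subrr add0r; exact: h.
exists (fun v => y v - a v); last first.
  by apply: functional_extensionality_dep => v; rewrite addrC subrK.
move=> c; move: (h c); rewrite /cdist !mxE opprB.
by rewrite addrA [x _ _ _ + _]addrC.
Qed.

Lemma nbhs_box x (A : set (QT T d)) : nbhs x A -> exists N, box (fun=> N) x `<=` A.
Proof.
move=> /nbhs_prod_ballP[e e0 eA].
have /choice[N hN] : forall v : T, exists N, prad (val v) N < e by move=> v; exact: prad_small.
exists (\max_v N v)%N => y xy; apply: eA => v; split=> // i j.
rewrite ord1; have := xy (v, j); rewrite /cdist/= => h.
apply: (le_lt_trans h); apply: le_lt_trans (hN v).
by rewrite le_prad leq_bigmax.
Qed.

Lemma open_box e x : open (box e x).
Proof.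
rewrite openE => y xy; apply/nbhs_prod_ballP.
have [eps eps0 heps] : exists2 eps : rat, 0 < eps & forall c : D, eps <= prad (val c.1) (e c).
  exists (\big[Num.min/1]_(c : D) prad (val c.1) (e c)).
    by apply/bigmin_gtP; split=> // c _; exact: prad_gt0.
  by move=> c; exact: bigmin_le_cond.
exists eps => // z yz c; apply: (cdist_trans (xy c)).
have [_ /(_ 0 c.2) h] := yz c.1.
by rewrite (le_trans _ (heps c))// ltW.
Qed.

End Boxes.

Lemma measure_finType_bigcup (dd : measure_display) (X : measurableType dd) (R : realType)
    (mu : {measure set X -> \bar R}) (I : finType) (P : pred I) (F : I -> set X) :
  (forall i, P i -> measurable (F i)) ->
  (forall i j, P i -> P j -> F i `&` F j !=set0 -> i = j) ->
  mu (\bigcup_(i in [set i | P i]) F i) = (\sum_(i | P i) mu (F i))%E.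
Proof.
move=> mF tF; rewrite measure_fin_bigcup//; last exact: finite_finset.
by rewrite [RHS]bigfs ?index_enum_uniq// => i _; rewrite mem_index_enum.
Qed.

Lemma bigcup_finType_measurable (dd : measure_display) (X : measurableType dd)
    (I : finType) (P : set I) (F : I -> set X) :
  (forall i, P i -> measurable (F i)) -> measurable (\bigcup_(i in P) F i).
Proof. by move=> mF; apply: fin_bigcup_measurable => //; exact: finite_finset. Qed.

Lemma card_ord_lt M k : (k <= M)%N -> #|[pred r : 'I_M | (r < k)%N]| = k.
Proof.
move=> kM; rewrite -sum1_card -[RHS]card_ord -[RHS]sum1_card.
by rewrite (big_ord_widen_cond M xpredT (fun=> 1%N)).
Qed.

Section Cells.
Variables (T : {fset primeT}) (d : nat).
Local Notation D := (T * 'I_d)%type.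
Implicit Types (x y z : QT T d) (e : D -> nat).

Definition modbound e : nat := (\max_(c : D) val (val c.1) ^ e c)%N.

Definition residues e := {ffun D -> 'I_(modbound e)}.

Definition reduced e : pred (residues e) :=
  [pred g : residues e | [forall c, (g c < val (val c.1) ^ e c)%N]].

Definition intpt e (g : residues e) : QT T d := fun v => \row_i (g (v, i) : nat)%:R.

Lemma leq_modbound e (c : D) : (val (val c.1) ^ e c <= modbound e)%N.
Proof. exact: (leq_bigmax c). Qed.

Lemma cdist_intpt x e (g : residues e) c :
  cdist x (intpt g) c = padic_abs (x c.1 0 c.2 - (g c : nat)%:R).
Proof. by rewrite /cdist mxE -surjective_pairing. Qed.

Lemma intptZ e (g : residues e) : @ZT T d (intpt g).
Proof. by move=> v i; rewrite mxE padic_abs_nat_le1. Qed.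

Lemma residue_uniq e (g g' : residues e) : reduced g -> reduced g' ->
  (exists x, box e (intpt g) x /\ box e (intpt g') x) -> g = g'.
Proof.
move=> /forallP rg /forallP rg' [x [xg xg']]; apply/ffunP => c; apply/val_inj => /=.
have := xg c; have := xg' c; rewrite ![cdist _ x c]cdistC !cdist_intpt padic_distC => h1 h2.
have := padic_dist_trans h1 h2.
rewrite !pmulrn -rmorphB/= padic_abs_int_le => dv.
have := rg c; have := rg' c; set n := (_ ^ _)%N in dv *; move: (g c : nat) (g' c : nat) dv => a b.
move=> dv bn an; apply/eqP; rewrite -(modn_small an) -(modn_small bn) eq_sym.
move: dv; have [ab|ba] := leqP a b.
  by rewrite subzn// absz_nat -eqn_mod_dvd.
by rewrite -opprB subzn ?abszN ?absz_nat -?eqn_mod_dvd ?(ltnW ba)// eq_sym.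
Qed.

Lemma residue_ex e x : ZT x -> exists2 g : residues e, reduced g & box e (intpt g) x.
Proof.
move=> xZ.
have h (c : D) : exists r : 'I_(modbound e), (r < val (val c.1) ^ e c)%N /\
    padic_abs (x c.1 0 c.2 - (r : nat)%:R) <= prad (val c.1) (e c).
  have [r r1 r2] := padic_int_approx (e c) (xZ c.1 c.2).
  by exists (Ordinal (leq_trans r1 (leq_modbound e c))).
have /choice[r hr] := h; exists [ffun c => r c].
  by apply/forallP => c; rewrite ffunE; case: (hr c).
by move=> c; rewrite cdistC cdist_intpt ffunE; case: (hr c).
Qed.

Lemma ZT_cells e : @ZT T d = \bigcup_(g in [set g : residues e | reduced g]) box e (intpt g).
Proof.
apply/seteqP; split=> [x /(residue_ex e)[g gr gx]|x [g _]]; first by exists g.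
exact/boxZ/intptZ.
Qed.

Lemma card_reduced e : #|@reduced e| = (\prod_(c : D) val (val c.1) ^ e c)%N.
Proof.
have -> : #|@reduced e| = #|family (fun c : D => [pred r : 'I_(modbound e) | (r < val (val c.1) ^ e c)%N])|.
  by apply: eq_card => g; apply/forallP/familyP => h c; exact: h.
rewrite card_family foldrE big_map big_enum/=.
by apply: eq_bigr => c _; rewrite card_ord_lt// leq_modbound.
Qed.

Lemma open_measurable_QT (A : set (QT_borel T d)) : @open (QT T d) A -> measurable A.
Proof. exact: sub_sigma_algebra. Qed.

Lemma measurable_box e x : measurable (box e x : set (QT_borel T d)).
Proof. apply: open_measurable_QT; exact: open_box. Qed.

Lemma measurable_ZT : measurable (@ZT T d : set (QT_borel T d)).
Proof.
rewrite (ZT_cells (fun=> 0%N)); apply: bigcup_finType_measurable => g _.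
exact: measurable_box.
Qed.

Variables (R : realType) (mu : {measure set (QT_borel T d) -> \bar R}).
Hypothesis haar_mu : is_haar mu.

Definition vol e : R := \prod_(c : D) ((val (val c.1))%:R ^- e c).

Lemma vol_gt0 e : 0 < vol e.
Proof.
apply: prodr_gt0 => c _; rewrite invr_gt0 exprn_gt0// ltr0n prime_gt0//.
exact: (valP (val c.1)).
Qed.

Lemma mu_box_eq e x y : mu (box e x) = mu (box e y).
Proof.
have [_ inv] := haar_mu.
suff h z : mu (box e z) = mu (box e (fun=> 0)) by rewrite !h.
rewrite -(inv z _ (measurable_box e (fun=> 0))) -box_translate; congr (mu (box e _)).
by apply: functional_extensionality_dep => v; rewrite addr0.
Qed.

Lemma mu_box e x : mu (box e x) = (vol e)%:E.
Proof.
have [mu1 _] := haar_mu.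
have : mu (@ZT T d) = (\sum_(g : residues e | reduced g) mu (box e (intpt g)))%E.
  rewrite (ZT_cells e) measure_finType_bigcup// => [g _|g g' gr gr' [z zz]].
    exact: measurable_box.
  by apply: residue_uniq => //; exists z.
under eq_bigr do rewrite (mu_box_eq e _ x).
have b1 : (mu (box e x) <= 1)%E.
  rewrite (mu_box_eq e x (fun=> 0)) -mu1; apply: le_measure; rewrite ?inE.
  - exact: measurable_box.
  - exact: measurable_ZT.
  - by apply: boxZ => v i; rewrite mxE padic_abs0.
have bfin : mu (box e x) \is a fin_num.
  by rewrite ge0_fin_numE// (le_lt_trans b1)// ltry.
rewrite mu1 -(fineK bfin) sumEFin => -[] /eqP.
rewrite sumr_const card_reduced -mulr_natr natr_prod => /eqP h.
have p0 : (\prod_(c : D) (val (val c.1) ^ e c)%N%:R : R) != 0.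
  apply/prodf_neq0 => c _; rewrite natrX expf_neq0// pnatr_eq0 -lt0n prime_gt0//.
  exact: (valP (val c.1)).
rewrite -[fine _](mulfK p0) -h mul1r /vol -prodfV; congr EFin.
by apply: eq_bigr => c _; rewrite natrX.
Qed.
End Cells.

(** * Density theorem *)

Section MaximalInequality.
Variables (T : {fset primeT}) (d : nat) (R : realType).
Variables (mu : {measure set (QT_borel T d) -> \bar R}).
Hypothesis haar_mu : is_haar mu.
Local Notation D := (T * 'I_d)%type.
Local Notation Z := (@ZT T d : set (QT_borel T d)).
Implicit Types (x y z : QT T d) (e : D -> nat) (A E : set (QT_borel T d)).

Lemma mu_le1 A : measurable A -> A `<=` Z -> (mu A <= 1)%E.
Proof.
move=> mA AZ; have [<- _] := haar_mu; apply: le_measure; rewrite ?inE//.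
exact: measurable_ZT.
Qed.

Lemma mu_fin_num A : measurable A -> A `<=` Z -> mu A \is a fin_num.
Proof.
by move=> mA AZ; rewrite ge0_fin_numE// (le_lt_trans (mu_le1 mA AZ))// ltry.
Qed.

Lemma mu_cells e (P : pred (residues e)) E : measurable E ->
  (forall g, P g -> reduced g) ->
  mu (E `&` \bigcup_(g in [set g | P g]) box e (intpt g)) =
  (\sum_(g | P g) mu (E `&` box e (intpt g)))%E.
Proof.
move=> mE Pr; rewrite setI_bigcupr measure_finType_bigcup// => [g _|g g' Pg Pg' [z [[_ zg] [_ zg']]]].
  by apply: measurableI => //; exact: measurable_box.
by apply: residue_uniq; [exact: Pr|exact: Pr|exists z].
Qed.

Definition dense_pts (k : R) E N : set (QT_borel T d) :=
  [set x | Z x /\ exists e, (forall c, (e c <= N)%N) /\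
     ((k * vol R e)%:E <= mu (E `&` box e x))%E].

Lemma dense_pts_box k E N x : dense_pts k E N x ->
  box (fun=> N) x `<=` dense_pts k E N.
Proof.
move=> [xZ [e [eN ke]]] y xy; split; first exact: boxZ xy.
exists e; split=> //; have xy' : box e x y by apply: subset_box xy.
by rewrite -(box_eq xy').
Qed.

Lemma measurable_dense_pts k E N : measurable (dense_pts k E N).
Proof.
apply: open_measurable_QT; rewrite openE => x /dense_pts_box xB.
apply: filterS xB _; apply: open_nbhs_nbhs; split; first exact: open_box.
exact: box_refl.
Qed.

Definition residue_ball e x (c : D) k : {set 'I_(modbound e)} :=
  [set r : 'I_(modbound e) | (r < val (val c.1) ^ e c)%N &&
    (padic_abs (x c.1 0 c.2 - (r : nat)%:R) <= prad (val c.1) k)].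

Lemma in_residue_ball e x c k (r : 'I_(modbound e)) : (r \in residue_ball e x c k) =
  (r < val (val c.1) ^ e c)%N && (padic_abs (x c.1 0 c.2 - (r : nat)%:R) <= prad (val c.1) k).
Proof. by rewrite inE. Qed.

Lemma laminar_residue_ball e c :
  laminar [pred J | `[< exists x k, J = residue_ball e x c k >]].
Proof.
move=> _ _ /asboolP[x [k ->]] /asboolP[y [l ->]].
have sub x1 x2 k1 k2 r : (k1 <= k2)%N ->
    r \in residue_ball e x1 c k1 -> r \in residue_ball e x2 c k2 ->
    residue_ball e x2 c k2 \subset residue_ball e x1 c k1.
  move=> k12; rewrite !inE => /andP[_ r1] /andP[_ r2].
  apply/fintype.subsetP => r'; rewrite !inE => /andP[-> h]/=.
  have le12 : prad (val c.1) k2 <= prad (val c.1) k1 by rewrite le_prad.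
  apply: (padic_dist_trans r1); apply: padic_dist_trans (le_trans h le12).
  by rewrite padic_distC (le_trans r2).
have [|/pred0Pn[r /andP[/= r1 r2]]] :=
  boolP [disjoint residue_ball e x c k & residue_ball e y c l].
  by rewrite !orbT.
have [kl|lk] := leqP k l; first by rewrite (sub x y k l r kl r1 r2) orbT.
by rewrite (sub y x l k r (ltnW lk) r2 r1).
Qed.

Lemma box_slab e e' x (g : residues e) : (forall c, (e' c <= e c)%N) -> ZT x ->
  box e' x = \bigcup_(h in [set h : residues e |
    h \in slab (enum {: D}) [ffun c => residue_ball e x c (e' c)] g]) box e (intpt h).
Proof.
move=> e'e xZ; apply/seteqP; split=> [y xy|y [h /slabP hs hy] c].
- have [h hr hy] := residue_ex e (boxZ xZ xy); exists h => //=.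
  apply/slabP => c; rewrite mem_enum /= ffunE in_residue_ball; apply/andP; split; first exact: (forallP hr).
  rewrite -cdist_intpt; apply: cdist_trans (xy c) _; rewrite cdistC.
  by rewrite (le_trans (hy c))// le_prad.
- have := hs c; rewrite mem_enum /= ffunE in_residue_ball => /andP[_].
  rewrite -cdist_intpt => h1; apply: (cdist_trans h1).
  by rewrite (le_trans (hy c))// le_prad.
Qed.

Lemma slab_reduced e e' x (g h : residues e) :
  h \in slab (enum {: D}) [ffun c => residue_ball e x c (e' c)] g -> reduced h.
Proof.
move=> /slabP hs; apply/forallP => c; have := hs c.
by rewrite mem_enum /= ffunE in_residue_ball => /andP[].
Qed.

Lemma strong_maximal_inequality k E N : 0 < k -> measurable E -> E `<=` Z ->
  (mu (dense_pts k E N) <= (weak_const k #|{: D}|)%:E * mu E)%E.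
Proof.
move=> k0 mE EZ; pose e0 : D -> nat := fun=> N; pose V := vol R e0.
have V0 : 0 < V by exact: vol_gt0.
have mEb g : measurable (E `&` box e0 (intpt g)).
  by apply: measurableI => //; exact: measurable_box.
have finEb x e : mu (E `&` box e x) \is a fin_num.
  apply: mu_fin_num; last by move=> y [/EZ].
  by apply: measurableI => //; exact: measurable_box.
have Ebound (g : residues e0) : fine (mu (E `&` box e0 (intpt g))) <= V.
  rewrite -lee_fin fineK// -(mu_box haar_mu e0 (intpt g)); apply: le_measure; rewrite ?inE//.
  exact: measurable_box.
pose w (g : residues e0) : R :=
  if reduced g then fine (mu (E `&` box e0 (intpt g))) / V else 0.
have w01 g : 0 <= w g <= 1.
  rewrite /w; case: ifP => _; last by rewrite lexx ler01.
  by rewrite divr_ge0 ?fine_ge0 ?(ltW V0)//= ler_pdivrMr// mul1r.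
have sumw (P : pred (residues e0)) : (forall g, P g -> reduced g) ->
    \sum_(g | P g) w g = fine (mu (E `&` \bigcup_(g in [set g | P g]) box e0 (intpt g))) / V.
  move=> Pr; rewrite mu_cells// (eq_bigr (fun g => (fine (mu (E `&` box e0 (intpt g))))%:E)).
    rewrite sumEFin/= mulr_suml; apply: eq_bigr => g Pg.
    by rewrite /w Pr.
  by move=> g _; rewrite fineK.
pose L (c : D) : {pred {set 'I_(modbound e0)}} :=
  [pred J | `[< exists x k, J = residue_ball e0 x c k >]].
pose DS := dense_set L (enum {: D}) k w.
have cover : dense_pts k E N `<=`
    \bigcup_(g in [set g | (g \in DS) && reduced g]) box e0 (intpt g).
  move=> x [xZ [e [eN ke]]]; have [g gr gx] := residue_ex e0 xZ.
  exists g => //; apply/andP; split=> //.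
  pose J : {ffun D -> {set 'I_(modbound e0)}} := [ffun c => residue_ball e0 x c (e c)].
  rewrite inE; apply/existsP; exists J; apply/and3P; split.
  - by apply/forallP => c; rewrite ffunE; apply/asboolP; exists x, (e c).
  - apply/slabP => c; rewrite mem_enum /= ffunE in_residue_ball.
    apply/andP; split; first exact: (forallP gr).
    rewrite -cdist_intpt cdistC.
    by rewrite (le_trans (gx c))// le_prad.
  - have card : #|slab (enum {: D}) J g|%:R * V = vol R e.
      have := mu_box haar_mu e x; rewrite (box_slab (e := e0) g)//.
      rewrite -[X in mu X]setTI mu_cells//; last by move=> h; exact: slab_reduced.
      under eq_bigr do rewrite setTI mu_box//.
      by rewrite sumEFin sumr_const => -[<-]; rewrite mulr_natl.
    rewrite sumw; last by move=> h; exact: slab_reduced.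
    by rewrite -box_slab// ler_pdivlMr// -mulrA card -lee_fin fineK.
apply: (@le_trans _ _ (mu (\bigcup_(g in [set g | (g \in DS) && reduced g]) box e0 (intpt g)))).
  apply: le_measure; rewrite ?inE//; first exact: measurable_dense_pts.
  by apply: bigcup_finType_measurable => g _; exact: measurable_box.
rewrite -[X in mu X]setTI mu_cells//; last by move=> g /andP[].
under eq_bigr do rewrite setTI mu_box//.
have sumE : \sum_g w g = fine (mu E) / V.
  rewrite (bigID (@reduced T d e0))/= [X in _ + X]big1 ?addr0 => [|g /negPf gr]; last by rewrite /w gr.
  rewrite sumw//.
  by rewrite -ZT_cells setIidl.
rewrite sumEFin -[mu E]fineK; last exact: mu_fin_num.
rewrite -EFinM lee_fin sumr_const -mulr_natl -ler_pdivlMr// -mulrA -sumE.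
have lam c : laminar (L c) by exact: laminar_residue_ball.
rewrite [X in weak_const _ X]cardE.
apply: le_trans (card_dense_set lam (enum_uniq _) k0 w01); rewrite ler_nat.
by apply/subset_leq_card/fintype.subsetP => g /andP[].
Qed.
End MaximalInequality.

Lemma measure_small_tail (dd : measure_display) (X : measurableType dd) (R : realType)
    (mu : {measure set X -> \bar R}) (F : nat -> set X) (eps : R) :
  (forall n, measurable (F n)) -> (mu (F 0%N) < +oo)%E ->
  (forall n, F n.+1 `<=` F n) -> \bigcap_n F n = set0 -> 0 < eps ->
  exists n, (mu (F n) <= eps%:E)%E.
Proof.
move=> mF F0 decF capF eps0.
have dec : {homo F : n m / (n <= m)%N >-> (m <= n)%O}.
  by apply/nonincreasing_seqP => n; apply/subsetPset; exact: decF.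
have mcap : measurable (\bigcap_n F n) by rewrite capF.
have := nonincreasing_cvg_mu F0 mF mcap dec; rewrite capF measure0.
move=> /fine_cvgP[_]/cvgrPdist_le/(_ _ eps0)[n _ /(_ n (leqnn n))/= h].
exists n; have fin : mu (F n) \is a fin_num.
  rewrite ge0_fin_numE// (le_lt_trans _ F0)//; apply: le_measure; rewrite ?inE//.
  by apply/subsetPset; exact: dec.
rewrite -(fineK fin) lee_fin; move: h; rewrite sub0r normrN ger0_norm// fine_ge0.
Qed.

Lemma negligible_cover (dd : measure_display) (X : measurableType dd) (R : realType)
    (mu : {measure set X -> \bar R}) (B : set X) :
  (forall eps : R, 0 < eps -> exists M, [/\ measurable M, B `<=` M & (mu M <= eps%:E)%E]) ->
  mu.-negligible B.
Proof.
move=> cov.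
have /choice[M hM] : forall n : nat, exists M,
    [/\ measurable M, B `<=` M & (mu M <= (n.+1%:R^-1)%:E)%E].
  by move=> n; apply: cov; rewrite invr_gt0.
exists (\bigcap_n M n); split.
- by apply: bigcap_measurable => // n _; have [] := hM n.
- apply/eqP; rewrite eq_le measure_ge0 andbT; apply/lee_addgt0Pr => eps eps0; rewrite add0e.
  have [n hn] : exists n : nat, n.+1%:R^-1 < eps.
    exists (Num.trunc eps^-1); rewrite invf_plt ?posrE//.
    by rewrite truncnS_gt// invr_ge0 ltW.
  have [mMn _ h] := hM n; rewrite (le_trans _ (le_trans h _)) ?lee_fin ?(ltW hn)//.
  apply: le_measure; rewrite ?inE//; last exact: bigcap_inf.
  by apply: bigcap_measurable => // j _; have [] := hM j.
- by move=> x Bx n _; have [_ h _] := hM n; exact: h.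
Qed.

Section Regularity.
Variables (T : {fset primeT}) (d : nat) (R : realType).
Variables (mu : {measure set (QT_borel T d) -> \bar R}).
Hypothesis haar_mu : is_haar mu.
Local Notation D := (T * 'I_d)%type.
Local Notation Z := (@ZT T d : set (QT_borel T d)).
Implicit Types (x y z : QT T d) (e : D -> nat) (A E O : set (QT_borel T d)).

Definition inner_cells O (N : nat) : set (QT_borel T d) :=
  [set x | Z x /\ box (fun=> N) x `<=` O].

Lemma inner_cells_box O N x : inner_cells O N x -> box (fun=> N) x `<=` inner_cells O N.
Proof.
move=> [xZ xO] y xy; split; first exact: boxZ xy.
by rewrite -(box_eq xy).
Qed.

Lemma open_inner_cells O N : @open (QT T d) (inner_cells O N).
Proof.
rewrite openE => x /inner_cells_box xB.
apply: filterS xB _; apply: open_nbhs_nbhs; split; first exact: open_box.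
exact: box_refl.
Qed.

Lemma open_setC_inner_cells O N : @open (QT T d) (~` inner_cells O N).
Proof.
rewrite openE => x xO; apply: (@filterS _ _ _ (box (fun=> N) x)) => [y xy yO|].
  apply: xO; apply: (inner_cells_box yO); rewrite -(box_eq xy); exact: box_refl.
by apply: open_nbhs_nbhs; split; [exact: open_box | exact: box_refl].
Qed.

Lemma inner_cellsS O N : inner_cells O N `<=` inner_cells O N.+1.
Proof.
move=> x [xZ xO]; split=> //; apply: subset_trans xO.
by apply: subset_box => c.
Qed.

Lemma bigcup_inner_cells O : @open (QT T d) O -> \bigcup_N inner_cells O N = Z `&` O.
Proof.
move=> oO; apply/seteqP; split=> x; first by move=> [N _ [xZ xO]]; split=> //; apply: xO; exact: box_refl.
move=> [xZ xO]; have [N NO] : exists N, box (fun=> N) x `<=` O.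
  by apply: nbhs_box; exact: open_nbhs_nbhs.
by exists N.
Qed.

Lemma measurable_closed_QT A : @open (QT T d) (~` A) -> measurable A.
Proof. by move=> /open_measurable_QT/measurableC; rewrite setCK. Qed.

Lemma measurable_inner_cells O N : measurable (inner_cells O N).
Proof. by apply: open_measurable_QT; exact: open_inner_cells. Qed.

Definition regular A := forall eps : R, 0 < eps -> exists V F : set (QT_borel T d),
  [/\ @open (QT T d) V, @open (QT T d) (~` F), F `<=` A, A `<=` V &
   (mu (Z `&` (V `\` F)) <= eps%:E)%E].

Lemma mu_Z_fin A : measurable A -> (mu (Z `&` A) < +oo)%E.
Proof.
move=> mA; rewrite ltey_eq (mu_fin_num haar_mu)//.
by apply: measurableI => //; exact: measurable_ZT.
Qed.

Lemma regular_open O : @open (QT T d) O -> regular O.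
Proof.
move=> oO eps eps0; pose F N := Z `&` (O `\` inner_cells O N).
have mF N : measurable (F N).
  apply: measurableI; first exact: measurable_ZT.
  by apply: measurableD; [exact: open_measurable_QT|exact: measurable_inner_cells].
have F0 : (mu (F 0%N) < +oo)%E.
  by apply: mu_Z_fin; apply: measurableD; [exact: open_measurable_QT|exact: measurable_inner_cells].
have decF N : F N.+1 `<=` F N.
  by move=> x [xZ [xO nx]]; split=> //; split=> // /inner_cellsS.
have capF : \bigcap_N F N = set0.
  apply/seteqP; split=> // x Fx; have [xZ [xO _]] := Fx 0%N I.
  have : (Z `&` O) x by [].
  by rewrite -bigcup_inner_cells// => -[N _ xN]; have [_ [_ /(_ xN)]] := Fx N I.
have [N FN] := measure_small_tail mF F0 decF capF eps0.
exists O, (inner_cells O N); split=> //; first exact: open_setC_inner_cells.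
  by move=> x [_]; apply; exact: box_refl.
Qed.

Lemma regular_setC A : regular A -> regular (~` A).
Proof.
move=> rA eps eps0; have [V [F [oV oF FA AV h]]] := rA eps eps0.
exists (~` F), (~` V); split=> //; first by rewrite setCK.
- exact: subsetC.
- exact: subsetC.
- by rewrite setDE setCK setIC [_ `&` V]setIC -setDE setIC.
Qed.

Lemma regular_bigcup (A : nat -> set (QT_borel T d)) :
  (forall n, regular (A n)) -> regular (\bigcup_n A n).
Proof.
move=> rA eps eps0.
have e2 n : 0 < eps / 2 / (2 ^ n.+1)%:R by rewrite !divr_gt0// ltr0n expn_gt0.
have /choice[W hW] : forall n, exists W : set (QT_borel T d) * set (QT_borel T d),
    [/\ @open (QT T d) W.1, @open (QT T d) (~` W.2), W.2 `<=` A n, A n `<=` W.1 &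
    (mu (Z `&` (W.1 `\` W.2)) <= (eps / 2 / (2 ^ n.+1)%:R)%:E)%E].
  by move=> n; have [V [F h]] := rA n _ (e2 n); exists (V, F).
pose O n := (W n).1; pose F n := (W n).2.
have mO n : measurable (O n) by apply: open_measurable_QT; have [] := hW n.
have mF n : measurable (F n) by apply: measurable_closed_QT; have [] := hW n.
pose FU K := \bigcup_(n < K) F n.
have mFU K : measurable (FU K) by apply: bigcup_measurable => n _.
have mZ := @measurable_ZT T d.
pose G K := Z `&` (\bigcup_n F n `\` FU K).
have mG K : measurable (G K).
  by apply: measurableI => //; apply: measurableD => //; exact: bigcup_measurable.
have G0 : (mu (G 0%N) < +oo)%E.
  by apply: mu_Z_fin; apply: measurableD => //; exact: bigcup_measurable.
have decG K : G K.+1 `<=` G K.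
  move=> x [xZ [xF nx]]; split=> //; split=> // -[n /= nK Fx]; apply: nx.
  by exists n => //=; rewrite (ltn_trans nK).
have capG : \bigcap_K G K = set0.
  apply/seteqP; split=> // x Gx; have [xZ [[n _ Fx] _]] := Gx 0%N I.
  by have [_ [_]] := Gx n.+1 I; apply; exists n => /=.
have eps20 : 0 < eps / 2 by rewrite divr_gt0.
have [K GK] := measure_small_tail mG G0 decG capG eps20.
exists (\bigcup_n O n), (FU K); split.
- by apply: bigcup_open => n _; have [] := hW n.
- rewrite /FU bigcup_mkord; elim: K {GK} => [|K IH].
    by rewrite big_ord0 setC0; exact: openT.
  by rewrite big_ord_recr/= setCU; apply: openI => //; have [] := hW K.
- by move=> x [n _ Fx]; exists n => //; have [_ _ h _ _] := hW n; exact: h.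
- by move=> x [n _ Ax]; exists n => //; have [_ _ _ h _] := hW n; exact: h.
pose H n := Z `&` (O n `\` F n).
have mH n : measurable (H n) by apply: measurableI => //; exact: measurableD.
apply: (@le_trans _ _ (mu (\bigcup_n H n `|` G K))).
  apply: le_measure; rewrite ?inE.
  - by apply: measurableI => //; apply: measurableD => //; exact: bigcup_measurable.
  - by apply: measurableU => //; exact: bigcup_measurable.
  - move=> x [xZ [[n _ Ox] nF]].
    have [[k _ Fx]|nFx] := pselect ((\bigcup_n F n) x); first by right; split=> //; split=> //; exists k.
    by left; exists n => //; split=> //; split=> // Fx; apply: nFx; exists n.
rewrite [in leRHS](splitr eps) EFinD (le_trans (measureU2 _ _ _))//; first exact: bigcup_measurable.
apply: leeD => //; apply: (le_trans (measure_sigma_subadditive mu mH _ (@subset_refl _ _))).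
  exact: bigcup_measurable.
apply: le_trans (epsilon_trick0 xpredT (ltW _)); last by rewrite divr_gt0.
by apply: lee_nneseries => // n _; have [] := hW n.
Qed.

Lemma measurable_regular A : measurable A -> regular A.
Proof.
apply: smallest_sub => [|O]; last exact: regular_open.
split; first exact/regular_open/open0.
- by move=> A' /regular_setC; rewrite setTD.
- by move=> F hF; exact: regular_bigcup.
Qed.

Lemma strong_density (k : R) A : 0 < k -> measurable A ->
  mu.-negligible [set x | [/\ Z x, A x & forall N, exists e, (forall c, (N <= e c)%N) /\
    (mu (A `&` box e x) <= ((1 - k) * vol R e)%:E)%E]].
Proof.
move=> k0 mA; set B := [set x | _].
have mZ := @measurable_ZT T d.
pose C := weak_const k #|{: D}|.
have C0 : 0 <= C by exact: weak_const_ge0.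
have cov eps : 0 < eps -> exists M : set (QT_borel T d),
    [/\ measurable M, B `<=` M & (mu M <= eps%:E)%E].
  move=> eps0.
  have eps'0 : 0 < eps / (C + 1) by rewrite divr_gt0// ltr_wpDl.
  have [V [F [oO oF FA AO h]]] := measurable_regular mA eps'0; pose O := V.
  have mO : measurable O by exact: open_measurable_QT.
  have mF : measurable F by exact: measurable_closed_QT.
  pose E := Z `&` (O `\` A).
  have mE : measurable E by apply: measurableI => //; exact: measurableD.
  have muE : (mu E <= (eps / (C + 1))%:E)%E.
    apply: le_trans h; apply: le_measure; rewrite ?inE//.
      by apply: measurableI => //; exact: measurableD.
    by move=> x [xZ [xO xA]]; split=> //; split=> // /FA.
  pose M := \bigcup_N dense_pts mu k E N.
  have mM : measurable M by apply: bigcup_measurable => N _; exact: measurable_dense_pts.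
  exists M; split=> //.
  - move=> x [xZ xA xe]; have [N NO] : exists N, box (fun=> N) x `<=` O.
      by apply: nbhs_box; apply: open_nbhs_nbhs; split=> //; exact: AO.
    have [e [Ne he]] := xe N; exists (\max_c e c)%N => //; split=> //.
    exists e; split=> [c|]; first exact: leq_bigmax.
    have mb := measurable_box e x.
    have eO : box e x `<=` O by apply: subset_trans NO; exact: subset_box.
    have -> : E `&` box e x = box e x `\` A.
      apply/seteqP; split=> y; first by move=> [[_ [_ yA]] yb].
      by move=> [yb yA]; split=> //; split; [exact: boxZ yb|split=> //; exact: eO].
    have bfin : (mu (box e x) < +oo)%E by rewrite (mu_box haar_mu) ltry.
    have -> : (mu (box e x `\` A) = mu (box e x) - mu (box e x `&` A))%E by exact: measureD.
    rewrite (mu_box haar_mu) setIC leeBrDr; last first.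
      by rewrite ge0_fin_numE// (le_lt_trans (measureIr mu mA mb)).
    rewrite (le_trans (leeD2l _ he))// -EFinD lee_fin -mulrDl addrC subrK mul1r//.
  - have cvgM : (mu \o dense_pts mu k E) x @[x --> \oo] --> mu M.
      apply: nondecreasing_cvg_mu => //; first by move=> N; exact: measurable_dense_pts.
      apply/nondecreasing_seqP => N; apply/subsetPset => x [xZ [e [eN he]]]; split=> //.
      by exists e; split=> // c; rewrite (leq_trans (eN c)).
    rewrite -(cvg_lim _ cvgM)//; apply: lime_le; first by apply/cvg_ex; exists (mu M).
    have EZ : E `<=` Z by move=> ? [].
    apply: nearW => N /=; have h1 := strong_maximal_inequality haar_mu N k0 mE EZ.
    apply: (le_trans h1).
    apply: (le_trans (lee_wpmul2l _ muE)); first by rewrite lee_fin.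
    rewrite -EFinM lee_fin mulrCA ler_piMr ?(ltW eps0)// ler_pdivrMr ?ltr_wpDl// mul1r lerDl//.
exact: negligible_cover.
Qed.
End Regularity.

Section Restriction.
Variables (T T' : {fset primeT}) (d : nat) (R : realType).
Variables (mu : {measure set (QT_borel T d) -> \bar R}).
Variables (mu' : {measure set (QT_borel T' d) -> \bar R}).
Hypotheses (haar_mu : is_haar mu) (haar_mu' : is_haar mu').
Hypothesis T'T : (T' `<=` T)%fset.
Local Notation Z := (@ZT T d : set (QT_borel T d)).
Local Notation Z' := (@ZT T' d : set (QT_borel T' d)).

Definition restrict_primes (x : QT T d) : QT T' d := fun v => x (fincl T'T v).

Let lift_exp (N : nat) (c : T * 'I_d) : nat := if val c.1 \in T' then N else 0%N.

Lemma restrict_primesZ x : ZT x -> ZT (restrict_primes x).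
Proof. by move=> xZ v i; exact: (xZ (fincl T'T v) i). Qed.

Lemma cdist_restrict x y (v' : T') (v : T) i : val v' = val v ->
  cdist (restrict_primes x) (restrict_primes y) (v', i) = cdist x y (v, i).
Proof.
move=> v'v; have -> // : v = fincl T'T v'.
by apply/val_inj; rewrite /= -v'v.
Qed.

Lemma vol_pair (T0 : {fset primeT}) (e : T0 * 'I_d -> nat) :
  vol R e = \prod_(v : T0) \prod_(i < d) (val (val v))%:R ^- e (v, i).
Proof. by rewrite pair_bigA; apply: eq_bigr => -[]. Qed.

Lemma vol_lift_exp N : vol R (lift_exp N) = vol R ((fun=> N) : T' * 'I_d -> nat).
Proof.
rewrite !vol_pair.
pose G (v : primeT) : R := \prod_(i < d) (val v)%:R ^- N.
pose G' (v : primeT) : R := \prod_(i < d) (val v)%:R ^- (if v \in T' then N else 0%N).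
transitivity (\prod_(v <- T') G v); last by rewrite big_seq_fsetE.
transitivity (\prod_(v <- T) G' v); first by rewrite big_seq_fsetE.
rewrite -(big_fset_incl _ T'T) => [|v _ vT'].
  by apply: eq_big_seq => v vT'; rewrite /G' vT'.
by rewrite /G' (negPf vT') big1// => i _; rewrite expr0 invr1.
Qed.

Lemma mu_restrict_cells O N :
  (mu (Z `&` restrict_primes @^-1` inner_cells O N) <= mu' (inner_cells O N))%E.
Proof.
pose e' : T' * 'I_d -> nat := fun=> N.
pose P (g : residues e') := reduced g && `[< box e' (intpt g) `<=` O >].
have Pr g : P g -> reduced g by move=> /andP[].
have innerE : inner_cells O N = \bigcup_(g in [set g | P g]) box e' (intpt g).
  apply/seteqP; split=> [x [xZ xO]|x [g /andP[gr /asboolP gO] gx]].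
    have [g gr gx] := residue_ex e' xZ; exists g => //=.
    by rewrite /P gr/=; apply/asboolP; rewrite (box_eq gx).
  split; first exact: boxZ (intptZ _) _ gx.
  by rewrite -(box_eq gx).
have cellE (g : residues e') x0 : Z x0 -> box e' (intpt g) (restrict_primes x0) ->
    Z `&` restrict_primes @^-1` box e' (intpt g) = box (lift_exp N) x0.
  move=> x0Z gx0; rewrite (box_eq gx0); apply/seteqP; split=> [x [xZ xb] [v i]|x xb].
    rewrite /lift_exp/=; case: ifPn => vT'; first by have := xb ([` vT']%fset, i); rewrite (@cdist_restrict _ _ _ v).
    by rewrite prad0 padic_absBle//; [exact: x0Z|exact: xZ].
  split; first exact: boxZ xb.
  move=> [v i]; have := xb (fincl T'T v, i); rewrite /lift_exp/= (valP v).
  by rewrite (@cdist_restrict _ _ v (fincl T'T v)).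
have mcell (g : residues e') : measurable (Z `&` restrict_primes @^-1` box e' (intpt g)).
  have [[x0 [x0Z gx0]]|nx] := pselect (exists x, ZT x /\ box e' (intpt g) (restrict_primes x)).
    by rewrite (cellE _ x0 x0Z gx0)//; exact: measurable_box.
  rewrite (_ : _ `&` _ = set0); first exact: measurable0.
  by apply/seteqP; split=> // x [xZ xg]; apply: nx; exists x.
have mucell (g : residues e') : (mu (Z `&` restrict_primes @^-1` box e' (intpt g)) <= mu' (box e' (intpt g)))%E.
  have [[x0 [x0Z gx0]]|nx] := pselect (exists x, ZT x /\ box e' (intpt g) (restrict_primes x)).
    by rewrite (cellE _ x0 x0Z gx0)// !mu_box// vol_lift_exp.
  rewrite (_ : _ `&` _ = set0) ?measure0//.
  by apply/seteqP; split=> // x [xZ xg]; apply: nx; exists x.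
rewrite innerE preimage_bigcup setI_bigcupr -[X in mu' X]setTI mu_cells//.
rewrite measure_finType_bigcup//.
  by apply: lee_sum => g _; rewrite setTI.
move=> g g' /Pr gr /Pr gr' [x [[_ xg] [_ xg']]].
by apply: residue_uniq => //; exists (restrict_primes x).
Qed.

Lemma negligible_restrict (A : set (QT_borel T' d)) :
  mu'.-negligible A -> mu.-negligible (Z `&` restrict_primes @^-1` A).
Proof.
move=> [B [mB B0 AB]].
apply: negligible_cover => eps eps0.
  have [W0 [F [oO oF FB BO h]]] := measurable_regular haar_mu' mB eps0.
  have mO : measurable W0 by exact: open_measurable_QT.
  have mF : measurable F by exact: measurable_closed_QT.
  have mZ' := @measurable_ZT T' d.
  have muO : (mu' (Z' `&` W0) <= eps%:E)%E.
    apply: (@le_trans _ _ (mu' (Z' `&` (W0 `\` F) `|` B))).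
      apply: le_measure; rewrite ?inE; first exact: measurableI.
        by apply: measurableU => //; apply: measurableI => //; exact: measurableD.
      move=> x [xZ xO]; have [xF|xF] := pselect (F x); first by right; exact: FB.
      by left.
    rewrite (le_trans (measureU2 _ _ _))//; first by apply: measurableI => //; exact: measurableD.
    by rewrite [X in (_ + X)%E]B0 adde0.
  pose V N := Z `&` restrict_primes @^-1` inner_cells W0 N.
  have oV N : @open (QT T d) (V N).
    rewrite openE => x [xZ xN]; apply: (@filterS _ _ _ (box (fun=> N) x)) => [y xy|].
      split; first exact: boxZ xy.
      apply: (inner_cells_box xN) => -[v i].
      by rewrite (@cdist_restrict _ _ v (fincl T'T v)); have := xy (fincl T'T v, i).
    by apply: open_nbhs_nbhs; split; [exact: open_box | exact: box_refl].
  have mV N : measurable (V N) by apply: open_measurable_QT; exact: oV.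
  exists (\bigcup_N V N); split; first exact: bigcup_measurable.
    move=> x [xZ xA]; have : (Z' `&` W0) (restrict_primes x).
      by split; [exact: restrict_primesZ|apply/BO/AB].
    by rewrite -bigcup_inner_cells// => -[N _ xN]; exists N.
  have mUV : measurable (\bigcup_N V N) by exact: bigcup_measurable.
  have cvgV : (mu \o V) x @[x --> \oo] --> mu (\bigcup_N V N).
    apply: nondecreasing_cvg_mu => //.
    apply/nondecreasing_seqP => N; apply/subsetPset => x [xZ xN]; split=> //.
    exact: inner_cellsS.
  rewrite -(cvg_lim _ cvgV)//; apply: lime_le; first by apply/cvg_ex; exists (mu (\bigcup_N V N)).
  apply: nearW => N /=; apply: (le_trans (mu_restrict_cells W0 N)); apply: le_trans muO.
  apply: le_measure; rewrite ?inE; first exact: measurable_inner_cells.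
    exact: measurableI.
  by rewrite -bigcup_inner_cells// => x xN; exists N.
Qed.
End Restriction.

(** * Ultrametric differentiability *)

Section Differentiability.
Variables (p : primeT) (d m : nat).
Local Notation K := (Qp p).
Implicit Types (x y a : 'rV[K]_d) (i : 'I_d) (u : K).

Let step_order i : 'I_d -> nat := fun j => (j == i).

Let step_nodes i y u : prod_topology (fun j : 'I_d => 'rV[K]_(step_order i j).+1) :=
  fun j => \row_k (if (j == i) && (k == 0 :> nat) then u else y 0 j).

Lemma partial_diff_quot_step (f : 'rV[K]_d -> 'rV[K]_m) i y u :
  partial_diff_quot f (step_nodes i y u) =
  (u - y 0 i)^-1 *: (f (set_coord y i u) - f y).
Proof.
rewrite /partial_diff_quot.
pose op j (g : 'rV[K]_d -> 'rV[K]_m) x :=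
  diff_quot (fun t => g (set_coord x j t)) (if j == i then u else y 0 j) (nseq (j == i) (y 0 j)).
rewrite [X in foldr X](_ : _ = op); last first.
  apply/funext => j; apply/funext => g; apply/funext => x.
  rewrite /op mxE eqxx andbT; congr diff_quot.
  rewrite (eq_map (g := fun=> y 0 j)) => [|k]; last by rewrite mxE andbF.
  have mapE (n : nat) (t : K) : [seq t | k <- enum 'I_n] = nseq n t.
    by rewrite -[n in RHS](size_enum_ord n); elim: (enum _) => //= k l ->.
  exact: mapE.
pose over (s : seq 'I_d) x : 'rV[K]_d := \row_j (if j \in s then y 0 j else x 0 j).
have H s x : uniq s -> foldr op f s x = if i \in s
    then (u - y 0 i)^-1 *: (f (set_coord (over s x) i u) - f (over s x))
    else f (over s x).
  elim: s x => [|j s IH] x /=.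
    by move=> _; congr f; apply/rowP => j; rewrite mxE.
  move=> /andP[js us]; rewrite inE eq_sym /op; have [ji|ji] := eqVneq j i; last first.
    rewrite /= IH//; have -> : over s (set_coord x j (y 0 j)) = over (j :: s) x; last by [].
    apply/rowP => k; rewrite !mxE inE; have [->|//] := eqVneq k j.
    by case: ifP.
  move: js us IH; rewrite ji => {j ji} js us IH; rewrite /= !IH// (negPf js).
  congr (_ *: (f _ - f _)); apply/rowP => k; rewrite !mxE inE.
    by have [->|//] := eqVneq k i; rewrite (negPf js).
  by have [->|//] := eqVneq k i; rewrite (negPf js).
rewrite H ?enum_uniq// mem_enum.
have -> : over (enum 'I_d) 0 = y by apply/rowP => j; rewrite mxE mem_enum.
by [].
Qed.

Lemma Ck_on_differentiable (U : set 'rV[K]_d) (f : 'rV[K]_d -> 'rV[K]_m) a :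
  Ck_on 2 U f -> U a -> exists J : 'M[K]_(d, m),
  forall theta : rat, 0 < theta -> exists2 delta : rat, 0 < delta &
  forall x, (forall i, padic_abs (x 0 i - a 0 i) < delta) -> U x /\
  forall rho : rat, 0 <= rho -> (forall i, padic_abs (x 0 i - a 0 i) <= rho) -> forall j,
    padic_abs (f x 0 j - f a 0 j - \sum_i (x 0 i - a 0 i) * J i j) <= theta * rho.
Proof.
move=> Cf Ua; have [r [r0 rU Hb]] := Cf a Ua.
have h i : exists g : prod_topology (fun j : 'I_d => 'rV[K]_(step_order i j).+1) -> 'rV[K]_m,
    (forall y u, (forall j, padic_abs (y 0 j - a 0 j) < r) -> padic_abs (u - a 0 i) < r ->
      u != y 0 i -> f (set_coord y i u) - f y = (u - y 0 i) *: g (step_nodes i y u)) /\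
    (forall theta : rat, 0 < theta -> exists2 delta : rat, 0 < delta &
      forall y u, (forall j, padic_abs (y 0 j - a 0 j) < delta) -> padic_abs (u - a 0 i) < delta ->
      forall k, padic_abs (g (step_nodes i y u) 0 k - g (step_nodes i a (a 0 i)) 0 k) <= theta).
  have sum_order : (\sum_(j < d) step_order i j <= 2)%N.
    rewrite (bigD1 i)//= /step_order eqxx big1// => j /negPf->//.
  have [g gc gE] := Hb (step_order i) sum_order; exists g; split.
    move=> y u ya ui uy.
    rewrite gE; last 2 first.
    - move=> j k; rewrite /ball/= /Qp_ball/= mxE padic_distC.
      case: ifP => [/andP[/eqP ji _]|_]; last exact: ya.
      by have -> : a 0 j = a 0 i by rewrite ji.
    - move=> j k1 k2; rewrite !mxE.
      have [ji|ji] := boolP (j == i); last first.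
        have so : ((step_order i j).+1 <= 1)%N by rewrite /step_order (negPf ji).
        have := leq_trans (ltn_ord k1) so; have := leq_trans (ltn_ord k2) so.
        by rewrite !ltnS !leqn0 => /eqP e2 /eqP e1 _; apply/val_inj; rewrite /= e1 e2.
      have -> : y 0 j = y 0 i by rewrite (eqP ji).
      have so : ((step_order i j).+1 <= 2)%N by rewrite /step_order ji.
      have h1 := leq_trans (ltn_ord k1) so; have h2 := leq_trans (ltn_ord k2) so.
      have uy' : y 0 i != u by rewrite eq_sym.
      case: (eqVneq (k1 : nat) 0%N) (eqVneq (k2 : nat) 0%N) => [e1|e1] [e2|e2] /= e.
      + by apply/val_inj; rewrite /= e1 e2.
      + by move/eqP: e; rewrite (negPf uy).
      + by move/eqP: e; rewrite (negPf uy').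
      + by apply/val_inj => /=; lia.
    by rewrite partial_diff_quot_step scalerA mulfV ?scale1r// subr_eq0.
  move=> theta theta0.
  have B0 j k : ball (a 0 j) r (step_nodes i a (a 0 i) j 0 k).
    rewrite /ball/= /Qp_ball/= mxE.
    case: ifP => [/andP[/eqP ji _]|_]; last by rewrite subrr padic_abs0.
    by have -> : a 0 j = a 0 i; rewrite ?ji// subrr padic_abs0.
  have /subspace_continuousP/(_ _ B0) gcont := gc.
  have /gcont/nbhs_prod_ballP[delta delta0 hd] :
      nbhs (g (step_nodes i a (a 0 i))) (ball (g (step_nodes i a (a 0 i))) theta).
    exact: nbhsx_ballx.
  exists (Num.min r delta); first by rewrite lt_min r0.
  move=> y u ya ua k.
  have hd1 j : ball (step_nodes i a (a 0 i) j) delta (step_nodes i y u j).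
    split=> // k1 k2; rewrite ord1 !mxE /ball/= /Qp_ball/= padic_distC.
    have ji_eq : j == i -> a 0 j = a 0 i by move=> /eqP->.
    have [ji|ji] /= := boolP (j == i); last by have := ya j; rewrite lt_min => /andP[].
    have ji_eq' : y 0 j = y 0 i by rewrite (eqP ji).
    rewrite ji_eq// ji_eq'; case: ifP => _.
      by move: ua; rewrite lt_min => /andP[].
    by have := ya i; rewrite lt_min => /andP[].
  have hd2 j k1 : ball (a 0 j) r (step_nodes i y u j 0 k1).
    rewrite /ball/= /Qp_ball/= padic_distC mxE.
    case: ifP => [/andP[/eqP ji _]|_].
      have -> : a 0 j = a 0 i by rewrite ji.
      by move: ua; rewrite lt_min => /andP[].
    by have := ya j; rewrite lt_min => /andP[].
  have [_ /(_ 0 k)] := hd _ hd1 hd2; rewrite /ball/= /Qp_ball/= padic_distC; exact: ltW.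
have {}h i := cid (h i).
pose g i := sval (h i).
have gE i := (svalP (h i)).1.
have gc i := (svalP (h i)).2.
exists (\matrix_(i, j) g i (step_nodes i a (a 0 i)) 0 j) => theta theta0.
have /choice[dl hdl] : forall i, exists delta : rat, 0 < delta /\
  forall y u, (forall j, padic_abs (y 0 j - a 0 j) < delta) -> padic_abs (u - a 0 i) < delta ->
      forall k, padic_abs (g i (step_nodes i y u) 0 k - g i (step_nodes i a (a 0 i)) 0 k) <= theta.
  by move=> i; have [delta ? ?] := gc i theta theta0; exists delta.
pose delta := \big[Num.min/r]_i dl i.
have dr : delta <= r by exact: bigmin_le_id.
have ddl i : delta <= dl i by exact: bigmin_le_cond.
exists delta.
  by apply/bigmin_gtP; split=> // i _; case: (hdl i).
move=> x xa; split.
  apply: rU; split=> // i j; rewrite ord1 /ball/= /Qp_ball/= padic_distC.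
  exact: lt_le_trans (xa j) dr.
move=> rho rho0 xrho j.
pose hyb (k : nat) : 'rV[K]_d := \row_j (if (j < k)%N then x 0 j else a 0 j).
have hyb_d : hyb d = x by apply/rowP => i; rewrite mxE ltn_ord.
have hyb_0 : hyb 0%N = a by apply/rowP => i; rewrite mxE.
have hybS (k : 'I_d) : hyb k.+1 = set_coord (hyb k) k (x 0 k).
  apply/rowP => i; rewrite !mxE ltnS leq_eqVlt; have [->|ik] := eqVneq i k.
    by rewrite eqxx.
  by rewrite (negPf (_ : val i != val k)).
have hyba k i : padic_abs (hyb k 0 i - a 0 i) < delta.
  rewrite mxE; case: ifP => // _; rewrite subrr padic_abs0.
  by apply: le_lt_trans (xa i); exact: padic_abs_ge0.
have stepE (k : 'I_d) : f (hyb k.+1) - f (hyb k) = (x 0 k - a 0 k) *: g k (step_nodes k (hyb k) (x 0 k)).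
  have hkk : hyb k 0 k = a 0 k by rewrite mxE ltnn.
  have [xk|xk] := eqVneq (x 0 k) (a 0 k).
    rewrite xk subrr scale0r hybS; apply/eqP; rewrite subr_eq0; apply/eqP; congr f.
    by apply/rowP => i; rewrite mxE; case: eqVneq => // ->; rewrite xk hkk.
  rewrite hybS -[a 0 k]hkk gE ?hkk//; first by move=> i; exact: lt_le_trans (hyba _ _) dr.
  exact: lt_le_trans (xa k) dr.
have -> : f x 0 j - f a 0 j = \sum_(k < d) (x 0 k - a 0 k) * g k (step_nodes k (hyb k) (x 0 k)) 0 j.
  have : \sum_(0 <= k < d) (f (hyb k.+1) - f (hyb k)) = f x - f a by rewrite telescope_sumr// hyb_d hyb_0.
  rewrite big_mkord => /matrixP/(_ 0 j); rewrite summxE !mxE => <-.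
  by apply: eq_bigr => k _; rewrite stepE mxE.
rewrite -sumrB; apply: padic_abs_sum => [|k _]; first by rewrite mulr_ge0// ltW.
rewrite mxE -mulrBr padic_absM mulrC ler_pM ?padic_abs_ge0//.
have [_ H] := hdl k; apply: H; last exact: lt_le_trans (xa k) (ddl k).
by move=> i; exact: lt_le_trans (hyba _ _) (ddl k).
Qed.
End Differentiability.

(** * Diophantine approximation *)

Lemma padic_pigeonhole (S : {fset primeT}) (n N H : nat) (e : S * 'I_n -> nat)
    (L : forall v : S, 'M[Qp (val v)]_(n, N)) :
  (forall v i k, padic_abs (L v i k) <= 1) ->
  (\prod_(c : S * 'I_n) val (val c.1) ^ e c < H.+1 ^ N)%N ->
  exists b : 'rV[int]_N, [/\ b != 0, forall k, (`|b 0%R k| <= H)%N &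
    forall v i, padic_abs (\sum_k (b 0 k)%:~R * L v i k) <= prad (val v) (e (v, i))].
Proof.
move=> L1 card_lt.
pose y (b : {ffun 'I_N -> 'I_H.+1}) : QT S n :=
  fun v => \row_i \sum_k (b k : nat)%:R * L v i k.
have yZ b : ZT (y b).
  move=> v i; rewrite mxE; apply: padic_abs_sum => // k _.
  by rewrite padic_absM mulr_ile1 ?padic_abs_ge0 ?padic_abs_nat_le1.
have /choice[g hg] : forall b, exists g : residues e, reduced g /\ box e (intpt g) (y b).
  by move=> b; have [g ? ?] := residue_ex e (yZ b); exists g.
have : ~~ injectiveb g.
  apply/negP => /injectiveP g_inj.
  have := subset_leq_card (_ : codom g \subset @reduced S n e).
  rewrite card_codom// card_ffun !card_ord card_reduced leqNgt card_lt => h.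
  suff : false by [].
  by apply: h; apply/fintype.subsetP => _ /codomP[b ->]; have [] := hg b.
move=> /injectivePn[b [b' bb' gbb']].
exists (\row_k ((b k : nat)%:Z - (b' k : nat)%:Z)); split.
- apply: contra_neq bb' => b0; apply/ffunP => k; apply/val_inj/eqP => /=.
  have /matrixP/(_ 0 k) := b0; rewrite !mxE => /eqP; rewrite subr_eq0.
  by rewrite eqz_nat.
- move=> k; rewrite mxE; have := ltn_ord (b k); have := ltn_ord (b' k).
  by lia.
- move=> v i; have [_ yb] := hg b; have [_ yb'] := hg b'.
  have h1 := yb (v, i); have := yb' (v, i); rewrite -gbb' => h2.
  rewrite cdistC in h1; have := cdist_trans h1 h2.
  rewrite /cdist !mxE/= -sumrB; congr (padic_abs _ <= _).
  by apply: eq_bigr => k _; rewrite mxE rmorphB/= mulrBl !pmulrn.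
Qed.

Section RealEstimates.
Variable R : realType.
Implicit Types (C a t : R) (p : primeT).

Lemma powR_unbounded C a : 0 < a -> exists N : nat, forall H, (N <= H)%N -> C < H%:R `^ a.
Proof.
move=> a0; exists (Num.trunc (`|C| `^ a^-1)).+1 => H NH.
have h : `|C| `^ a^-1 < H%:R.
  by apply: lt_le_trans (truncnS_gt _) _; rewrite ?powR_ge0// ler_nat.
rewrite (le_lt_trans (ler_norm C))//.
have -> : `|C| = (`|C| `^ a^-1) `^ a by rewrite -powRrM mulVf ?powRr1 ?gt_eqF.
by rewrite gt0_ltr_powR ?nnegrE ?powR_ge0.
Qed.

Lemma powRN_small C a t : 0 < a -> 0 < t ->
  exists N : nat, forall H, (N <= H)%N -> C * H%:R `^ (- a) < t.
Proof.
move=> a0 t0; have [N hN] := powR_unbounded (C / t) a0.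
exists N.+1 => H NH; have H0 : 0 < H%:R `^ a by rewrite powR_gt0// ltr0n (leq_ltn_trans _ NH).
rewrite powRN ltr_pdivrMr// mulrC -ltr_pdivrMr//.
by apply: hN; rewrite ltnW.
Qed.

Lemma padic_norm_ge0 p (x : Qp p) : 0 <= padic_norm R x.
Proof. by rewrite /padic_norm ler0q padic_abs_ge0. Qed.

Lemma padic_norm_eq0 p (x : Qp p) : (padic_norm R x == 0) = (x == 0).
Proof. by rewrite /padic_norm fmorph_eq0 padic_abs_eq0. Qed.

Lemma padic_normM p (x y : Qp p) : padic_norm R (x * y) = padic_norm R x * padic_norm R y.
Proof. by rewrite /padic_norm padic_absM rmorphM. Qed.

Lemma padic_normN p (x : Qp p) : padic_norm R (- x) = padic_norm R x.
Proof. by rewrite /padic_norm padic_absN. Qed.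

Lemma padic_norm_le p (x : Qp p) (r : rat) : (padic_norm R x <= ratr r) = (padic_abs x <= r).
Proof. by rewrite /padic_norm ler_rat. Qed.

Lemma padic_normDle p (x y : Qp p) t :
  padic_norm R x <= t -> padic_norm R y <= t -> padic_norm R (x + y) <= t.
Proof.
move=> xt yt; rewrite (@le_trans _ _ (ratr (Num.max (padic_abs x) (padic_abs y))))//.
  by rewrite ler_rat padic_absD.
by rewrite /Num.max; case: ifP.
Qed.

Lemma padic_normDlt p (x y : Qp p) t :
  padic_norm R x < t -> padic_norm R y < t -> padic_norm R (x + y) < t.
Proof.
move=> xt yt; rewrite (@le_lt_trans _ _ (ratr (Num.max (padic_abs x) (padic_abs y))))//.
  by rewrite ler_rat padic_absD.
by rewrite /Num.max; case: ifP.
Qed.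

Lemma padic_norm_int_le1 p (a : int) : padic_norm R (a%:~R : Qp p) <= 1.
Proof. by rewrite -[leRHS](rmorph1 (@ratr R)) padic_norm_le padic_abs_int rat_padic_abs_int_le1. Qed.

Lemma ratr_prad p e : ratr (prad p e) = (val p)%:R ^- e :> R.
Proof. by rewrite /prad fmorphV rmorphXn/= ratr_nat. Qed.

Lemma prime_gt1_real p : 1 < (val p)%:R :> R.
Proof. by rewrite ltr1n prime_gt1 ?(valP p). Qed.

Lemma prime_gt0_real p : 0 < (val p)%:R :> R.
Proof. exact: lt_trans ltr01 (prime_gt1_real p). Qed.

Lemma prime_power_between p t : 0 < t -> t <= 1 ->
  exists e, (val p)%:R ^- e < t /\ t <= (val p)%:R * (val p)%:R ^- e.
Proof.
move=> t0 t1; have q0 := prime_gt0_real p; have q1 := prime_gt1_real p.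
have ex : exists e, (val p)%:R ^- e < t.
  exists (Num.trunc t^-1).+1; set M := Num.trunc _.
  have h : t^-1 < M.+1%:R by rewrite /M truncnS_gt// invr_ge0 ltW.
  rewrite -[ltRHS]invrK ltf_pV2 ?posrE ?invr_gt0 ?exprn_gt0//.
  by rewrite (lt_le_trans h)// -natrX ler_nat ltnW// ltn_expl// prime_gt1 ?(valP p).
case: (ex_minnP ex) => -[|e] he emin.
  by move: he; rewrite expr0 invr1 ltNge t1.
exists e.+1; split=> //; rewrite leNgt; apply/negP => h.
have : (e.+1 <= e)%N; last by rewrite ltnn.
apply: emin; move: h; rewrite exprS invfM mulrA mulfV ?mul1r// gt_eqF//.
Qed.

Lemma prad_small_real p t : 0 < t -> exists N, ratr (prad p N) < t.
Proof.
move=> t0; have m0 : 0 < Num.min 1 t by rewrite lt_min ltr01.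
have m1 : Num.min 1 t <= 1 by rewrite ge_min lexx.
have [N [hN _]] := prime_power_between p m0 m1; exists N.
by rewrite ratr_prad (lt_le_trans hN)// ge_min lexx orbT.
Qed.

Lemma finite_set_pos_lb (I : choiceType) (B : set I) (F : I -> R) :
  finite_set B -> (forall b, B b -> 0 < F b) -> exists2 t : R, 0 < t & forall b, B b -> t <= F b.
Proof.
move=> finB F0; have /finite_fsetP[X BX] := finB.
exists (\big[Num.min/1]_(b <- X) F b).
  rewrite big_seq; elim/big_ind : _ => // [x y x0 y0|b bX]; first by rewrite lt_min x0.
  by apply: F0; rewrite BX.
move=> b; rewrite BX /= => bX.
elim: (enum_fset X) (bX : b \in enum_fset X) => // c s IH; rewrite inE big_cons => /orP[/eqP->|/IH h].
  by rewrite ge_min lexx.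
by rewrite ge_min h orbT.
Qed.

Lemma padic_norm_coprime p (a : nat) : ~~ (val p %| a)%N -> padic_norm R (a%:R : Qp p) = 1.
Proof.
move=> pa; rewrite -[RHS](rmorph1 (@ratr R)) /padic_norm; congr ratr.
have l0 : logn (val p) a = 0%N by rewrite lognE (negPf pa) !andbF.
have a0 : Posz a != 0 by apply: contraNneq pa => -[->]; rewrite dvdn0.
by rewrite pmulrn padic_abs_int (rat_padic_abs_int p a0) absz_nat l0 expr0 invr1.
Qed.

Lemma sup_norm_le n (b : 'rV[int]_n) H : (sup_norm R b <= H%:R) = [forall k, (`|b 0%R k| <= H)%N].
Proof.
rewrite /sup_norm ler_nat; apply/bigmax_leqP/forallP => h k; first exact: h.
by move=> _; exact: h.
Qed.

Lemma sup_norm_gt0 n (b : 'rV[int]_n) : b != 0 -> 0 < sup_norm R b.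
Proof.
move=> b0; rewrite /sup_norm ltr0n lt0n; apply: contra_neq b0 => h.
apply/rowP => k; rewrite mxE; apply/eqP; rewrite -absz_eq0 -leqn0.
by apply: leq_trans (eq_leq h); exact: (leq_bigmax k).
Qed.

End RealEstimates.

Lemma multiples_infinite n (b : 'rV[int]_n) (B : set 'rV[int]_n) :
  b != 0 -> (forall j : nat, B (j.+1%:Z *: b)) -> infinite_set B.
Proof.
move=> b0 Bb finB; apply: infinite_nat.
have : finite_set ((fun j : nat => j.+1%:Z *: b) @^-1` B).
  apply: finite_preimage => // i j _ _ /rowP h.
  have [k bk] : exists k, b 0 k != 0.
    apply/existsP; apply: contraNT b0; rewrite negb_exists => /forallP b0.
    by apply/eqP/rowP => k; rewrite mxE; apply/eqP; rewrite -[_ == _]negbK.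
  by have := h k; rewrite !mxE => /(mulIf bk) [].
by apply: sub_finite_set => j _; exact: Bb.
Qed.

Section SmallDenominator.
Variables (R : realType) (S : {fset primeT}) (n : nat).
Variables (tau : 'I_n -> primeT -> R).
Hypothesis tau_gt0 : forall i (s : S), 0 < tau i (val s).
Implicit Types (y : QT S n) (b : 'rV[int]_n.+1).

Definition dioph_max (T : {fset primeT}) (kappa : 'I_n -> primeT -> R) (y : QT T n) b : R :=
  \big[Num.max/0]_(i < n) \big[Num.max/0]_(v : T)
    padic_norm R ((b 0 0)%:~R * y v 0 i + (b 0 (lift 0 i))%:~R) `^ (kappa i (val v))^-1.

Definition dioph_sols (T : {fset primeT}) kappa (y : QT T n) (w : R) : set 'rV[int]_n.+1 :=
  [set b | dioph_max kappa y b <= sup_norm R b `^ (- w)].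

Lemma dioph_max_ge0 (T : {fset primeT}) kappa (y : QT T n) b : 0 <= dioph_max kappa y b.
Proof. exact: bigmax_ge_id. Qed.

Lemma dioph_max_le (T : {fset primeT}) kappa (y : QT T n) b (t : R) : 0 <= t ->
  (forall i (v : T), padic_norm R ((b 0 0)%:~R * y v 0 i + (b 0 (lift 0 i))%:~R)
     `^ (kappa i (val v))^-1 <= t) -> dioph_max kappa y b <= t.
Proof. by move=> t0 h; apply/bigmax_leP; split=> // i _; apply/bigmax_leP; split. Qed.

Lemma dioph_max_pos (T : {fset primeT}) kappa (y : QT T n) w b :
  (forall i (v : T), 0 < kappa i (val v)) ->
  finite_set (dioph_sols kappa y w) -> b != 0 -> 0 < dioph_max kappa y b.
Proof.
move=> k0 fin b0; rewrite lt_neqAle dioph_max_ge0 andbT eq_sym; apply/eqP => M0.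
apply: (multiples_infinite b0 _ fin) => j; rewrite /dioph_sols /=.
suff -> : dioph_max kappa y (j.+1%:Z *: b) = 0 by exact: powR_ge0.
apply/eqP; rewrite eq_le dioph_max_ge0 andbT dioph_max_le// => i v.
have le0 : padic_norm R ((b 0 0)%:~R * y v 0 i + (b 0 (lift 0 i))%:~R) `^ (kappa i (val v))^-1 <= 0.
  rewrite -M0; apply: le_trans (le_bigmax _ _ i).
  exact: (le_bigmax _ (fun v : T => padic_norm R ((b 0 0)%:~R * y v 0 i +
    (b 0 (lift 0 i))%:~R) `^ (kappa i (val v))^-1) v).
have /powR_eq0_eq0/eqP : padic_norm R ((b 0 0)%:~R * y v 0 i + (b 0 (lift 0 i))%:~R)
    `^ (kappa i (val v))^-1 = 0.
  by apply/eqP; rewrite eq_le le0; exact: powR_ge0.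
rewrite padic_norm_eq0 => /eqP e0.
rewrite !mxE !intrM -mulrA -mulrDr e0 mulr0 /padic_norm padic_abs0 rmorph0.
by rewrite powR0// invr_neq0// gt_eqF.
Qed.

Definition weak_approx y (C : R) H b := [/\ b != 0, forall k, (`|b 0%R k| <= H)%N &
  forall i (s : S), padic_norm R ((b 0 0)%:~R * y s 0 i - (b 0 (lift 0 i))%:~R)
    <= C * H%:R `^ (- tau i (val s))].

Lemma divide_prime_power (p : primeT) e b :
  (forall k, padic_abs ((b 0 k)%:~R : Qp p) <= prad p e) ->
  exists b' : 'rV[int]_n.+1, forall k, b 0 k = (val p ^ e)%N%:Z * b' 0 k.
Proof.
move=> h; exists (\row_k (b 0%R k %/ (val p ^ e)%N%:Z)%Z) => k; rewrite mxE mulrC divzK//.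
by have := h k; rewrite padic_abs_int_le dvdzE absz_nat.
Qed.

Lemma padic_norm_prime_power (p q : primeT) e : p != q ->
  padic_norm R ((val p ^ e)%N%:R : Qp q) = 1.
Proof.
move=> pq; apply: padic_norm_coprime; rewrite Euclid_dvdX ?(valP q)//.
rewrite (dvdn_prime2 (valP q) (valP p)) negb_and eq_sym.
by rewrite (_ : (val p == val q) = false)//; apply/negbTE.
Qed.

Variables (y : QT S n) (v : S) (u : R).
Local Notation p := (val v).
Local Notation avg := (avg_weight tau (val v)).
Hypotheses (yZ : ZT y) (u_gt0 : 0 < u) (u_le : forall i, u <= tau i (val v)).
Local Notation y' := (restrict_primes (fsubD1set S (val v)) y).
Hypothesis generic : 1 < u \/ [/\ u <= 1, avg < 1 & exists w : R,
  [/\ 0 <= w, (1 - u) * w < 1 - avg &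
      finite_set (dioph_sols (reduced_weight tau (val v)) y' w)]].

Let reduced_gt0 i (s : S) : avg < 1 -> 0 < reduced_weight tau p i (val s).
Proof. by move=> a1; rewrite divr_gt0// subr_gt0. Qed.

Lemma weak_approx_quotient (C eps : R) : 0 < C -> 0 < eps ->
  exists C2 : R, 0 < C2 /\ exists N, forall H b, (N <= H)%N -> weak_approx y C H b ->
  (exists i, eps * padic_norm R ((b 0 0)%:~R : Qp p) < H%:R `^ (- tau i p)) ->
  exists b' : 'rV[int]_n.+1, [/\ b' != 0, sup_norm R b' < C2 * H%:R `^ (1 - u) &
    forall i (s : S), val s != p ->
      padic_norm R ((b' 0 0)%:~R * y s 0 i - (b' 0 (lift 0 i))%:~R)
      <= C * H%:R `^ (- tau i (val s))].
Proof.
move=> C0 eps0; pose C1 := Num.max eps^-1 C.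
have C10 : 0 < C1 by rewrite lt_max invr_gt0 eps0.
have p0 := prime_gt0_real R p.
exists ((val p)%:R * C1); split; first exact: mulr_gt0.
have [N hN] := @powRN_small _ ((val p)%:R * C1) u 1 u_gt0 ltr01.
exists N.+1 => H b NH [b0 bH bapp] [i0 hi0].
have H0 : 0 < H%:R :> R by rewrite ltr0n (leq_ltn_trans _ NH).
have H1 : 1 <= H%:R :> R by rewrite ler1n (leq_ltn_trans _ NH).
have Hu i : H%:R `^ (- tau i p) <= H%:R `^ (- u).
  by rewrite ler_powR// lerN2.
have b0v : padic_norm R ((b 0 0)%:~R : Qp p) <= C1 * H%:R `^ (- u).
  rewrite (@le_trans _ _ (eps^-1 * H%:R `^ (- u)))//.
    by rewrite -ler_pdivrMl ?invr_gt0// invrK (le_trans (ltW hi0)).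
  by rewrite ler_wpM2r ?powR_ge0// le_max lexx.
have bv k : padic_norm R ((b 0 k)%:~R : Qp p) <= C1 * H%:R `^ (- u).
  have [->//|[i ->]] : k = 0 \/ exists i, k = lift 0 i.
    by case: (unliftP 0 k) => [i ->|->]; [right; exists i|left].
  have -> : (b 0 (lift 0 i))%:~R = (b 0 0)%:~R * y v 0 i -
      ((b 0 0)%:~R * y v 0 i - (b 0 (lift 0 i))%:~R) :> Qp p by rewrite subKr.
  apply: padic_normDle.
    rewrite padic_normM (le_trans _ b0v)// ler_piMr ?padic_norm_ge0//.
    by rewrite -[leRHS](rmorph1 (@ratr R)) padic_norm_le; exact: yZ.
  rewrite padic_normN (le_trans (bapp i v))// ler_pM ?powR_ge0 ?(ltW C0)//.
  by rewrite le_max lexx orbT.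
have t0 : 0 < (val p)%:R * C1 * H%:R `^ (- u) by rewrite !mulr_gt0// powR_gt0.
have t1 : (val p)%:R * C1 * H%:R `^ (- u) <= 1 by apply/ltW/hN/ltnW.
have [e [e1 e2]] := prime_power_between p t0 t1.
have [b' b'E] : exists b' : 'rV[int]_n.+1, forall k, b 0 k = (val p ^ e)%N%:Z * b' 0 k.
  apply: (@divide_prime_power p) => k; rewrite -(padic_norm_le R) ratr_prad.
  by apply: (le_trans (bv k)); move: e2; rewrite -mulrA ler_pM2l.
have pe0 : 0 < (val p)%:R ^+ e :> R by rewrite exprn_gt0.
exists b'; split.
- by apply: contra_neq b0 => b'0; apply/rowP => k; rewrite b'E b'0 !mxE mulr0.
- have : sup_norm R b' * (val p)%:R ^+ e <= H%:R.
    rewrite /sup_norm -natrX -natrM ler_nat -leq_divRL ?expn_gt0 ?prime_gt0 ?(valP p)//.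
    apply/bigmax_leqP => k _; rewrite leq_divRL ?expn_gt0 ?prime_gt0 ?(valP p)//.
    by have := bH k; rewrite b'E abszM absz_nat mulnC.
  rewrite -ler_pdivlMr// => h; apply: (le_lt_trans h).
  rewrite powRD ?(gt_eqF H0) ?implybT// powRr1 ?(ltW H0)//.
  by rewrite mulrCA ltr_pM2l.
- move=> i s sp; have := bapp i s; rewrite !b'E !intrM -mulrA -mulrBr padic_normM.
  by rewrite -pmulrn padic_norm_prime_power ?mul1r// eq_sym.
Qed.

Lemma denominator_not_small (C eps : R) : 0 < C -> 0 < eps ->
  exists N, forall H b, (N <= H)%N -> weak_approx y C H b ->
  forall i, H%:R `^ (- tau i p) <= eps * padic_norm R ((b 0 0)%:~R : Qp p).
Proof.
move=> C0 eps0; have [C2 [C20 [N hN]]] := weak_approx_quotient C0 eps0.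
have sup1 (b : 'rV[int]_n.+1) : b != 0 -> 1 <= sup_norm R b.
  by move=> /(sup_norm_gt0 R); rewrite /sup_norm ltr0n ler1n.
suff [N' hN'] : exists N', forall H (b' : 'rV[int]_n.+1), (N' <= H)%N -> b' != 0 ->
    sup_norm R b' < C2 * H%:R `^ (1 - u) ->
    (forall i (s : S), val s != p ->
      padic_norm R ((b' 0 0)%:~R * y s 0 i - (b' 0 (lift 0 i))%:~R)
      <= C * H%:R `^ (- tau i (val s))) -> False.
  exists (maxn N N') => H b; rewrite geq_max => /andP[NH N'H] bw i.
  rewrite leNgt; apply/negP => h.
  have [b' [b'0 b's b'a]] := hN H b NH bw (ex_intro _ i h).
  exact: hN' b'0 b's b'a.
case: generic => [u1|[u1 a1 [w [w0 uw fin]]]].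
  have u10 : 0 < u - 1 by rewrite subr_gt0.
  have [N' hN'] := @powRN_small _ C2 (u - 1) 1 u10 ltr01.
  exists N' => H b' N'H b'0 b's _.
  have h2 : C2 * H%:R `^ (1 - u) < 1 by have := hN' H N'H; rewrite opprB.
  by have := lt_trans b's h2; rewrite ltNge sup1.
have r0 i (s : (S `\ p)%fset) : 0 < reduced_weight tau p i (val s).
  exact: (reduced_gt0 i (fincl (fsubD1set S p) s)).
pose B := [set b | dioph_sols (reduced_weight tau p) y' w b /\ b != 0].
have finB : finite_set B by apply: sub_finite_set fin => b [].
have posB b : B b -> 0 < dioph_max (reduced_weight tau p) y' b.
  by move=> [_ b0]; exact: dioph_max_pos fin b0.
have [t t0 ht] := finite_set_pos_lb finB posB.
pose C3 : R := \big[Num.max/0]_(i < n) \big[Num.max/0]_(s : (S `\ p)%fset)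
  C `^ (reduced_weight tau p i (val s))^-1.
have C30 : 0 <= C3 by exact: bigmax_ge_id.
have a0 : 0 < 1 - avg by rewrite subr_gt0.
have al0 : 0 < (1 - avg) - (1 - u) * w by rewrite subr_gt0.
have [N1 hN1] := @powRN_small _ C3 _ t a0 t0.
have [N2 hN2] := @powRN_small _ (C3 * C2 `^ w) _ 1 al0 ltr01.
exists (maxn N1 N2).+1 => H b' NH b'0 b's b'a.
have H0 : 0 < H%:R :> R by rewrite ltr0n (leq_ltn_trans _ NH).
have N1H : (N1 <= H)%N by apply: leq_trans (ltnW NH); rewrite leq_maxl.
have N2H : (N2 <= H)%N by apply: leq_trans (ltnW NH); rewrite leq_maxr.
pose b : 'rV[int]_n.+1 := \row_k (if k == 0 then b' 0 k else - b' 0 k).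
have supE : sup_norm R b = sup_norm R b'.
  by congr (_%:R); apply: eq_bigr => k _; rewrite mxE; case: ifP => //; rewrite abszN.
have b0 : b != 0.
  apply: contra_neq b'0 => /rowP h; apply/rowP => k; have := h k; rewrite !mxE.
  by case: ifP => // _ /eqP; rewrite oppr_eq0 => /eqP.
have maxb : dioph_max (reduced_weight tau p) y' b <= C3 * H%:R `^ (- (1 - avg)).
  apply: dioph_max_le => [|i s]; first by rewrite mulr_ge0 ?powR_ge0.
  set k := (reduced_weight _ _ _ _)^-1.
  have k0 : 0 <= k by rewrite invr_ge0 ltW.
  rewrite !mxE/= rmorphN.
  have sp : val (fincl (fsubD1set S p) s) != p.
    by have := valP s; rewrite in_fsetD1 => /andP[].
  have h := b'a i (fincl (fsubD1set S p) s) sp.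
  apply: (@le_trans _ _ ((C * H%:R `^ (- tau i (val s))) `^ k)).
    by rewrite ge0_ler_powR ?nnegrE ?padic_norm_ge0 ?mulr_ge0 ?powR_ge0 ?(ltW C0).
  rewrite powRM ?powR_ge0 ?(ltW C0)// -powRrM.
  rewrite (_ : - tau i (val s) * k = - (1 - avg)); last first.
    rewrite /k /reduced_weight invf_div mulrC mulrN divfK//.
    by rewrite gt_eqF// (tau_gt0 i (fincl (fsubD1set S p) s)).
  rewrite ler_wpM2r ?powR_ge0//; apply: le_trans (le_bigmax _ _ i).
  exact: (le_bigmax _ (fun s : (S `\ p)%fset => C `^ (reduced_weight tau p i (val s))^-1) s).
have bsol : dioph_sols (reduced_weight tau p) y' w b.
  rewrite /dioph_sols/= (le_trans maxb)// supE powRN.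
  have supw : sup_norm R b' `^ w <= C2 `^ w * H%:R `^ ((1 - u) * w).
    rewrite powRrM -powRM ?powR_ge0 ?(ltW C20)//.
    by rewrite ge0_ler_powR ?nnegrE ?mulr_ge0 ?powR_ge0 ?(ltW C20) ?(ltW b's)// ler0n.
  rewrite -div1r ler_pdivlMr ?powR_gt0 ?sup_norm_gt0//.
  apply: (le_trans (ler_wpM2l _ supw)); first by rewrite mulr_ge0 ?powR_ge0.
  rewrite mulrACA -powRD ?(gt_eqF H0) ?implybT//.
  by apply/ltW; have := hN2 H N2H; rewrite opprB addrC.
have := ht b (conj bsol b0); rewrite leNgt => /negP; apply.
by apply: (le_lt_trans maxb); exact: hN1.
Qed.
End SmallDenominator.

Lemma infinite_set_countP (I : countType) (B : set I) :
  infinite_set B <-> forall N, exists2 b, B b & (N <= choice.pickle b)%N.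
Proof.
split=> [infB N|h finB].
  apply: contrapT => nex; apply: infB.
  have sub : B `<=` choice.pickle @^-1` `I_N.
    move=> b Bb /=; rewrite ltnNge; apply/negP => Nb; by apply: nex; exists b.
  apply: sub_finite_set sub _; apply: finite_preimage; last exact: finite_II.
  by move=> b c _ _; exact: (pcan_inj choice.pickleK).
have /finite_fsetP[X BX] := finB.
have [b Bb] := h (\max_(b <- enum_fset X) choice.pickle b)%N.+1.
by rewrite ltnNge leq_bigmax_seq//; move: Bb; rewrite BX.
Qed.

Lemma padic_family_bound (S : {fset primeT}) (I : finType)
    (F : forall v : S, I -> Qp (val v)) :
  exists s, forall v i, padic_abs (F v i) * prad (val v) s <= 1.
Proof.
have /choice[s hs] : forall v : S, exists s, forall i, padic_abs (F v i) * prad (val v) s <= 1.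
  move=> v; pose B : rat := \big[Num.max/1]_i padic_abs (F v i).
  have B0 : 0 < B by rewrite (lt_le_trans ltr01)// bigmax_ge_id.
  have BV0 : 0 < B^-1 by rewrite invr_gt0.
  have [s hs] := prad_small (val v) BV0.
  exists s => i; rewrite (@le_trans _ _ (B * prad (val v) s))//.
    by rewrite ler_wpM2r ?(ltW (prad_gt0 _ _))// le_bigmax.
  by rewrite -ler_pdivlMl// mulr1 ltW.
exists (\max_v s v)%N => v i; apply: le_trans (hs v i).
by rewrite ler_wpM2l ?padic_abs_ge0// le_prad leq_bigmax.
Qed.

Section GraphSolutions.
Variables (R : realType) (S : {fset primeT}) (d m : nat).
Variables (U : forall p : primeT, set 'rV[Qp p]_d).
Variables (f : forall p : primeT, 'rV[Qp p]_d -> 'rV[Qp p]_m).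
Arguments U : clear implicits.
Arguments f : clear implicits.
Variable tau : 'I_(d + m) -> primeT -> R.
Hypothesis hU : forall v, v \in S -> [/\ open (U v), U v `<=` Zp_vec v d,
  f v @` U v `<=` Zp_vec v m & Ck_on 2 (U v) (f v)].
Hypothesis tau_gt0 : forall i v, v \in S -> 0 < tau i v.
Local Notation n := (d + m)%N.
Implicit Types (x : QT S d) (b : 'rV[int]_n.+1).

Definition graph_dom : set (QT S d) := [set x | forall v : S, U (val v) (x v)].

Lemma graph_domZ x : graph_dom x -> ZT x.
Proof. by move=> xU v; have [_ UZ _ _] := hU (fsvalP v); exact: (UZ _ (xU v)). Qed.

Lemma graph_mapZ x : graph_dom x -> ZT (graph_map f x).
Proof.
move=> xU v i; rewrite -(splitK i) /graph_map; case: (fintype.split i) => j /=.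
  by rewrite row_mxEl; exact: (graph_domZ xU).
rewrite row_mxEr; have [_ _ fZ _] := hU (fsvalP v).
exact: (fZ _ (imageP _ (xU v))).
Qed.

Lemma graph_differentiable x : graph_dom x ->
  exists J : forall v : S, 'M[Qp (val v)]_(d, m),
  forall s, exists M, forall x', box (fun=> M) x x' -> graph_dom x' /\
    forall (v : S) (rho : rat), 0 <= rho ->
    (forall i, padic_abs (x' v 0 i - x v 0 i) <= rho) -> forall j,
    padic_abs (f (val v) (x' v) 0 j - f (val v) (x v) 0 j
      - \sum_i (x' v 0 i - x v 0 i) * J v i j) <= prad (val v) s * rho.
Proof.
move=> xU.
have h (v : S) : exists J : 'M[Qp (val v)]_(d, m),
  forall theta : rat, 0 < theta -> exists2 delta : rat, 0 < delta &
  forall y : 'rV_d, (forall i, padic_abs (y 0 i - x v 0 i) < delta) -> U (val v) y /\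
  forall rho : rat, 0 <= rho -> (forall i, padic_abs (y 0 i - x v 0 i) <= rho) -> forall j,
    padic_abs (f (val v) y 0 j - f (val v) (x v) 0 j - \sum_i (y 0 i - x v 0 i) * J i j) <= theta * rho.
  by have [_ _ _ hC] := hU (fsvalP v); exact: Ck_on_differentiable hC (xU v).
exists (fun v => sval (cid (h v))) => s.
have /choice[M hM] : forall v : S, exists M, forall y : 'rV_d,
    (forall i, padic_abs (y 0 i - x v 0 i) <= prad (val v) M) -> U (val v) y /\
    forall rho : rat, 0 <= rho -> (forall i, padic_abs (y 0 i - x v 0 i) <= rho) -> forall j,
    padic_abs (f (val v) y 0 j - f (val v) (x v) 0 j -
      \sum_i (y 0 i - x v 0 i) * (sval (cid (h v))) i j) <= prad (val v) s * rho.
  move=> v; have [delta delta0 hd] := svalP (cid (h v)) _ (prad_gt0 (val v) s).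
  have [M hM] := prad_small (val v) delta0; exists M => y yx.
  by apply: hd => i; apply: le_lt_trans hM; exact: yx.
have boxM x' : box (fun=> (\max_v M v)%N) x x' -> forall (v : S) i,
    padic_abs (x' v 0 i - x v 0 i) <= prad (val v) (M v).
  move=> xx' v i; rewrite padic_distC; apply: (le_trans (xx' (v, i))).
  by rewrite le_prad leq_bigmax.
exists (\max_v M v)%N => x' /boxM xx'; split=> v; first by have [] := hM v _ (xx' v).
by have [_ h2] := hM v _ (xx' v); exact: h2.
Qed.

Lemma graph_continuous x N : graph_dom x -> exists M, forall x', box (fun=> M) x x' ->
  graph_dom x' /\ forall (v : S) i, padic_abs (graph_map f x' v 0 i - graph_map f x v 0 i) <= prad (val v) N.
Proof.
move=> xU; have [J /(_ 0%N)[M hM]] := graph_differentiable xU.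
have [s hs] := @padic_family_bound S _ (fun v (ij : 'I_d * 'I_m) => J v ij.1 ij.2).
exists (maxn M (N + s)) => x' xx'.
have xM : box (fun=> M) x x' by apply: subset_box xx' => c; rewrite leq_maxl.
have [x'U hx'] := hM x' xM; split=> // v i.
have xNs j : padic_abs (x' v 0 j - x v 0 j) <= prad (val v) (N + s).
  rewrite padic_distC; apply: (le_trans (xx' (v, j))).
  by rewrite le_prad leq_maxr.
rewrite -(splitK i) /graph_map; case: (fintype.split i) => j /=.
  by rewrite !row_mxEl (le_trans (xNs j))// le_prad leq_addr.
rewrite !row_mxEr -(subrK (\sum_i (x' v 0 i - x v 0 i) * J v i j) (_ - _)).
have prad0' : 0 <= prad (val v) N by exact: ltW (prad_gt0 _ _).
apply: padic_absDle.
  rewrite (le_trans (hx' v (prad (val v) N) _ _ j))// ?prad0 ?mul1r// => k.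
  by rewrite (le_trans (xNs k))// le_prad leq_addr.
apply: padic_abs_sum => // k _; rewrite padic_absM.
rewrite (@le_trans _ _ (prad (val v) (N + s) * padic_abs (J v k j)))//.
  by rewrite ler_wpM2r ?padic_abs_ge0.
by rewrite pradD -mulrA ler_piMr// mulrC (hs v (k, j)).
Qed.

Lemma open_solution_set b (t : 'I_n -> S -> R) :
  @open (QT S d) [set x | graph_dom x /\ forall i v,
    padic_norm R ((b 0 0)%:~R * graph_map f x v 0 i - (b 0 (lift 0 i))%:~R) < t i v].
Proof.
rewrite openE => x [xU xt].
have /choice[N hN] : forall iv : 'I_n * S, exists N : nat, ratr (prad (val iv.2) N) < t iv.1 iv.2 :> R.
  move=> [i v] /=; apply: prad_small_real.
  exact: le_lt_trans (padic_norm_ge0 _ _) (xt i v).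
have [M hM] := graph_continuous (\max_iv N iv)%N xU.
apply: (@filterS _ _ _ (box (fun=> M) x)) => [x' /hM[x'U hx']|]; last first.
  by apply: open_nbhs_nbhs; split; [exact: open_box|exact: box_refl].
split=> // i v; rewrite -[_ * _](subrK ((b 0 0)%:~R * graph_map f x v 0 i)) -addrA.
apply: padic_normDlt; last exact: xt.
rewrite -mulrBr padic_normM (@le_lt_trans _ _ (ratr (prad (val v) (N (i, v)))))//; last exact: (hN (i, v)).
rewrite -[leRHS]mul1r ler_pM ?padic_norm_ge0 ?padic_norm_int_le1//.
rewrite padic_norm_le (le_trans (hx' v i))// le_prad.
exact: (leq_bigmax (i, v)).
Qed.

Definition approximable (c : R) H : set (QT S d) :=
  [set x | graph_dom x /\ exists b : 'rV[int]_n.+1, [/\ b != 0,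
    forall k, (`|b 0%R k| <= H)%N & forall i (v : S),
    padic_norm R ((b 0 0)%:~R * graph_map f x v 0 i - (b 0 (lift 0 i))%:~R)
      < c * H%:R `^ (- tau i (val v))]].

Lemma open_approximable c H : @open (QT S d) (approximable c H).
Proof.
rewrite (_ : approximable c H = \bigcup_(b in [set b : 'rV[int]_n.+1 | b != 0 /\
    forall k, (`|b 0%R k| <= H)%N]) [set x | graph_dom x /\ forall i (v : S),
    padic_norm R ((b 0 0)%:~R * graph_map f x v 0 i - (b 0 (lift 0 i))%:~R)
      < c * H%:R `^ (- tau i (val v))]).
  by apply: bigcup_open => b _; exact: open_solution_set.
apply/seteqP; split=> [x [xU [b [b0 bH bx]]]|x [b [b0 bH] [xU bx]]].
  by exists b.
by split=> //; exists b.
Qed.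

Lemma open_graph_dom : @open (QT S d) graph_dom.
Proof.
rewrite openE => x xU; have [M hM] := graph_continuous 0 xU.
apply: (@filterS _ _ _ (box (fun=> M) x)) => [x' /hM[]//|].
by apply: open_nbhs_nbhs; split; [exact: open_box|exact: box_refl].
Qed.

Lemma measurable_approx_set c :
  measurable ([set x | graph_dom x /\ approx_set c tau (graph_map f x)] : set (QT_borel S d)).
Proof.
pose B (b : 'rV[int]_n.+1) : set (QT_borel S d) := [set x | graph_dom x /\ forall i (v : S),
    padic_norm R ((b 0 0)%:~R * graph_map f x v 0 i - (b 0 (lift 0 i))%:~R)
      < c * sup_norm R b `^ (- tau i (val v))].
rewrite (_ : [set x | _] = graph_dom `&` \bigcap_N \bigcup_(b in [set b | (N <= choice.pickle b)%N]) B b).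
  apply: measurableI; first by apply: open_measurable_QT; exact: open_graph_dom.
  apply: bigcap_measurable => // N _; apply: open_measurable_QT.
  by apply: bigcup_open => b _; exact: open_solution_set.
apply/seteqP; split=> [x [xU [_ /infinite_set_countP h]]|x [xU h]].
  by split=> // N _; have [b bx Nb] := h N; exists b.
split=> //; split; first exact: graph_mapZ.
apply/infinite_set_countP => N; have [b Nb [_ bx]] := h N I.
by exists b.
Qed.

Lemma frequently_approximable (c : R) x : 0 < c -> graph_dom x ->
  (forall N, exists2 H, (N <= H)%N & approximable c H x) ->
  approx_set c tau (graph_map f x).
Proof.
move=> c0 xU happ; split; first exact: graph_mapZ.
set B := [set b | _] => finB.
pose err (b : 'rV[int]_n.+1) : R := \big[Num.max/0]_(iv : 'I_n * S)
  padic_norm R ((b 0 0)%:~R * graph_map f x iv.2 0 iv.1 - (b 0 (lift 0 iv.1))%:~R).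
have err_ge (b : 'rV[int]_n.+1) i (v : S) :
    padic_norm R ((b 0 0)%:~R * graph_map f x v 0 i - (b 0 (lift 0 i))%:~R) <= err b.
  exact: (le_bigmax _ (fun iv : 'I_n * S => padic_norm R ((b 0 0)%:~R *
    graph_map f x iv.2 0 iv.1 - (b 0 (lift 0 iv.1))%:~R)) (i, v)).
have sup_pos (b : 'rV[int]_n.+1) i (v : S) : b != 0 -> 0 < c * sup_norm R b `^ (- tau i (val v)).
  by move=> b0; rewrite mulr_gt0// powR_gt0// sup_norm_gt0.
have errpos b : (B `&` [set b | b != 0]) b -> 0 < err b.
  move=> [Bb b0]; rewrite lt_neqAle bigmax_ge_id andbT eq_sym; apply/eqP => e0.
  apply: (multiples_infinite b0 _ finB) => j i v.
  have : padic_norm R ((b 0 0)%:~R * graph_map f x v 0 i - (b 0 (lift 0 i))%:~R) == 0.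
    by rewrite eq_le padic_norm_ge0 andbT -e0.
  rewrite padic_norm_eq0 => /eqP bx0; rewrite ![(_ *: b) _ _]mxE !intrM.
  rewrite -mulrA -mulrBr bx0 mulr0.
  rewrite /padic_norm padic_abs0 rmorph0; apply: sup_pos.
  by apply: contra_neq b0 => /rowP h; apply/rowP => k; have := h k; rewrite !mxE => /eqP;
    rewrite mulf_eq0 => /eqP.
have finB' : finite_set (B `&` [set b | b != 0]) by apply: sub_finite_set finB => b [].
have [t t0 ht] := finite_set_pos_lb finB' errpos.
have /choice[N hN] : forall iv : 'I_n * S, exists N : nat, forall H, (N <= H)%N ->
    c * H%:R `^ (- tau iv.1 (val iv.2)) < t.
  by move=> [i v]; apply: powRN_small => //=; exact: (tau_gt0 i (fsvalP v)).
have [H NH [_ [b [b0 bH bx]]]] := happ (\max_iv N iv)%N.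
have Bb : B b.
  move=> i v; apply: (lt_le_trans (bx i v)); rewrite ler_pM2l//.
  rewrite !powRN lef_pV2 ?posrE ?powR_gt0 ?sup_norm_gt0//; last first.
    by apply: lt_le_trans (_ : sup_norm R b <= _); rewrite ?sup_norm_gt0// sup_norm_le; apply/forallP.
  rewrite ge0_ler_powR ?nnegrE ?(ltW (sup_norm_gt0 _ b0)) ?ler0n//.
    by apply/ltW; exact: (tau_gt0 i (fsvalP v)).
  by rewrite sup_norm_le; apply/forallP.
have := ht b (conj Bb b0); rewrite leNgt => /negP; apply.
apply/bigmax_ltP; split=> // -[i v] _; apply: (lt_trans (bx i v)).
by apply: (hN (i, v)); apply: leq_trans NH; exact: (leq_bigmax (i, v)).
Qed.
End GraphSolutions.

Lemma prod_powR (R : realType) (I : Type) (r : seq I) (F : I -> R) (x : R) : 0 < x ->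
  \prod_(i <- r) x `^ F i = x `^ (\sum_(i <- r) F i).
Proof.
move=> x0; elim: r => [|i r IH]; first by rewrite !big_nil powRr0.
by rewrite !big_cons IH powRD// (gt_eqF x0) implybT.
Qed.

Section Minkowski.
Variables (R : realType) (S : {fset primeT}) (d m : nat).
Local Notation n := (d + m)%N.
Variable tau : 'I_n -> primeT -> R.
Hypotheses (d_gt0 : (0 < d)%N) (tau_gt0 : forall i v, v \in S -> 0 < tau i v).
Hypothesis tau_sum : \sum_(i < n) \sum_(v <- S) tau i v = n.+1%:R.

(* The exponent [slack] is gained in each of the [d] first coordinates, and pays for
   the factors [p^n] (rounding), [(k+1)^n] (the constant) and [p^(ms)] (the derivatives). *)
Definition slack (s k : nat) : nat := (n + m * s + k.+1 * n)%N.

Definition scale (k H : nat) (a : 'I_n -> S -> nat) := forall i (v : S),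
  (val (val v))%:R ^- a i v < k.+1%:R^-1 * H%:R `^ (- tau i (val v)) /\
  k.+1%:R^-1 * H%:R `^ (- tau i (val v)) <= (val (val v))%:R * (val (val v))%:R ^- a i v :> R.

Lemma scale_ex k H : (0 < H)%N -> exists a, scale k H a.
Proof.
move=> H0.
have h (iv : 'I_n * S) : exists a, (val (val iv.2))%:R ^- a < k.+1%:R^-1 * H%:R `^ (- tau iv.1 (val iv.2)) /\
  k.+1%:R^-1 * H%:R `^ (- tau iv.1 (val iv.2)) <= (val (val iv.2))%:R * (val (val iv.2))%:R ^- a :> R.
  apply: prime_power_between; first by rewrite mulr_gt0 ?invr_gt0 ?powR_gt0 ?ltr0n.
  rewrite mulr_ile1 ?invr_ge0 ?powR_ge0 ?ler0n// ?invf_le1 ?ler1n//.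
  have t0 := tau_gt0 iv.1 (fsvalP iv.2).
  by rewrite -[leRHS](powRr0 H%:R) ler_powR ?ler1n// oppr_le0 ltW.
have /choice[a ha] := h.
by exists (fun i v => a (i, v)) => i v; exact: ha.
Qed.

Lemma scale_large k s : exists N, forall H a, (N <= H)%N -> scale k H a ->
  forall i v, (slack s k <= a i v)%N.
Proof.
have /choice[N hN] : forall iv : 'I_n * S, exists N : nat, forall H, (N <= H)%N ->
    k.+1%:R^-1 * H%:R `^ (- tau iv.1 (val iv.2)) < ratr (prad (val iv.2) (slack s k)) :> R.
  move=> [i v]; apply: powRN_small; first exact: (tau_gt0 i (fsvalP v)).
  by rewrite ltr0q prad_gt0.
exists (\max_iv N iv)%N => H a NH ha i v.
have NH' : (N (i, v) <= H)%N by apply: leq_trans NH; exact: (leq_bigmax (i, v)).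
have := lt_trans (ha i v).1 (hN (i, v) H NH').
by rewrite -ratr_prad ltr_rat => /ltW; rewrite le_prad.
Qed.

Lemma slack_count k s H a : (0 < H)%N -> scale k H a -> (forall i v, (slack s k <= a i v)%N) ->
  (\prod_(c : S * 'I_n) val (val c.1) ^ (match fintype.split c.2 with
     | inl _ => a c.2 c.1 - slack s k | inr _ => a c.2 c.1 + s end) < H.+1 ^ n.+1)%N.
Proof.
move=> H0 ha hK; apply: (@leq_ltn_trans (H ^ n.+1)); last by rewrite ltn_exp2r.
rewrite -(ler_nat R) natr_prod.
have HR0 : 0 < H%:R :> R by rewrite ltr0n.
have -> : (H ^ n.+1)%N%:R = \prod_(v : S) \prod_(i < n) H%:R `^ tau i (val v).
  under eq_bigr do rewrite prod_powR//.
  rewrite prod_powR// -(big_seq_fsetE _ S xpredT (fun v => \sum_(i < n) tau i v))/=.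
  by rewrite exchange_big tau_sum powR_mulrn ?ler0n// natrX.
rewrite -(pair_bigA _ (fun (v : S) (i : 'I_n) => (val (val v) ^ (match fintype.split i with
     | inl _ => a i v - slack s k | inr _ => a i v + s end))%N%:R))/=.
apply: ler_prod => v _; rewrite prodr_ge0 ?ler0n//=.
set q : R := (val (val v))%:R.
have q0 : 0 < q by exact: prime_gt0_real.
have q1 : 1 < q by exact: prime_gt1_real.
have qe0 e : 0 < q ^+ e by rewrite exprn_gt0.
have qa i : q ^+ a i v <= q * k.+1%:R * H%:R `^ tau i (val v).
  have := (ha i v).2; rewrite powRN -invfM ler_pdivlMr// ler_pdivrMl; last first.
    by rewrite mulr_gt0 ?powR_gt0 ?ltr0n.
  by move=> h; rewrite (le_trans h)// mulrC mulrA.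
have sl i : fintype.split (lshift m i) = inl i := unsplitK (inl i).
have sr j : fintype.split (rshift d j) = inr j := unsplitK (inr j).
rewrite big_split_ord/=.
under eq_bigr do rewrite sl natrX.
under [X in _ * X]eq_bigr do rewrite sr natrX exprD.
have qK i : q ^+ (a i v - slack s k) = q ^+ a i v * q ^- slack s k.
  by rewrite -{2}(subnK (hK i v)) exprD mulfK// gt_eqF.
under eq_bigr do rewrite qK.
have splitE : \prod_(i < n) q ^+ a i v =
    \prod_(i < d) q ^+ a (lshift m i) v * \prod_(j < m) q ^+ a (rshift d j) v.
  by rewrite big_split_ord.
rewrite !big_split/= mulrACA -splitE !prodr_const !card_ord.
set T := \prod_(i < n) H%:R `^ _.
have T0 : 0 <= T by apply: prodr_ge0 => i _; exact: powR_ge0.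
have h1 : \prod_(i < n) q ^+ a i v <= (q * k.+1%:R) ^+ n * T.
  have -> : (q * k.+1%:R) ^+ n = \prod_(i < n) (q * k.+1%:R) by rewrite prodr_const card_ord.
  by rewrite -big_split/=; apply: ler_prod => i _; rewrite (ltW (qe0 _)) qa.
have h2 : (q ^- slack s k) ^+ d * (q ^+ s) ^+ m <= q ^- (n + k.+1 * n).
  rewrite -[X in _ ^+ X * _](prednK d_gt0) exprS -mulrA (@le_trans _ _ (q ^- slack s k * (q ^+ s) ^+ m))//.
    rewrite ler_wpM2l ?invr_ge0 ?(ltW (qe0 _))// ler_piMl ?exprn_ge0 ?(ltW (qe0 _))//.
    by rewrite exprn_ile1 ?invr_ge0 ?(ltW (qe0 _))// invf_le1// exprn_ege1// ltW.
  rewrite -exprM /slack addnAC exprD invfM -mulrA [(m * s)%N]mulnC.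
  by rewrite mulVf ?mulr1// gt_eqF.
have h3 : (q * k.+1%:R) ^+ n <= q ^+ (n + k.+1 * n).
  rewrite exprMn [leRHS]exprD ler_wpM2l ?(ltW (qe0 _))// exprM lerXn2r ?nnegrE ?(ltW (qe0 _)) ?ler0n//.
  rewrite /q -natrX ler_nat ltnW// ltn_expl// prime_gt1 ?(valP (val v))//.
rewrite (le_trans (ler_pM _ _ h1 h2))//.
- by apply: prodr_ge0 => i _; exact: ltW.
- by rewrite mulr_ge0 ?exprn_ge0 ?invr_ge0 ?(ltW (qe0 _))// ltW.
- by rewrite mulrAC ler_piMl// ler_pdivrMr// mul1r.
Qed.

Lemma minkowski_system (k s : nat) (x : QT S d)
    (g : forall v : S, 'rV[Qp (val v)]_m) (J : forall v : S, 'M[Qp (val v)]_(d, m)) :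
  ZT x -> ZT (g : QT S m) ->
  (forall (v : S) i j, padic_abs (J v i j) * prad (val v) s <= 1) ->
  exists N, forall H a, (N <= H)%N -> scale k H a -> exists b : 'rV[int]_n.+1,
    [/\ b != 0, forall l, (`|b 0%R l| <= H)%N,
        forall i (v : S), (slack s k <= a i v)%N,
        forall (v : S) i, padic_abs ((b 0 0)%:~R * x v 0 i - (b 0 (lift 0 (lshift m i)))%:~R)
          <= prad (val v) (a (lshift m i) v - slack s k) &
        forall (v : S) j, padic_abs ((b 0 0)%:~R * g v 0 j - (b 0 (lift 0 (rshift d j)))%:~R -
            \sum_i ((b 0 0)%:~R * x v 0 i - (b 0 (lift 0 (lshift m i)))%:~R) * J v i j)
          <= prad (val v) (a (rshift d j) v)].
Proof.
move=> xZ gZ hJ; have [N hN] := scale_large k s; exists N.+1 => H a NH ha.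
have H0 : (0 < H)%N by exact: leq_trans NH.
have hK := hN H a (ltnW NH) ha.
have sl i : fintype.split (lshift m i) = inl i := unsplitK (inl i).
have sr j : fintype.split (rshift d j) = inr j := unsplitK (inr j).
pose L (v : S) : 'M[Qp (val v)]_(n, n.+1) := \matrix_(i, l)
  match fintype.split i, unlift 0 l with
  | inl i0, None => x v 0 i0
  | inl i0, Some l' => - (l' == lshift m i0)%:R
  | inr j, None => (val (val v) ^ s)%N%:R * (g v 0 j - \sum_i x v 0 i * J v i j)
  | inr j, Some l' => (val (val v) ^ s)%N%:R *
      match fintype.split l' with inl i0 => J v i0 j | inr j' => - (j' == j)%:R end
  end.
have ps (v : S) : padic_abs ((val (val v) ^ s)%N%:R : Qp (val v)) = prad (val v) s.
  elim: (s) => [|s' IH]; first by rewrite expn0 padic_abs1 prad0.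
  by rewrite expnS natrM padic_absM IH padic_abs_prime /prad exprS invfM.
have nat1 (v : S) (t : bool) : padic_abs (- (t%:R : Qp (val v))) <= 1.
  by rewrite padic_absN padic_abs_nat_le1.
have sJ (v : S) i j : padic_abs ((val (val v) ^ s)%N%:R * J v i j) <= 1.
  by rewrite padic_absM ps mulrC.
have LE (v : S) i l : L v i l =
  match fintype.split i, unlift 0 l with
  | inl i0, None => x v 0 i0
  | inl i0, Some l' => - (l' == lshift m i0)%:R
  | inr j, None => (val (val v) ^ s)%N%:R * (g v 0 j - \sum_i x v 0 i * J v i j)
  | inr j, Some l' => (val (val v) ^ s)%N%:R *
      match fintype.split l' with inl i0 => J v i0 j | inr j' => - (j' == j)%:R end
  end by rewrite mxE.
have L1 (v : S) i l : padic_abs (L v i l) <= 1.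
  rewrite LE; case: fintype.split => [i0|j]; case: unlift => [l'|]; first exact: nat1.
  - exact: xZ.
  - case: fintype.split => [i0|j']; first exact: sJ.
    by rewrite padic_absM mulr_ile1 ?padic_abs_ge0 ?nat1// ps prad_le1.
  - rewrite mulrBr padic_absBle//.
      rewrite padic_absM mulr_ile1 ?padic_abs_ge0 ?ps ?prad_le1//; exact: gZ.
    rewrite mulr_sumr padic_abs_sum// => i0 _; rewrite mulrCA padic_absM.
    by rewrite mulr_ile1 ?padic_abs_ge0 ?sJ//; exact: xZ.
have [b [b0 bH bL]] := padic_pigeonhole L1 (slack_count H0 ha hK).
exists b; split=> // v.
- move=> i; have := bL v (lshift m i); rewrite sl.
  rewrite big_ord_recl LE sl unlift_none (bigD1 (lshift m i))//= LE sl liftK eqxx.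
  rewrite mulrN1 big1 ?addr0// => l /negPf li.
  by rewrite LE sl liftK li oppr0 mulr0.
- move=> j; have := bL v (rshift d j); rewrite sr.
  set F := \sum_l _; set E := _ - _ - _.
  have -> : F = (val (val v) ^ s)%N%:R * E.
    rewrite /F big_ord_recl LE sr unlift_none big_split_ord/= (bigD1 j)//=.
    rewrite [X in _ + (_ + (_ + X))]big1 ?addr0 => [|j' /negPf j'j]; last first.
      by rewrite LE sr liftK sr j'j oppr0 !mulr0.
    rewrite LE sr liftK sr eqxx.
    under [X in _ + (X + _)]eq_bigr do rewrite LE sr liftK sl mulrCA.
    rewrite -mulr_sumr /E.
    have -> : \sum_i ((b 0 0)%:~R * x v 0 i - (b 0 (lift 0 (lshift m i)))%:~R) * J v i j =
        (b 0 0)%:~R * (\sum_i x v 0 i * J v i j) - \sum_i (b 0 (lift 0 (lshift m i)))%:~R * J v i j.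
      by rewrite mulr_sumr -sumrB; apply: eq_bigr => i _; rewrite mulrBl mulrA.
    have gen (q b0' g0 A B bj : Qp (val v)) : b0' * (q * (g0 - A)) + (q * B + bj * (q * - 1)) =
        q * (b0' * g0 - bj - (b0' * A - B)) by ring.
    exact: gen.
  by rewrite padic_absM ps addnC pradD ler_pM2l ?prad_gt0.
Qed.
End Minkowski.

(** * Measure of the exceptional sets *)

Lemma mulr_subdiv (K : fieldType) (b x y : K) : b != 0 -> b * (x - y / b) = b * x - y.
Proof. by move=> b0; rewrite mulrBr mulrCA mulfV// mulr1. Qed.

Section Density.
Variables (R : realType) (S : {fset primeT}) (d m : nat).
Local Notation n := (d + m)%N.
Variables (mu : {measure set (QT_borel S d) -> \bar R}).
Variables (U : forall p : primeT, set 'rV[Qp p]_d).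
Variables (f : forall p : primeT, 'rV[Qp p]_d -> 'rV[Qp p]_m).
Arguments U : clear implicits.
Arguments f : clear implicits.
Variable tau : 'I_n -> primeT -> R.
Hypothesis haar_mu : is_haar mu.
Hypothesis hU : forall v, v \in S -> [/\ open (U v), U v `<=` Zp_vec v d,
  f v @` U v `<=` Zp_vec v m & Ck_on 2 (U v) (f v)].
Hypotheses (d_gt0 : (0 < d)%N) (tau_gt0 : forall i v, v \in S -> 0 < tau i v).
Hypothesis tau_sum : \sum_(i < n) \sum_(v <- S) tau i v = n.+1%:R.
Hypothesis tau_order : forall i j v, v \in S -> tau (rshift d j) v <= tau (lshift m i) v.
Local Notation dom := (@graph_dom S d U).

Definition generic_at (x : QT S d) (v : S) := exists u : R,
  [/\ 0 < u, forall i, u <= tau i (val v) &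
  1 < u \/ [/\ u <= 1, avg_weight tau (val v) < 1 & exists w : R,
  [/\ 0 <= w, (1 - u) * w < 1 - avg_weight tau (val v) &
      finite_set (dioph_sols (reduced_weight tau (val v))
        (restrict_primes (fsubD1set S (val v)) (graph_map f x)) w)]]].

Definition derivative_bound (x : QT S d) s := exists J : forall v : S, 'M[Qp (val v)]_(d, m),
  (forall (v : S) i j, padic_abs (J v i j) * prad (val v) s <= 1) /\
  forall s', exists M, forall x', box (fun=> M) x x' -> dom x' /\
    forall (v : S) (rho : rat), 0 <= rho ->
    (forall i, padic_abs (x' v 0 i - x v 0 i) <= rho) -> forall j,
    padic_abs (f (val v) (x' v) 0 j - f (val v) (x v) 0 j
      - \sum_i (x' v 0 i - x v 0 i) * J v i j) <= prad (val v) s' * rho.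

Lemma derivative_bound_ex x : dom x -> exists s, derivative_bound x s.
Proof.
move=> xU; have [J hJ] := graph_differentiable hU xU.
have [s hs] := @padic_family_bound S _ (fun v (ij : 'I_d * 'I_m) => J v ij.1 ij.2).
by exists s, J; split=> // v i j; exact: (hs v (i, j)).
Qed.

Lemma padic_norm_sum_lt p (I : finType) (F : I -> Qp p) (t : R) : 0 < t ->
  (forall i, padic_norm R (F i) < t) -> padic_norm R (\sum_i F i) < t.
Proof.
move=> t0 h; elim/big_ind : _ => //; first by rewrite /padic_norm padic_abs0 rmorph0.
by move=> x y; exact: padic_normDlt.
Qed.

Lemma volD (e e' : S * 'I_d -> nat) : vol R (fun c => e c + e' c)%N = vol R e * vol R e'.
Proof. by rewrite /vol -big_split; apply: eq_bigr => c _; rewrite exprD invfM. Qed.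

Lemma approximable_box k s x e0 N0 : dom x -> derivative_bound x s ->
  (forall v : S, generic_at x v) ->
  exists e H x1, [/\ (N0 <= H)%N, forall c, (e0 <= e c)%N, box e x x1 &
    box (fun c => e c + (slack d m s k + s))%N x1 `<=` approximable U f tau k.+1%:R^-1 H].
Proof.
move=> xU [J [Js hJ]] gen; set K := slack d m s k.
have [M hM] := hJ K.
have xZ := graph_domZ hU xU.
pose g : QT S m := fun v => f (val v) (x v).
have gZ : ZT g.
  move=> v i; have := graph_mapZ hU xU v (rshift d i); by rewrite /graph_map row_mxEr.
have [N1 hN1] := minkowski_system d_gt0 tau_gt0 tau_sum k xZ gZ Js.
pose C : R := \big[Num.max/1]_(v : S) (val (val v))%:R ^+ (K + s).
have C1 : 1 <= C by exact: bigmax_ge_id.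
have Cv (v : S) : (val (val v))%:R ^+ (K + s) <= C.
  exact: (le_bigmax _ (fun v : S => (val (val v))%:R ^+ (K + s)) v).
pose E := maxn e0 M.
have tau_gt0' i (v : S) : 0 < tau i (val v) by exact: (tau_gt0 i (fsvalP v)).
have /choice[N2 hN2] : forall v : S, exists N, forall H b, (N <= H)%N ->
    weak_approx tau (graph_map f x) C H b -> forall i, H%:R `^ (- tau i (val v)) <=
      ratr (prad (val v) (K + E)) * padic_norm R ((b 0 0)%:~R : Qp (val v)).
  move=> v; have [u [u0 ule hu]] := gen v.
  apply: (denominator_not_small tau_gt0' (graph_mapZ hU xU) u0 ule hu).
    exact: lt_le_trans ltr01 C1.
  by rewrite ltr0q prad_gt0.
pose H := maxn (maxn N0 N1) (maxn (\max_v N2 v) 1).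
have N0H : (N0 <= H)%N by rewrite /H -maxnA leq_maxl.
have N1H : (N1 <= H)%N by rewrite /H leq_max leq_maxr.
have N2H v : (N2 v <= H)%N.
  apply: leq_trans (leq_maxr _ _); apply: leq_trans (leq_maxl _ _).
  exact: leq_bigmax.
have H0 : (0 < H)%N by rewrite /H; lia.
have HR1 : 1 <= H%:R :> R by rewrite ler1n.
have [a ha] := scale_ex tau_gt0 k H0.
have [b [b0 bH aK bx bL]] := hN1 H a N1H ha.
have c1 : k.+1%:R^-1 <= 1 :> R by rewrite invf_le1 ?ler1n.
have tau_mono i j (v : S) : k.+1%:R^-1 * H%:R `^ (- tau (lshift m i) (val v)) <=
    k.+1%:R^-1 * H%:R `^ (- tau (rshift d j) (val v)).
  by rewrite ler_wpM2l ?invr_ge0// ler_powR// lerN2 tau_order ?fsvalP.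
have alt i (v : S) : ratr (prad (val v) (a i v)) < k.+1%:R^-1 * H%:R `^ (- tau i (val v)).
  by rewrite ratr_prad; have [] := ha i v.
have cH i (v : S) : k.+1%:R^-1 * H%:R `^ (- tau i (val v)) <= H%:R `^ (- tau i (val v)).
  by rewrite ler_piMl ?powR_ge0.
have prad_aK i (v : S) : ratr (prad (val v) (a i v - K)) =
    (val (val v))%:R ^+ K * ratr (prad (val v) (a i v)) :> R.
  rewrite -{2}(subnK (aK i v)) pradD rmorphM/= mulrCA [ratr (prad _ K)]ratr_prad mulfV ?mulr1//.
  by rewrite expf_neq0// gt_eqF// prime_gt0_real.
have wa : weak_approx tau (graph_map f x) C H b.
  split=> // i v; have q1 := prime_gt1_real R (val v).
  have CH : (val (val v))%:R ^+ (K + s) * ratr (prad (val v) (a i v)) <= C * H%:R `^ (- tau i (val v)).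
    by rewrite ler_pM ?exprn_ge0 ?ler0n ?ler0q ?(ltW (prad_gt0 _ _))// (le_trans (ltW (alt _ _))).
  rewrite -(splitK i) in CH *; case: (fintype.split i) CH => j /= CH.
    rewrite /graph_map row_mxEl; have := bx v j; rewrite -(padic_norm_le R) => h.
    apply: (le_trans h); rewrite prad_aK; apply: le_trans CH.
    by rewrite ler_wpM2r ?ler0q ?(ltW (prad_gt0 _ _))// ler_weXn2l ?leq_addr// ltW.
  rewrite /graph_map row_mxEr.
  have := bL v j; rewrite -(padic_norm_le R); set L := _ - _ - _ => hL.
  rewrite -[X in padic_norm R X](subrK (\sum_i ((b 0 0)%:~R * x v 0 i - (b 0 (lift 0 (lshift m i)))%:~R) * J v i j)).
  apply: padic_normDle.
    rewrite (le_trans hL)//; apply: le_trans CH; rewrite ler_peMl ?ler0q ?(ltW (prad_gt0 _ _))//.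
    by rewrite exprn_ege1// ltW.
  apply/ltW/padic_norm_sum_lt => [|i0].
    by rewrite mulr_gt0 ?powR_gt0 ?ltr0n// (lt_le_trans ltr01).
  rewrite padic_normM; have := bx v i0; rewrite -(padic_norm_le R) prad_aK => h.
  apply: (@le_lt_trans _ _ ((val (val v))%:R ^+ (K + s) * ratr (prad (val v) (a (lshift m i0) v)))).
    have hJs : padic_norm R (J v i0 j) <= (val (val v))%:R ^+ s.
      have -> : (val (val v))%:R ^+ s = ratr (prad (val v) s)^-1 :> R.
        by rewrite fmorphV/= ratr_prad invrK.
      by rewrite padic_norm_le -div1r ler_pdivlMr ?prad_gt0.
    have h' := ler_pM (padic_norm_ge0 R _) (padic_norm_ge0 R _) h hJs.
    by apply: (le_trans h'); rewrite exprD [leRHS]mulrAC.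
  apply: (@lt_le_trans _ _ ((val (val v))%:R ^+ (K + s) * H%:R `^ (- tau (rshift d j) (val v)))).
    rewrite ltr_pM2l ?exprn_gt0 ?prime_gt0_real//.
    exact: lt_le_trans (lt_le_trans (alt _ _) (tau_mono i0 j v)) (cH _ _).
  by rewrite ler_wpM2r ?powR_ge0.
pose kv (v : S) := logn (val (val v)) `|b 0%R 0%R|%N.
have b0v (v : S) : b 0 0 != 0 /\ padic_abs ((b 0 0)%:~R : Qp (val v)) = prad (val v) (kv v).
  have b00 : b 0 0 != 0.
    apply/eqP => b00; have := hN2 v H b (N2H v) wa (lshift m (Ordinal d_gt0)).
    rewrite b00 /padic_norm padic_abs0 rmorph0 mulr0 leNgt powR_gt0//.
    by rewrite ltr0n.
  by split=> //; rewrite padic_abs_int rat_padic_abs_int.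
have ekv i (v : S) : (kv v + E <= a (lshift m i) v - K)%N.
  rewrite -(le_prad (val v)) -(ler_rat R) prad_aK.
  have := hN2 v H b (N2H v) wa (lshift m i).
  rewrite /padic_norm (b0v v).2 => h.
  apply: (@le_trans _ _ ((val (val v))%:R ^+ K * H%:R `^ (- tau (lshift m i) (val v)))).
    rewrite ler_wpM2l ?exprn_ge0 ?ler0n//.
    exact: le_trans (ltW (alt _ _)) (cH _ _).
  apply: (@le_trans _ _ ((val (val v))%:R ^+ K * (ratr (prad (val v) (K + E)) * ratr (prad (val v) (kv v))))).
    by rewrite ler_wpM2l ?exprn_ge0 ?ler0n.
  rewrite pradD !rmorphM/= -mulrA mulrA ratr_prad mulfV ?mul1r; last first.
    by rewrite expf_neq0// gt_eqF// prime_gt0_real.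
  by rewrite pradD rmorphM/= mulrC.
pose e (c : S * 'I_d) := (a (lshift m c.2) c.1 - K - kv c.1)%N.
have eE c : (E <= e c)%N by rewrite /e leq_subRL ?ekv// (leq_trans _ (ekv _ _))// leq_addr.
have kve v i : (kv v + e (v, i) = a (lshift m i) v - K)%N.
  by rewrite /e/= subnKC// (leq_trans _ (ekv _ _))// leq_addr.
have kvKe v i : (kv v + (K + e (v, i)) = a (lshift m i) v)%N by rewrite addnCA kve subnKC.
pose x1 : QT S d := fun v => \row_i ((b 0 (lift 0 (lshift m i)))%:~R / (b 0 0)%:~R).
have b0Q (v : S) : (b 0 0)%:~R != 0 :> Qp (val v).
  by rewrite -padic_abs_eq0 (b0v v).2 gt_eqF// prad_gt0.
have x1E (v : S) i (z : Qp (val v)) : (b 0 0)%:~R * (z - x1 v 0 i) =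
    (b 0 0)%:~R * z - (b 0 (lift 0 (lshift m i)))%:~R.
  by rewrite mxE (mulr_subdiv _ _ (b0Q v)).
have xx1 : box e x x1.
  move=> [v i]; rewrite -(ler_pM2l (prad_gt0 (val v) (kv v))) -pradD kve -(b0v v).2 -padic_absM.
  by rewrite x1E; exact: bx.
exists e, H, x1; split=> //.
  by move=> c; apply: leq_trans (eE c); rewrite leq_maxl.
move=> x' x1x'.
have xx' : box e x x' by rewrite (box_eq xx1); apply: subset_box x1x' => c; rewrite leq_addr.
have [x'U hx'] : dom x' /\ forall (v : S) (rho : rat), 0 <= rho ->
    (forall i, padic_abs (x' v 0 i - x v 0 i) <= rho) -> forall j,
    padic_abs (f (val v) (x' v) 0 j - f (val v) (x v) 0 j
      - \sum_i (x' v 0 i - x v 0 i) * J v i j) <= prad (val v) K * rho.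
  apply: hM; apply: subset_box xx' => c; apply: leq_trans (eE c); exact: leq_maxr.
split=> //; exists b; split=> //.
have bx' (v : S) i : padic_abs ((b 0 0)%:~R * x' v 0 i - (b 0 (lift 0 (lshift m i)))%:~R)
    <= prad (val v) (a (lshift m i) v + s).
  have := x1x' (v, i); rewrite -(ler_pM2l (prad_gt0 (val v) (kv v))) -pradD -(b0v v).2 -padic_absM.
  rewrite -padic_absN -mulrN opprB x1E.
  by rewrite (_ : (kv v + _ = a (lshift m i) v + s)%N)// -(kvKe v i); lia.
move=> i v; rewrite -(splitK i); case: (fintype.split i) => j /=.
  rewrite /graph_map row_mxEl; apply: le_lt_trans (alt (lshift m j) v).
  by rewrite padic_norm_le (le_trans (bx' v j))// le_prad leq_addr.
rewrite /graph_map row_mxEr.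
set b0' := (b 0 0)%:~R; set D := \sum_i (x' v 0 i - x v 0 i) * J v i j.
set bj := (b 0 (lift 0 (rshift d j)))%:~R.
have -> : b0' * f (val v) (x' v) 0 j - bj =
    (b0' * g v 0 j - bj - \sum_i (b0' * x v 0 i - (b 0 (lift 0 (lshift m i)))%:~R) * J v i j)
    + (b0' * (f (val v) (x' v) 0 j - f (val v) (x v) 0 j - D)
    + \sum_i (b0' * x' v 0 i - (b 0 (lift 0 (lshift m i)))%:~R) * J v i j).
  have -> : \sum_i (b0' * x' v 0 i - (b 0 (lift 0 (lshift m i)))%:~R) * J v i j =
      b0' * D + \sum_i (b0' * x v 0 i - (b 0 (lift 0 (lshift m i)))%:~R) * J v i j.
    by rewrite mulr_sumr -big_split; apply: eq_bigr => i0 _ /=; ring.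
  by rewrite /g; ring.
apply: padic_normDlt; first by apply: le_lt_trans (alt _ v); rewrite padic_norm_le; exact: bL.
apply: padic_normDlt; last first.
  apply: padic_norm_sum_lt => [|i0]; first by rewrite mulr_gt0 ?invr_gt0 ?powR_gt0 ?ltr0n.
  apply: le_lt_trans (lt_le_trans (alt (lshift m i0) v) (tau_mono i0 j v)).
  rewrite padic_norm_le padic_absM.
  rewrite (le_trans (ler_pM (padic_abs_ge0 _) (padic_abs_ge0 _) (bx' v i0) (lexx _)))//.
  by rewrite pradD -mulrA ler_piMr ?(ltW (prad_gt0 _ _))// mulrC Js.
case: (arg_minnP (fun i => e (v, i)) (erefl (xpredT (Ordinal d_gt0)))) => i1 _ mini1.
apply: le_lt_trans (lt_le_trans (alt (lshift m i1) v) (tau_mono i1 j v)).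
rewrite padic_norm_le padic_absM (b0v v).2 -(kvKe v i1) (pradD _ (kv v)) ler_pM2l ?prad_gt0// (pradD _ K).
apply: hx' => [|i0]; first exact: ltW (prad_gt0 _ _).
rewrite padic_distC (le_trans (xx' (v, i0)))// le_prad.
exact: mini1.
Qed.

Definition uncovered k N0 : set (QT_borel S d) :=
  dom `\` \bigcup_(H in [set H | (N0 <= H)%N]) approximable U f tau k.+1%:R^-1 H.

Lemma measurable_uncovered k N0 : measurable (uncovered k N0).
Proof.
apply: measurableD; first by apply: open_measurable_QT; exact: (open_graph_dom hU).
by apply: open_measurable_QT; apply: bigcup_open => H _; exact: (open_approximable tau hU).
Qed.

Lemma negligible_uncovered k s N0 : mu.-negligible [set x | [/\ uncovered k N0 x,
  derivative_bound x s & forall v : S, generic_at x v]].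
Proof.
pose r : S * 'I_d -> nat := fun=> (slack d m s k + s)%N.
apply: negligibleS (strong_density haar_mu (vol_gt0 R r) (measurable_uncovered k N0)).
move=> x [xA db gen]; have xU : dom x by case: xA.
have xZ := graph_domZ hU xU; split=> // N.
have [e [H [x1 [NH Ne xx1 sub]]]] := approximable_box k N N0 xU db gen.
exists e; split=> //.
have sub1 : box (fun c => e c + r c)%N x1 `<=` box e x.
  by rewrite (box_eq xx1); apply: subset_box => c; rewrite leq_addr.
have mb := measurable_box e x; have mb1 := measurable_box (fun c => e c + r c)%N x1.
have mA := measurable_uncovered k N0.
apply: (@le_trans _ _ (mu (box e x `\` box (fun c => e c + r c)%N x1))).
  apply: le_measure; rewrite ?inE; [exact: measurableI|exact: measurableD|].
  move=> y [[yU ny] yb]; split=> // yb1; apply: ny; exists H => //; exact: sub.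
have bfin : (mu (box e x) < +oo)%E by rewrite (mu_box haar_mu) ltry.
have -> : (mu (box e x `\` box (fun c => e c + r c)%N x1) =
    mu (box e x) - mu (box e x `&` box (fun c => e c + r c)%N x1))%E by exact: measureD.
rewrite setIidr// !(mu_box haar_mu) volD -EFinB lee_fin.
by rewrite mulrBl mul1r [vol R r * _]mulrC.
Qed.
End Density.

Lemma negligible_bigcup_count (dd : measure_display) (X : measurableType dd) (R : realType)
    (mu : {measure set X -> \bar R}) (I : countType) (F : I -> set X) :
  (forall i, mu.-negligible (F i)) -> mu.-negligible (\bigcup_i F i).
Proof.
move=> hF; pose G k := if choice.unpickle k is Some i then F i else set0.
apply: negligibleS (negligible_bigcup (F := G) _) => [x [i _ Fx]|k].
  by exists (choice.pickle i) => //; rewrite /G choice.pickleK.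
by rewrite /G; case: choice.unpickle => [i|]; [exact: hF|exact: negligible_set0].
Qed.

Lemma min_weight_attained (R : realType) n (tau : 'I_n -> primeT -> R) v : (0 < n)%N ->
  exists i0, min_weight tau v = (tau i0 v)%:E /\ forall i, tau i0 v <= tau i v.
Proof.
move=> n0; have [i0 _ mini0] := @Order.TotalTheory.arg_minP _ _ _ (Ordinal n0) xpredT (fun i => tau i v) isT.
exists i0; split; last by move=> i; exact: mini0.
apply/eqP; rewrite eq_le; apply/andP; split; first exact: bigmin_le_cond.
apply/bigmin_geP; split=> [|i _]; first exact: leey.
by rewrite lee_fin; exact: mini0.
Qed.

Lemma generic_ae (R : realType) (S : {fset primeT}) (d m : nat)
    (mu : forall T : {fset primeT}, {measure set (QT_borel T d) -> \bar R})
    (U : forall p : primeT, set 'rV[Qp p]_d)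
    (f : forall p : primeT, 'rV[Qp p]_d -> 'rV[Qp p]_m)
    (tau : 'I_(d + m) -> primeT -> R) (v : S) :
  (0 < d)%N -> (forall T, is_haar (mu T)) ->
  (forall i v, v \in S -> 0 < tau i v) ->
  (forall j v, v \in S -> avg_weight tau v < tau j v) ->
  ((min_weight tau (val v) <= 1)%E ->
     (dioph_exponent_graph (mu (S `\ val v)%fset) U f (reduced_weight tau (val v))
       < (1 - avg_weight tau (val v))%:E / (1 - min_weight tau (val v)))%E) ->
  (mu S).-negligible [set x | [/\ ZT x, @graph_dom S d U x & ~ generic_at f tau x v]].
Proof.
move=> d0 haar tau0 avg_lt hexp.
have n0 : (0 < d + m)%N by rewrite addn_gt0 d0.
have [i0 [minE mini0]] := min_weight_attained tau (val v) n0.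
set u := tau i0 (val v) in minE mini0; set av := avg_weight tau (val v) in hexp *.
have u0 : 0 < u by exact: (tau0 i0 _ (fsvalP v)).
have avu : av < u by exact: (avg_lt i0 _ (fsvalP v)).
have [u1|u1] := ltP 1 u.
  apply: negligibleS (negligible_set0 _) => x [_ _ ng]; apply: ng.
  by exists u; split=> //; left.
have : (min_weight tau (val v) <= 1)%E by rewrite minE lee_fin.
move=> /hexp/ereal_inf_lt[_ [w aew <-]]; rewrite minE => wlt.
have av1 : av < 1 by exact: lt_le_trans u1.
have [w' [w'0 ww' uw']] : exists w' : R, [/\ 0 <= w', w < w' & (1 - u) * w' < 1 - av].
  have [u1'|u1'] := eqVneq u 1.
    exists (Num.max w 0 + 1); split; first by rewrite addr_ge0// le_max lexx orbT.
      by rewrite ltr_pwDr// le_max lexx.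
    by rewrite u1' subrr mul0r subr_gt0.
  have u1'' : 0 < 1 - u by rewrite subr_gt0 lt_neqAle u1'.
  have wlt' : w < (1 - av) / (1 - u).
    by move: wlt; rewrite -[(1 - u%:E)%E]/((1 - u)%:E) inver (gt_eqF u1'') -EFinM lte_fin.
  have t0 : Num.max w 0 < (1 - av) / (1 - u) by rewrite gt_max wlt' divr_gt0// subr_gt0.
  exists ((Num.max w 0 + (1 - av) / (1 - u)) / 2).
  have [h1 h2] := midf_lt t0; split.
  - by rewrite (le_trans _ (ltW h1))// le_max lexx orbT.
  - by rewrite (le_lt_trans _ h1)// le_max lexx.
  - by rewrite mulrC -ltr_pdivlMr.
have neg := negligible_restrict (haar S) (haar _) (fsubD1set S (val v)) aew.
apply: negligibleS neg => x [xZ xU ng]; split=> //= hx; apply: ng.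
exists u; split=> //; right; split=> //; exists w'; split=> //.
have := hx (fun s => xU (fincl (fsubD1set S (val v)) s)); rewrite /dioph_exponent => hle.
apply: contrapT => inf; have : (w'%:E <= w%:E)%E.
  by apply: le_trans hle; apply: ereal_sup_ubound; exists w'.
by rewrite lee_fin leNgt ww'.
Qed.

(* U, f and tau are families over all primes of which only the values at the
   primes of S matter.
   The quotient in the last hypothesis is taken in \bar R, where
   x / 0 = +oo for x > 0: no condition is imposed when the minimum is 1. *)
Theorem theorem8p10 (R : realType) (S : {fset primeT}) (d m : nat)
    (mu : forall T : {fset primeT}, {measure set (QT_borel T d) -> \bar R})
    (U : forall p : primeT, set 'rV[Qp p]_d)
    (f : forall p : primeT, 'rV[Qp p]_d -> 'rV[Qp p]_m)
    (tau : 'I_(d + m) -> primeT -> R) :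
  S != fset0 -> (0 < d)%N -> (0 < m)%N ->
  (forall T, is_haar (mu T)) ->
  (forall v, v \in S -> [/\ open (U v), U v `<=` Zp_vec v d,
     f v @` U v `<=` Zp_vec v m & Ck_on 2 (U v) (f v)]) ->
  (forall i v, v \in S -> 0 < tau i v) ->
  \sum_(i < d + m) \sum_(v <- S) tau i v = (d + m).+1%:R ->
  (forall v, v \in S ->
     (\big[maxe/-oo]_(j < m) (tau (rshift d j) v)%:E
       <= \big[mine/+oo]_(i < d) (tau (lshift m i) v)%:E)%E) ->
  (forall j v, v \in S -> avg_weight tau v < tau j v) ->
  (forall v, v \in S -> (min_weight tau v <= 1)%E ->
     (dioph_exponent_graph (mu (S `\ v)%fset) U f (reduced_weight tau v)
       < (1 - avg_weight tau v)%:E / (1 - min_weight tau v))%E) ->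
  mu S [set x | (forall v : S, U (val v) (x v)) /\
                bad_set tau (graph_map f x)] = 0%E.
Proof.
move=> S0 d0 m0 haar hU tau0 tau_sum tau_ord avg_lt hexp.
have n0 : (0 < d + m)%N by rewrite addn_gt0 d0.
have tau_order i j v : v \in S -> tau (rshift d j) v <= tau (lshift m i) v.
  move=> vS; rewrite -lee_fin.
  apply: le_trans (le_trans _ (tau_ord v vS)) _; last exact: bigmin_le_cond.
  exact: (le_bigmax _ (fun j => (tau (rshift d j) v)%:E) j).
pose dom := @graph_dom S d U.
pose Exc (v : S) : set (QT_borel S d) := [set x | [/\ ZT x, dom x & ~ generic_at f tau x v]].
have ExcN v : (mu S).-negligible (Exc v).
  by apply: generic_ae => //; exact/hexp/fsvalP.
pose Unc (p : nat * nat * nat) : set (QT_borel S d) := [set x | [/\ uncovered U f tau p.1.1 p.1.2 x,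
  derivative_bound U f x p.2 & forall v : S, generic_at f tau x v]].
have UncN p : (mu S).-negligible (Unc p) by exact: negligible_uncovered.
set X := [set x | _].
have mX : measurable (X : set (QT_borel S d)).
  pose W c : set (QT_borel S d) := [set x | dom x /\ approx_set c tau (graph_map f x)].
  have mW c : measurable (W c) by exact: measurable_approx_set.
  rewrite (_ : X = W 1 `\` \bigcap_(k : nat) W k.+1%:R^-1); last first.
    apply/seteqP; split=> x.
      by move=> [xU [x1 nx]]; split=> // h; apply: nx => k _; have [] := h k I.
    by move=> [[xU x1] nx]; split=> //; split=> // h; apply: nx => k _; split=> //; exact: h.
  by apply: measurableD => //; exact: bigcap_measurable.
apply/negligibleP => //.
have negU := negligibleU (negligible_bigcup_count ExcN) (negligible_bigcup_count UncN).
apply: negligibleS negU => x [xU [_ /existsNP[k /not_implyP[_ nk]]]].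
have [[v ng]|gen] := pselect (exists v : S, ~ generic_at f tau x v).
  by left; exists v => //; split=> //; exact: (graph_domZ hU xU).
have {}gen v : generic_at f tau x v by apply: contrapT => ng; apply: gen; exists v.
right; have [s hs] := derivative_bound_ex hU xU.
have [N0 hN0] : exists N0, forall H, (N0 <= H)%N -> ~ approximable U f tau k.+1%:R^-1 H x.
  apply: contrapT => h; apply: nk; apply: (frequently_approximable hU) => //.
  move=> N; apply: contrapT => hN; apply: h; exists N => H NH Hx; apply: hN.
  by exists H.
exists (k, N0, s) => //; split=> //; split=> // -[H NH Hx].
exact: hN0 NH Hx.
Qed.
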